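(* Under the Borda rule, both DOMINATION with partial orders and DOMINATING MANIPULATION with partial orders are NP-hard, even when in each partial order of the non-manipulators' profile the number of pairs of alternatives left unordered is at most $4$.
   Context: Alternatives $\mathcal C=\{c_1,\ldots,c_m\}$; Borda gives $m-i$ points for position $i$, highest total wins, ties broken according to a fixed linear order on the alternatives. There are $n$ non-manipulators and one manipulator with true preferences $V_M$ (a linear order). The manipulator's information is a profile $P_{po}=(O_1,\ldots,O_n)$ of partial orders; the information set $E$ is the set of all profiles $(V_1,\ldots,V_n)$ of linear orders with each $V_i$ extending $O_i$. A vote $U$ dominates a vote $V$ if for every $P\in E$, $r(P\cup\{U\})$ is ranked weakly above $r(P\cup\{V\})$ in $V_M$, and for some $P'\in E$ strictly above. DOMINATION: given $P_{po}$, $V_M$ and linear orders $V,U$, does $U$ dominate $V$? DOMINATING MANIPULATION: given $P_{po}$ and $V_M$, does there exist a linear order $V'$ that dominates $V_M$? The number of unknown pairs of a partial order is the number of unordered pairs of alternatives that are incomparable in it. *)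

(* Defs.v *)
From mathcomp Require Import all_boot all_order.
From mathcomp Require Import fingroup perm.
Set Implicit Arguments. Unset Strict Implicit. Unset Printing Implicit Defensive.

(* Deterministic single-tape Turing machines over the input alphabet    *)
(* {0,1} with tape alphabet {0,1,blank} (blank = None), two-way         *)
(* infinite tape.  States are 'I_(tm_q M).+1, the start state is ord0;  *)
(* the machine halts when the transition function returns None.          *)

Inductive move := MoveL | MoveR | MoveS.

Record TM := mkTM {
  tm_q : nat;
  tm_delta : 'I_tm_q.+1 -> option bool ->
             option ('I_tm_q.+1 * option bool * move) }.

(* configuration: state, left part of tape (nearest cell first),
   symbol under the head, right part of tape (nearest cell first) *)
Definition config (M : TM) :=
  ('I_(tm_q M).+1 * seq (option bool) * option bool * seq (option bool))%type.

Definition step (M : TM) (c : config M) : option (config M) :=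
  let: (q, l, h, r) := c in
  match tm_delta q h with
  | None => None
  | Some (q', w, mv) =>
    Some match mv with
    | MoveL => match l with
               | [::] => (q', [::], None, w :: r)
               | a :: l' => (q', l', a, w :: r) end
    | MoveR => match r with
               | [::] => (q', w :: l, None, [::])
               | a :: r' => (q', w :: l, a, r') end
    | MoveS => (q', l, w, r)
    end
  end.

Definition halted (M : TM) (c : config M) : bool :=
  if step c is None then true else false.

Definition run (M : TM) (t : nat) (c : config M) : config M :=
  iter t (fun c => if step c is Some c' then c' else c) c.

Definition init (M : TM) (x : seq bool) : config M :=
  match x with
  | [::] => (ord0, [::], None, [::])
  | b :: x' => (ord0, [::], Some b, map Some x')
  end.

Fixpoint read_word (s : seq (option bool)) : seq bool :=
  match s with
  | Some b :: s' => b :: read_word s'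
  | _ => [::]
  end.

Definition output (M : TM) (c : config M) : seq bool :=
  let: (_, _, h, r) := c in read_word (h :: r).

Definition poly_time_fun (f : seq bool -> seq bool) : Prop :=
  exists (M : TM) (k : nat), forall x : seq bool, exists t : nat,
    t <= size x ^ k + k /\ halted (run t (init M x)) /\
    output (run t (init M x)) = f x.

Definition language := seq bool -> Prop.

Definition in_P (L : language) : Prop :=
  exists f, poly_time_fun f /\ forall x, L x <-> f x = [:: true].

(* self-delimiting pairing of words *)
Definition pair_enc (x w : seq bool) : seq bool :=
  flatten [seq [:: b; b] | b <- x] ++ [:: false; true] ++ w.

Definition in_NP (L : language) : Prop :=
  exists (V : language) (k : nat), in_P V /\
    forall x, L x <-> exists w : seq bool, size w <= size x ^ k + k /\ V (pair_enc x w).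

Definition karp_reduces (L1 L2 : language) : Prop :=
  exists f, poly_time_fun f /\ forall x, L1 x <-> L2 (f x).

Definition NP_hard (L : language) : Prop :=
  forall L', in_NP L' -> karp_reduces L' L.

(* Alternatives are 'I_m (c_1,...,c_m are indices 0..m-1).               *)
(* A linear order (vote) is a bijection v : {perm 'I_m} sending each      *)
(* alternative to its position (0 = top).  A partial order is a strict   *)
(* partial order O : rel 'I_m, "O a b" meaning a is ranked above b.       *)

Section Voting.
Variable m : nat.
Local Notation alt := 'I_m.

Definition strict_partial_order (O : rel alt) : Prop :=
  (forall a, ~~ O a a) /\ (forall a b c, O a b -> O b c -> O a c).

Definition extends (v : {perm alt}) (O : rel alt) : Prop :=
  forall a b, O a b -> v a < v b.

Definition unknown_pairs (O : rel alt) : nat :=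
  #|[set p : alt * alt | (p.1 < p.2) && ~~ O p.1 p.2 && ~~ O p.2 p.1]|.

Definition borda_score (P : seq {perm alt}) (c : alt) : nat :=
  \sum_(v <- P) (m.-1 - v c).

(* c = r(P): c has maximum Borda score, ties broken by the fixed linear
   order c_1 > c_2 > ... > c_m (smallest index wins). *)
Definition borda_winner (P : seq {perm alt}) (c : alt) : Prop :=
  (forall d, borda_score P d <= borda_score P c) /\
  (forall d, borda_score P d = borda_score P c -> c <= d).

Definition in_info_set (Po : seq (rel alt)) (P : seq {perm alt}) : Prop :=
  size P = size Po /\ forall i, i < size Po ->
    extends (nth 1%g P i) (nth (fun _ _ => false) Po i).

Definition weakly_better (VM U V : {perm alt}) (P : seq {perm alt}) : Prop :=
  forall w1 w2, borda_winner (U :: P) w1 -> borda_winner (V :: P) w2 ->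
    VM w1 <= VM w2.

Definition strictly_better (VM U V : {perm alt}) (P : seq {perm alt}) : Prop :=
  exists w1 w2, borda_winner (U :: P) w1 /\ borda_winner (V :: P) w2 /\
    VM w1 < VM w2.

Definition dominates (Po : seq (rel alt)) (VM U V : {perm alt}) : Prop :=
  (forall P, in_info_set Po P -> weakly_better VM U V P) /\
  (exists P, in_info_set Po P /\ strictly_better VM U V P).

Definition rel_bits (O : rel alt) : seq bool :=
  [seq O a b | a <- enum alt, b <- enum alt].
Definition perm_bits (v : {perm alt}) : seq bool :=
  [seq v a == i | a <- enum alt, i <- enum alt].
End Voting.

Definition unary (k : nat) : seq bool := nseq k true ++ [:: false].

Definition enc_profile m (Po : seq (rel 'I_m)) : seq bool :=
  unary m ++ unary (size Po) ++ flatten (map (@rel_bits m) Po).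

Definition enc_domination m (Po : seq (rel 'I_m)) (VM V U : {perm 'I_m}) :=
  enc_profile Po ++ perm_bits VM ++ perm_bits V ++ perm_bits U.

Definition enc_dom_manip m (Po : seq (rel 'I_m)) (VM : {perm 'I_m}) :=
  enc_profile Po ++ perm_bits VM.

Definition admissible m (Po : seq (rel 'I_m)) : Prop :=
  forall i, i < size Po ->
    let O := nth (fun _ _ => false) Po i in
    strict_partial_order O /\ unknown_pairs O <= 4.

Definition DOMINATION_4 : language := fun x =>
  exists m (Po : seq (rel 'I_m)) (VM V U : {perm 'I_m}),
    x = enc_domination Po VM V U /\ admissible Po /\ dominates Po VM U V.

Definition DOMINATING_MANIPULATION_4 : language := fun x =>
  exists m (Po : seq (rel 'I_m)) (VM : {perm 'I_m}),
    x = enc_dom_manip Po VM /\ admissible Po /\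
    exists V' : {perm 'I_m}, dominates Po VM V' VM.

(* Main.v *)
From Stdlib Require Import ZArith FunctionalExtensionality.
Require Import Defs.
From mathcomp Require Import all_boot all_order zify.
From mathcomp Require Import fingroup perm.
Set Implicit Arguments. Unset Strict Implicit. Unset Printing Implicit Defensive.

(* The Cook-Levin theorem is proved for formulas in conjunctive normal form with clauses of any
   width, and satisfiability is then reduced to the two manipulation problems.

   Polynomial time is handled by a class PF of numerical functions generated by bounded sums: they
   are computed by programs on unary counters, which are compiled to structured tape programs and
   these to Turing machines.  A word whose length and letters are in PF is thus computable in
   polynomial time, and the instances of the reduction are given letter by letter.

   In the reduction each partial vote is a linear order in which the top candidate is released
   from the next one or three candidates, followed by the reverse of that order, so that a pair of
   votes only transfers a few points from its top candidate.  The only useful insincere vote swaps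
   e and f.  As f never wins, the swap matters only if it takes the victory away from e, which then
   goes to a candidate ranked above e; so it dominates the true vote iff e can win, and the scores
   are such that e wins iff a satisfying assignment is encoded by the transfers.  The pairs of
   votes with one free transfer let any y_i and y_(i+1), or c0 and z, compete for victory, which
   makes every vote other than the true one and the swapped one harmful in some completion. *)

(** * Structured tape programs *)

(** Since each vote may leave only a few pairs open, no single vote can carry the value of a
    variable to all clauses. Hence every variable has a copy at each clause, and a cyclic chain of
    comparisons through the [l] candidates forces the copies to agree. A choice needs three
    recipients: [d] makes the two choices at a node exclusive, [l] links consecutive clauses, and
    [u] records a literal that fails the clause, [f] being a harmless sink otherwise. So three
    released pairs stay within the limit of four, and a clause of any width is one inequality on the
    total received by its [u].

    Transfers conserve points, so prescribed leads need a donor: [f] pays for all of them and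
    thereby falls behind [c0] whatever the manipulator votes. Ties favour small indices, so [e],
    which comes after all [x], [d], [l], [u] and [c0], can beat these only strictly. Under the true
    vote [c0] trails [e] by at most one point, which is what makes moving [e] down one place
    decisive. *)

Notation sym := (option bool).
Definition tape := Z -> sym.

Definition upd (T : tape) (p : Z) (s : sym) : tape :=
  fun i => if Z.eqb i p then s else T i.

Definition dz (m : move) : Z :=
  match m with MoveL => (-1)%Z | MoveR => 1%Z | MoveS => 0%Z end.

(** The tape relative to the head, which is at cell 0. Cells beyond the lists read as blank, so the
    blanks that the machine appends at the ends are invisible. *)
Definition cells (l : seq sym) (h : sym) (r : seq sym) : tape :=
  fun i => if (i <? 0)%Z then nth None l (Z.to_nat (- 1 - i))
           else nth None (h :: r) (Z.to_nat i).

Definition state_of M (c : config M) : 'I_(tm_q M).+1 := c.1.1.1.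
Definition cells_of M (c : config M) : tape := cells c.1.1.2 c.1.2 c.2.

Lemma Z_nat_cases (i : Z) :
  (exists n, i = Z.of_nat n) \/ (exists n, i = (- 1 - Z.of_nat n)%Z).
Proof.
case: (Z.ltb_spec i 0) => ?; [right; exists (Z.to_nat (- 1 - i))|
  left; exists (Z.to_nat i)]; lia.
Qed.

Lemma cells_ge0 l h r n : cells l h r (Z.of_nat n) = nth None (h :: r) n.
Proof.
rewrite /cells; case: Z.ltb_spec => [?|_]; first by lia.
by rewrite Nat2Z.id.
Qed.

Lemma cells_lt0 l h r n : cells l h r (- 1 - Z.of_nat n)%Z = nth None l n.
Proof.
rewrite /cells; case: Z.ltb_spec => [_|?]; last by lia.
by congr nth; lia.
Qed.

Lemma cells_shift a l h r i : cells (a :: l) h r i = cells l a (h :: r) (i + 1)%Z.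
Proof.
case: (Z_nat_cases i) => [[n ->]|[[|n] ->]].
- have -> : (Z.of_nat n + 1)%Z = Z.of_nat n.+1 by lia.
  by rewrite !cells_ge0.
- by rewrite cells_lt0 (_ : (_ + 1)%Z = Z.of_nat 0) ?cells_ge0.
- have -> : (- 1 - Z.of_nat n.+1 + 1)%Z = (- 1 - Z.of_nat n)%Z by lia.
  by rewrite !cells_lt0.
Qed.

Lemma cells_write l h r w i : cells l w r i = upd (cells l h r) 0%Z w i.
Proof.
rewrite /upd; case: (Z_nat_cases i) => [[[|n] ->]|[n ->]] //;
  rewrite ?cells_ge0 ?cells_lt0; case: Z.eqb_spec => // ?; lia.
Qed.

Lemma cells_blank_left h r : cells [::] h r = cells [:: None] h r.
Proof.
apply: functional_extensionality => i.
by case: (Z_nat_cases i) => [[n ->]|[n ->]];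
  rewrite ?cells_ge0 ?cells_lt0 //; case: n => [|[]].
Qed.

Lemma cells_blank_right l h : cells l h [::] = cells l h [:: None].
Proof.
apply: functional_extensionality => i.
by case: (Z_nat_cases i) => [[n ->]|[n ->]];
  rewrite ?cells_ge0 ?cells_lt0 //; case: n => [|[|[]]].
Qed.

Lemma step_cells M (c : config M) q' w mv :
  tm_delta (state_of c) (cells_of c 0%Z) = Some (q', w, mv) ->
  exists c', [/\ step c = Some c', state_of c' = q' &
    forall i, cells_of c' i = upd (cells_of c) 0%Z w (i + dz mv)%Z].
Proof.
case: c => [[[q l] h] r]; rewrite /state_of /cells_of [c in c _ -> _]/=.
rewrite (cells_ge0 _ _ _ 0) /= => E.
rewrite /step E; eexists; split; [reflexivity|by case: mv {E} => //; case: l => [|? ?] //; case: r|].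
move=> i; rewrite /= -cells_write; case: mv {E} => /=; last by rewrite Z.add_0_r.
- case: l => [|a l]; rewrite /= ?(cells_blank_left w) cells_shift;
    by congr cells; lia.
- by case: r => [|a r]; rewrite /= ?(cells_blank_right l) cells_shift.
Qed.

Lemma step_None M (c : config M) :
  tm_delta (state_of c) (cells_of c 0%Z) = None -> step c = None.
Proof.
case: c => [[[q l] h] r]; rewrite /state_of /cells_of [c in c _ -> _]/=.
by rewrite (cells_ge0 _ _ _ 0) /step /= => ->.
Qed.

Lemma output_cells M (c : config M) (w : seq bool) :
  (forall i, cells_of c (Z.of_nat i) = nth None (map Some w) i) -> output c = w.
Proof.
case: c => [[[q l] h] r]; rewrite /cells_of /=.
move=> H; have {}H i : nth None (h :: r) i = nth None (map Some w) i.
  by rewrite -H cells_ge0.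
elim: w h r H => [|b w IH] h r H; first by have /= -> := H 0.
have /= -> /= := H 0; congr cons; case: r H => [|h' r] H.
  by case: w {IH} H => // b' w /(_ 1).
by apply: IH => i; apply: (H i.+1).
Qed.

Lemma init_cells M (x : seq bool) i :
  cells_of (init M x) i =
  if (i <? 0)%Z then None else nth None (map Some x) (Z.to_nat i).
Proof.
case: (Z_nat_cases i) => [[n ->]|[n ->]]; case: Z.ltb_spec => //; try lia.
  by case: x => [|b x] _; rewrite /cells_of cells_ge0 Nat2Z.id //=; case: n => [|[]].
by case: x => [|b x]; rewrite /cells_of cells_lt0 nth_nil.
Qed.

(* The position before the first input cell is the origin, so that the input occupies 1, 2, ... *)
Definition rep M (c : config M) (q : nat) (T : tape) (p : Z) : Prop :=
  state_of c = q :> nat /\ forall i, cells_of c i = T (p + i)%Z.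

(** States are plain numbers here, so that code can be laid out at arbitrary offsets; [TM_of]
    returns to the bounded type. *)
Definition nmach := nat -> sym -> option (nat * sym * move).

Inductive nrun (D : nmach) : nat -> nat -> tape -> Z -> nat -> tape -> Z -> Prop :=
| nrun0 q T p : nrun D 0 q T p q T p
| nrunS n q T p q1 w m q2 T2 p2 : D q (T p) = Some (q1, w, m) ->
    nrun D n q1 (upd T p w) (p + dz m)%Z q2 T2 p2 -> nrun D n.+1 q T p q2 T2 p2.

Lemma nrun_trans D n1 q T p q1 T1 p1 : nrun D n1 q T p q1 T1 p1 ->
  forall n2 q2 T2 p2, nrun D n2 q1 T1 p1 q2 T2 p2 ->
  nrun D (n1 + n2) q T p q2 T2 p2.
Proof.
elim=> {n1 q T p q1 T1 p1} //= n q T p q1 w m q2 T2 p2 E _ IH n2 q3 T3 p3 H.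
by apply: nrunS E _; apply: IH.
Qed.

Definition TM_of (N : nat) (D : nmach) : TM :=
  @mkTM N (fun q s => omap (fun a => (inord a.1.1, a.1.2, a.2)) (D q s)).

(** [inord] is faithful only up to [N], hence the bound on all target states. *)
Lemma nrun_TM N (D : nmach) n q T p q' T' p' :
  (forall q1 s a, D q1 s = Some a -> a.1.1 <= N) -> q <= N ->
  nrun D n q T p q' T' p' ->
  forall c : config (TM_of N D), rep c q T p -> rep (run n c) q' T' p'.
Proof.
move=> DN qN H; elim: H qN => {n q T p q' T' p'} //.
move=> n q T p q1 w m q2 T2 p2 E _ IH qN c [Hq HT].
have [|c' [S1 S2 S3]] := @step_cells _ c (inord q1) w m.
  by rewrite /= Hq HT Z.add_0_r E.
rewrite /run iterSr S1; apply: IH; first exact: DN E.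
have q1N := DN _ _ _ E; split; first by rewrite S2 inordK.
move=> i; rewrite S3 /upd HT.
by do 2 case: Z.eqb_spec => ?; rewrite ?S3 //; try lia; congr T; lia.
Qed.

Inductive tprog :=
| Act of (sym -> sym * move)
| TSeq of tprog & tprog
| TIf of pred sym & tprog & tprog
| TWhile of pred sym & tprog.

Fixpoint tlen (P : tprog) : nat :=
  match P with
  | Act _ => 1
  | TSeq a b => tlen a + tlen b
  | TIf _ a b => (tlen a + tlen b).+1
  | TWhile _ a => (tlen a).+1
  end.

(* The code of P occupies the states off, ..., off + tlen P - 1, is entered at off and left to ex. *)
Fixpoint tdelta (P : tprog) (off ex : nat) : nmach := fun q s =>
  match P with
  | Act f => Some (ex, (f s).1, (f s).2)
  | TSeq a b => if q < off + tlen a then tdelta a off (off + tlen a) q s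
                else tdelta b (off + tlen a) ex q s
  | TIf t a b =>
      if q == off then Some (if t s then off.+1 else off.+1 + tlen a, s, MoveS)
      else if q < off.+1 + tlen a then tdelta a off.+1 ex q s
      else tdelta b (off.+1 + tlen a) ex q s
  | TWhile t a =>
      if q == off then Some (if t s then off.+1 else ex, s, MoveS)
      else tdelta a off.+1 off q s
  end.

Inductive texec : tprog -> tape -> Z -> nat -> tape -> Z -> Prop :=
| EAct f T p : texec (Act f) T p 1 (upd T p (f (T p)).1) (p + dz (f (T p)).2)%Z
| ESeq a b T p n1 T1 p1 n2 T2 p2 : texec a T p n1 T1 p1 -> texec b T1 p1 n2 T2 p2 ->
    texec (TSeq a b) T p (n1 + n2) T2 p2
| EIfT (t : pred sym) a b T p n T1 p1 : t (T p) -> texec a T p n T1 p1 ->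
    texec (TIf t a b) T p n.+1 T1 p1
| EIfF (t : pred sym) a b T p n T1 p1 : ~~ t (T p) -> texec b T p n T1 p1 ->
    texec (TIf t a b) T p n.+1 T1 p1
| EWhileF (t : pred sym) a T p : ~~ t (T p) -> texec (TWhile t a) T p 1 T p
| EWhileT (t : pred sym) a T p n1 T1 p1 n2 T2 p2 : t (T p) -> texec a T p n1 T1 p1 ->
    texec (TWhile t a) T1 p1 n2 T2 p2 ->
    texec (TWhile t a) T p (n1 + n2).+1 T2 p2.

Lemma upd_id (T : tape) p : upd T p (T p) = T.
Proof.
by apply: functional_extensionality => i; rewrite /upd; case: Z.eqb_spec => // ->.
Qed.

Lemma tlen_gt0 P : 0 < tlen P.
Proof. by elim: P => //= *; lia. Qed.

(** [D] need agree with [tdelta] only on the states of the current block, which lets the induction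
    descend to subprograms of a larger table. *)
Lemma texec_nrun (D : nmach) P T p n T' p' : texec P T p n T' p' ->
  forall off ex,
  (forall q s, off <= q < off + tlen P -> D q s = tdelta P off ex q s) ->
  nrun D n off T p ex T' p'.
Proof.
elim=> {P T p n T' p'}.
- move=> f T p off ex H; apply: nrunS; last exact: nrun0.
  by rewrite H //=; lia.
- move=> a b T p n1 T1 p1 n2 T2 p2 _ IHa _ IHb off ex H.
  apply: (nrun_trans (IHa off (off + tlen a) _)) => [q s Hq|].
    by rewrite H /=; [case: ltnP => //; lia | lia].
  apply: IHb => q s Hq; rewrite H /=; [case: ltnP => //; lia | lia].
- move=> t a b T p n T1 p1 tT _ IH off ex H.
  apply: nrunS; first by rewrite H /= ?eqxx ?tT //; lia.
  rewrite upd_id Z.add_0_r; apply: IH => q s Hq; rewrite H /=; last by lia.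
  by case: eqP => [?|_]; [lia|]; case: ltnP => //; lia.
- move=> t a b T p n T1 p1 /negbTE tT _ IH off ex H.
  apply: nrunS; first by rewrite H /= ?eqxx ?tT //; lia.
  rewrite upd_id Z.add_0_r; apply: IH => q s Hq; rewrite H /=; last by lia.
  by case: eqP => [?|_]; [lia|]; case: ltnP => //; lia.
- move=> t a T p /negbTE tT off ex H.
  apply: nrunS; first by rewrite H /= ?eqxx ?tT //; lia.
  by rewrite upd_id Z.add_0_r; apply: nrun0.
- move=> t a T p n1 T1 p1 n2 T2 p2 tT _ IHa _ IHb off ex H.
  apply: nrunS; first by rewrite H /= ?eqxx ?tT //; lia.
  rewrite upd_id Z.add_0_r; apply: (nrun_trans (IHa off.+1 off _)); last exact: IHb.
  by move=> q s Hq; rewrite H /=; [case: eqP => //; lia|lia].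
Qed.

Lemma tdelta_bound P off ex q s a : tdelta P off ex q s = Some a ->
  off <= q < off + tlen P -> a.1.1 <= maxn (off + tlen P) ex.
Proof.
elim: P off ex => [f|b IHb c IHc|t b IHb c IHc|t b IHb] off ex /=.
- by case=> <- /= _; lia.
- by case: ltnP => H1 => [/IHb|/IHc] IH ?; move: IH; lia.
- have := (tlen_gt0 b, tlen_gt0 c) => -[? ?].
  case: eqP => H1; first by case=> <- /=; case: (t s); lia.
  by case: ltnP => H2 => [/IHb|/IHc] IH ?; move: IH; lia.
- have := tlen_gt0 b.
  case: eqP => H1 ?; first by case=> <- /=; case: (t s); lia.
  by move=> /IHb IH ?; move: IH; lia.
Qed.

Definition tape_in (x : seq bool) : tape := fun i =>
  if (i <? 1)%Z then None else nth None (map Some x) (Z.to_nat (i - 1)).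

Lemma poly_time_tprog (P : tprog) (f : seq bool -> seq bool) k :
  (forall x, exists n T p, [/\ texec P (tape_in x) 1 n T p, n <= size x ^ k + k &
     forall i, T (p + Z.of_nat i)%Z = nth None (map Some (f x)) i]) ->
  poly_time_fun f.
Proof.
move=> H; set N := tlen P.
(* State [N] lies just past the code; leaving [D] undefined there makes it the halting state. *)
pose D : nmach := fun q s => if q < N then tdelta P 0 N q s else None.
have DN q1 s a : D q1 s = Some a -> a.1.1 <= N.
  by rewrite /D; case: ltnP => // q1N /tdelta_bound; rewrite /N in q1N *; lia.
exists (TM_of N D), k => x; have [n [T [p [E nk HT]]]] := H x.
exists n; split=> //.
have R : nrun D n 0 (tape_in x) 1 N T p.
  by apply: (texec_nrun E) => q s; rewrite add0n => /= Hq; rewrite /D Hq.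
have [|Q1 Q2] := nrun_TM DN (leq0n _) R (c := init (TM_of N D) x).
  split; first by case: (x).
  move=> i; rewrite init_cells /tape_in.
  by do 2 case: Z.ltb_spec => //; try lia; move=> *; congr nth; lia.
split.
  rewrite /halted step_None //=.
  by rewrite Q1 /D ltnn.
by apply: output_cells => i; rewrite Q2.
Qed.

(** * Counter programs on a tape *)

(** A time bound instead of the exact time, so that costs can be weakened freely when programs are
    composed. *)
Definition texb P T p B T' p' := exists2 n, n <= B & texec P T p n T' p'.

Lemma texb_le P T p B1 B2 T' p' : B1 <= B2 -> texb P T p B1 T' p' -> texb P T p B2 T' p'.
Proof. by move=> H [n Hn E]; exists n => //; lia. Qed.

Lemma texb_act f T p : texb (Act f) T p 1 (upd T p (f (T p)).1) (p + dz (f (T p)).2)%Z.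
Proof. by exists 1 => //; apply: EAct. Qed.

Lemma texb_seq a b T p B1 T1 p1 B2 T2 p2 : texb a T p B1 T1 p1 -> texb b T1 p1 B2 T2 p2 ->
  texb (TSeq a b) T p (B1 + B2) T2 p2.
Proof. by move=> [n Hn E] [m Hm F]; exists (n + m); [lia|apply: ESeq E F]. Qed.

Lemma texb_if (t : pred sym) a b T p B T' p' :
  texb (if t (T p) then a else b) T p B T' p' -> texb (TIf t a b) T p B.+1 T' p'.
Proof.
by case: ifP => [H|/negbT H] [n Hn E]; exists n.+1 => //; [apply: EIfT|apply: EIfF].
Qed.

Lemma texb_while0 (t : pred sym) a T p : ~~ t (T p) -> texb (TWhile t a) T p 1 T p.
Proof. by exists 1 => //; apply: EWhileF. Qed.

Lemma texb_whileS (t : pred sym) a T p B1 T1 p1 B2 T2 p2 : t (T p) ->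
  texb a T p B1 T1 p1 -> texb (TWhile t a) T1 p1 B2 T2 p2 ->
  texb (TWhile t a) T p (B1 + B2).+1 T2 p2.
Proof. by move=> H [n Hn E] [m Hm F]; exists (n + m).+1; [lia|apply: EWhileT E F]. Qed.

Definition go m := Act (fun s => (s, m)).
Definition wr a := Act (fun _ => (a, MoveS)).

Fixpoint mvn m k := if k is k'.+1 then TSeq (go m) (mvn m k') else go MoveS.

Lemma texb_go m T p : texb (go m) T p 1 T (p + dz m)%Z.
Proof. by have := texb_act (fun s => (s, m)) T p; rewrite upd_id. Qed.

Lemma texb_wr a T p : texb (wr a) T p 1 (upd T p a) p.
Proof. by have := texb_act (fun s => (a, MoveS)) T p; rewrite Z.add_0_r. Qed.

Lemma texb_mvn m k T p p' : p' = (p + Z.of_nat k * dz m)%Z -> texb (mvn m k) T p k.+1 T p'.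
Proof.
move=> ->; elim: k p => [|k IH] p.
  by have := texb_go MoveS T p; congr texb.
have := texb_seq (texb_go m T p) (IH (p + dz m)%Z); congr texb; lia.
Qed.

Definition setr (rg : nat -> nat) r v := fun i => if i == r then v else rg i.

Definition is1 : pred sym := fun s => s == Some true.
Definition non1 : pred sym := fun s => s != Some true.
Definition nonblank : pred sym := fun s => s != None.

Inductive cprog :=
| CInc of nat
| CDec of nat
| CBit of nat & nat
| COut of nat
| CSeq of cprog & cprog
| CWhile of nat & cprog.

Definition cstate := ((nat -> nat) * seq bool)%type.

(* CBit r s increments register s if bit number (register r) of the read-only word d is set;
   COut r appends to the output whether register r is positive. *)
Inductive cexec (d : seq bool) : cprog -> cstate -> nat -> cstate -> Prop :=
| XInc r rg o : cexec d (CInc r) (rg, o) 1 (setr rg r (rg r).+1, o)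
| XDec r rg o : cexec d (CDec r) (rg, o) 1 (setr rg r (rg r).-1, o)
| XBit r s rg o : cexec d (CBit r s) (rg, o) 1
    (setr rg s (rg s + nth false d (rg r)), o)
| XOut r rg o : cexec d (COut r) (rg, o) 1 (rg, rcons o (0 < rg r))
| XSeq a b s n1 s1 n2 s2 : cexec d a s n1 s1 -> cexec d b s1 n2 s2 ->
    cexec d (CSeq a b) s (n1 + n2) s2
| XWhile0 r a s : s.1 r = 0 -> cexec d (CWhile r a) s 1 s
| XWhileS r a s n1 s1 n2 s2 : 0 < s.1 r -> cexec d a s n1 s1 ->
    cexec d (CWhile r a) s1 n2 s2 -> cexec d (CWhile r a) s (n1 + n2).+1 s2.

Fixpoint cwf NR (c : cprog) : bool :=
  match c with
  | CInc r | CDec r | COut r => r < NR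
  | CBit r s => (r < NR) && (s < NR)
  | CSeq a b => cwf NR a && cwf NR b
  | CWhile r a => (r < NR) && cwf NR a
  end.

Definition cbound m (s : cstate) := (forall r, s.1 r <= m) /\ size s.2 <= m.

(** Registers and output grow by at most one per step, so the elapsed time bounds the length of
    every walk on the tape. *)
Lemma cexec_bound d c s n s' : cexec d c s n s' ->
  0 < n /\ forall m, cbound m s -> cbound (m + n) s'.
Proof.
elim=> {c s n s'} /=.
- move=> r rg o; split=> // m [/= H1 H2]; split=> /= [r'|]; last by lia.
  by rewrite /setr; case: eqP => _; [have := H1 r|have := H1 r']; lia.
- move=> r rg o; split=> // m [/= H1 H2]; split=> /= [r'|]; last by lia.
  by rewrite /setr; case: eqP => _; [have := H1 r|have := H1 r']; lia.
- move=> r t rg o; split=> // m [/= H1 H2]; split=> /= [r'|]; last by lia.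
  by rewrite /setr; case: eqP => _; [have := H1 t; case: nth|have := H1 r']; lia.
- move=> r rg o; split=> // m [/= H1 H2]; split=> /= [r'|]; last by rewrite size_rcons; lia.
  by have := H1 r'; lia.
- move=> a b s n1 s1 n2 s2 _ [? H1] _ [? H2]; split; first by lia.
  by move=> m /H1 /H2; rewrite addnA.
- by move=> r a s _; split=> // m [/= H1 H2]; split=> /= [r'|]; [have := H1 r'|]; lia.
- move=> r a s n1 s1 n2 s2 _ _ [? H1] _ [? H2]; split=> // m /H1 /H2 [H3 H4].
  by split=> [r'|]; [have := H3 r'|]; lia.
Qed.

Section Layout.
Variable NR : nat.
Let W := NR.+2.

Definition cell (p j : nat) : Z := (- 1 - Z.of_nat (p * W + j))%Z.

Definition track (d : seq bool) (rg : nat -> nat) (p j : nat) : sym :=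
  match j with
  | 0 => if p == 0 then Some true else None
  | 1 => nth None (map Some d) p
  | j'.+2 => if p < rg j' then Some true else None
  end.

(* Blocks of NR + 2 cells run leftwards from position -1, block p holding in track 0 a marker of
   block 0, in track 1 the datum d_p, and in track j + 2 whether p < rg j; position 0 is blank
   and the word o starts at position 1. *)
Definition enc (d : seq bool) (rg : nat -> nat) (o : seq bool) : tape := fun i =>
  if (0 <? i)%Z then nth None (map Some o) (Z.to_nat (i - 1))
  else if (i =? 0)%Z then None
  else let k := Z.to_nat (- 1 - i) in track d rg (k %/ W) (k %% W).

Lemma enc_cell d rg o p j : j < W -> enc d rg o (cell p j) = track d rg p j.
Proof.
move=> jW; rewrite /enc /cell.
case: Z.ltb_spec => [?|_]; first by lia.
case: Z.eqb_spec => [?|_]; first by lia.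
have -> : Z.to_nat (-1 - (-1 - Z.of_nat (p * W + j))) = p * W + j by lia.
by rewrite /= divnMDl // modnMDl divn_small // modn_small // addn0.
Qed.

Lemma enc_out d rg o n : enc d rg o (Z.of_nat n.+1) = nth None (map Some o) n.
Proof.
rewrite /enc; case: Z.ltb_spec => [_|?]; last by lia.
by congr nth; lia.
Qed.

Lemma enc_0 d rg o : enc d rg o 0%Z = None. Proof. by []. Qed.

Lemma pos_cases i :
  [\/ exists n, i = Z.of_nat n.+1, i = 0%Z | exists p j, j < W /\ i = cell p j].
Proof.
case: (Z.ltb_spec 0 i) => H; first by constructor 1; exists (Z.to_nat (i - 1)); lia.
case: (Z.eqb_spec i 0) => H'; first by constructor 2.
constructor 3; exists (Z.to_nat (- 1 - i) %/ W), (Z.to_nat (- 1 - i) %% W).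
by rewrite ltn_mod; split=> //; rewrite /cell -divn_eq; lia.
Qed.

Lemma cell_inj p j p' j' : j < W -> j' < W -> cell p j = cell p' j' -> p = p' /\ j = j'.
Proof.
rewrite /cell => H H' E; have {}E : p * W + j = p' * W + j' by lia.
split.
  by rewrite -(addn0 p) -(divn_small H) -divnMDl // E divnMDl // divn_small // addn0.
by rewrite -(modn_small H) -(modnMDl p) E modnMDl modn_small.
Qed.

Lemma upd_track d rg o d' rg' p j a : j < W ->
  (forall p' j', j' < W ->
     track d' rg' p' j' = if (p' == p) && (j' == j) then a else track d rg p' j') ->
  upd (enc d rg o) (cell p j) a = enc d' rg' o.
Proof.
move=> jW H; apply: functional_extensionality => i; rewrite /upd.
case: (pos_cases i) => [[n ->]|->|[p' [j' [j'W ->]]]].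
- by rewrite !enc_out; case: Z.eqb_spec => //; rewrite /cell; lia.
- by rewrite !enc_0; case: Z.eqb_spec => //; rewrite /cell; lia.
- rewrite !enc_cell // H //; case: Z.eqb_spec => [/cell_inj [] // -> ->|E].
    by rewrite !eqxx.
  by case: eqP => // ?; case: eqP => // ?; subst.
Qed.

Lemma upd_inc d rg o r : r < NR ->
  upd (enc d rg o) (cell (rg r) r.+2) (Some true) = enc d (setr rg r (rg r).+1) o.
Proof.
move=> rN; apply: upd_track => // p' [|[|j']] _; rewrite /= ?andbF //.
rewrite /setr !eqSS; case: (j' =P r) => [->|_]; last by rewrite andbF.
by rewrite andbT; case: eqP => [->|?]; rewrite ?leqnn //; congr (if _ then _ else _); lia.
Qed.

Lemma upd_dec d rg o r : r < NR -> 0 < rg r ->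
  upd (enc d rg o) (cell (rg r).-1 r.+2) None = enc d (setr rg r (rg r).-1) o.
Proof.
move=> rN r0; apply: upd_track => // p' [|[|j']] _; rewrite /= ?andbF //.
rewrite /setr !eqSS; case: (j' =P r) => [->|_]; last by rewrite andbF.
by rewrite andbT; case: eqP => [->|?]; rewrite ?ltnn //; congr (if _ then _ else _); lia.
Qed.

Lemma upd_data d rg o b :
  upd (enc d rg o) (cell (size d) 1) (Some b) = enc (rcons d b) rg o.
Proof.
apply: upd_track => // p' [|[|j']] _; rewrite /= ?andbF // andbT map_rcons nth_rcons size_map.
by case: ltngtP => // H; rewrite nth_default // size_map ltnW.
Qed.

Lemma upd_out d rg o b :
  upd (enc d rg o) (Z.of_nat (size o).+1) (Some b) = enc d rg (rcons o b).
Proof.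
apply: functional_extensionality => i; rewrite /upd.
case: (pos_cases i) => [[n ->]|->|[p' [j' [j'W ->]]]].
- rewrite !enc_out map_rcons nth_rcons size_map; case: Z.eqb_spec => H.
    have -> : n = size o by lia.
    by rewrite ltnn eqxx.
  case: ltngtP => // H1; [by rewrite nth_default ?size_map // ltnW | by lia].
- by case: Z.eqb_spec => // ?; lia.
- by rewrite !enc_cell //; case: Z.eqb_spec => //; rewrite /cell; lia.
Qed.

Lemma upd_erase d rg o b :
  upd (enc d rg (rcons o b)) (Z.of_nat (size o).+1) None = enc d rg o.
Proof.
rewrite -upd_out; apply: functional_extensionality => i; rewrite /upd.
case: Z.eqb_spec => // ->; by rewrite enc_out nth_default ?size_map.
Qed.

(** Jumping whole blocks leftwards along a register track ends at the first unmarked block, whose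
    number is the value of the register. *)
Definition skip1 := TWhile is1 (mvn MoveL W).
(** From track [j] to track 0, then block by block to the unique marker of block 0, then one cell to
    the origin. *)
Definition home j := TSeq (mvn MoveR j) (TSeq (TWhile non1 (mvn MoveR W)) (mvn MoveR 1)).

Lemma texb_skip1 d rg o p r : r < NR -> p <= rg r ->
  texb skip1 (enc d rg o) (cell p r.+2) ((rg r - p) * (W + 2)).+1
    (enc d rg o) (cell (rg r) r.+2).
Proof.
move=> rN; move E: (rg r - p) => k; elim: k p E => [|k IH] p E H.
  have -> : p = rg r by lia.
  by apply: texb_while0; rewrite enc_cell //= ltnn.
apply: texb_le (texb_whileS (B1 := W.+1) (p1 := cell p.+1 r.+2) _ _ (IH p.+1 _ _)) => //; try lia.
  rewrite enc_cell //= (_ : p < rg r) //; lia.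
by apply: texb_mvn; rewrite /cell /dz ?mulSn; lia.
Qed.

Lemma texb_home d rg o p j : j < W ->
  texb (home j) (enc d rg o) (cell p j) (j + p * (W + 2) + 4) (enc d rg o) 0%Z.
Proof.
move=> jW; apply: texb_le (texb_seq (B1 := j.+1) (p1 := cell p 0) (T1 := enc d rg o) _
  (texb_seq (B1 := (p * (W + 2)).+1) (p1 := cell 0 0) (T1 := enc d rg o) _
  (texb_mvn (k := 1) (m := MoveR) _ _))) => //; try lia.
- by apply: texb_mvn; rewrite /cell /dz ?mulSn; lia.
- elim: p => [|p IH]; first by apply: texb_while0; rewrite enc_cell.
  apply: texb_le (texb_whileS (B1 := W.+1) (p1 := cell p 0) _ _ IH); try lia.
    by rewrite enc_cell.
  by apply: texb_mvn; rewrite /cell /dz ?mulSn; lia.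
Qed.

Lemma texb_to_cell j T : texb (mvn MoveL j.+1) T 0%Z j.+2 T (cell 0 j).
Proof. by apply: texb_mvn; rewrite /cell /dz ?mulSn; lia. Qed.

Definition to_end := TSeq (mvn MoveR 1) (TWhile nonblank (mvn MoveR 1)).
Definition to_origin := TWhile nonblank (mvn MoveL 1).

Lemma texb_to_end d rg o :
  texb to_end (enc d rg o) 0%Z (3 * size o + 3) (enc d rg o) (Z.of_nat (size o).+1).
Proof.
have H n : n <= size o -> texb (TWhile nonblank (mvn MoveR 1)) (enc d rg o)
    (Z.of_nat n.+1) (3 * (size o - n)).+1 (enc d rg o) (Z.of_nat (size o).+1).
  move E: (size o - n) => k; elim: k n E => [|k IH] n E H.
    have -> : n = size o by lia.
    by apply: texb_while0; rewrite enc_out nth_default ?size_map.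
  apply: texb_le (texb_whileS (B1 := 2) (p1 := Z.of_nat n.+2) _ _ (IH n.+1 _ _)); try lia.
    by rewrite enc_out (nth_map false) //; lia.
  by apply: texb_mvn; rewrite /dz; lia.
apply: texb_le (texb_seq (B1 := 2) (p1 := 1%Z) _ (H 0 _)) => //; try lia.
exact: texb_mvn.
Qed.

Lemma texb_to_origin d rg o n : n <= size o ->
  texb to_origin (enc d rg o) (Z.of_nat n) (3 * n).+1 (enc d rg o) 0%Z.
Proof.
elim: n => [|n IH] H; first exact: texb_while0.
apply: texb_le (texb_whileS (B1 := 2) (p1 := Z.of_nat n) _ _ (IH _)); try lia.
  by rewrite enc_out (nth_map false).
by apply: texb_mvn; rewrite /dz; lia.
Qed.

Definition t_inc r :=
  TSeq (mvn MoveL r.+3) (TSeq skip1 (TSeq (wr (Some true)) (home r.+2))).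
Definition t_dec r :=
  TSeq (mvn MoveL r.+3) (TIf is1
    (TSeq skip1 (TSeq (mvn MoveR W) (TSeq (wr None) (home r.+2)))) (home r.+2)).
(** The walk along the track of [r] ends in block number [rg r], whose track 1 holds exactly the
    requested bit. *)
Definition t_bit r s :=
  TSeq (mvn MoveL r.+3) (TSeq skip1 (TSeq (mvn MoveR r.+1)
    (TIf is1 (TSeq (home 1) (t_inc s)) (home 1)))).
Definition t_app b := TSeq to_end (TSeq (wr (Some b)) to_origin).
Definition t_out r :=
  TSeq (mvn MoveL r.+3) (TIf is1 (TSeq (home r.+2) (t_app true))
                                 (TSeq (home r.+2) (t_app false))).
Definition t_loop r a := TWhile is1 (TSeq (mvn MoveR r.+3) (TSeq a (mvn MoveL r.+3))).
Definition t_while r a := TSeq (mvn MoveL r.+3) (TSeq (t_loop r a) (mvn MoveR r.+3)).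

Fixpoint compile (c : cprog) : tprog :=
  match c with
  | CInc r => t_inc r
  | CDec r => t_dec r
  | CBit r s => t_bit r s
  | COut r => t_out r
  | CSeq a b => TSeq (compile a) (compile b)
  | CWhile r a => t_while r (compile a)
  end.

Let K := 20 * W.

Lemma texb_skip1_le d rg o r m : r < NR -> rg r <= m ->
  texb skip1 (enc d rg o) (cell 0 r.+2) (m * (W + 2)).+1 (enc d rg o) (cell (rg r) r.+2).
Proof.
by move=> rN rm; apply: texb_le (texb_skip1 _ _ rN (leq0n _)); rewrite subn0 ltnS leq_mul.
Qed.

Lemma texb_home_le d rg o p j m : j < W -> p <= m ->
  texb (home j) (enc d rg o) (cell p j) (W + m * (W + 2) + 4) (enc d rg o) 0%Z.
Proof.
by move=> rN rm; apply: texb_le (texb_home _ _ _ _ rN); rewrite leq_add2r leq_add ?leq_mul // ltnW.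
Qed.

Lemma texb_inc d rg o r m : r < NR -> rg r <= m ->
  texb (t_inc r) (enc d rg o) 0%Z (8 * W * m.+1) (enc d (setr rg r (rg r).+1) o) 0%Z.
Proof.
move=> rN rm; rewrite /t_inc.
apply: texb_le (texb_seq (texb_to_cell r.+2 _) (texb_seq (texb_skip1_le _ _ rN rm)
  (texb_seq (texb_wr _ _ _) _))); last first.
  by rewrite upd_inc //; apply: (@texb_home_le _ _ _ _ _ m).
by rewrite /W; nia.
Qed.

Lemma texb_dec d rg o r m : r < NR -> rg r <= m ->
  texb (t_dec r) (enc d rg o) 0%Z (8 * W * m.+1) (enc d (setr rg r (rg r).-1) o) 0%Z.
Proof.
move=> rN rm; rewrite /t_dec.
apply: texb_le (texb_seq (texb_to_cell r.+2 _) (texb_if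
   (B := (m * (W + 2)).+1 + (W.+1 + (1 + (W + m * (W + 2) + 4)))) _)).
  by rewrite /W; nia.
rewrite enc_cell // /track; case: ltnP => /= r0; last first.
  have -> : setr rg r (rg r).-1 = rg.
    by apply: functional_extensionality => i; rewrite /setr; case: eqP => // ->; lia.
  by apply: texb_le (texb_home_le _ _ _ _ (leq0n m)) => //; lia.
apply: texb_seq (texb_skip1_le _ _ rN rm) _.
apply: (texb_seq (T1 := enc d rg o) (p1 := cell (rg r).-1 r.+2)).
  by apply: texb_mvn; rewrite /cell /dz; case: (rg r) r0 => // v _; rewrite mulSn -[v.+1.-1]/v; lia.
apply: texb_seq (texb_wr _ _ _) _.
by rewrite upd_dec //; apply: texb_home_le => //; lia.
Qed.

Lemma texb_bit d rg o r s m : r < NR -> s < NR -> (forall i, rg i <= m) ->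
  texb (t_bit r s) (enc d rg o) 0%Z (16 * W * m.+1)
    (enc d (setr rg s (rg s + nth false d (rg r))) o) 0%Z.
Proof.
move=> rN sN rm; rewrite /t_bit.
apply: texb_le (texb_seq (texb_to_cell r.+2 _) (texb_seq (texb_skip1_le _ _ rN (rm r))
  (texb_seq (B1 := r.+2) (p1 := cell (rg r) 1) (T1 := enc d rg o) _ (texb_if
   (B := (W + m * (W + 2) + 4) + 8 * W * m.+1) _)))).
- by rewrite /W; nia.
- by apply: texb_mvn; rewrite /cell /dz; lia.
rewrite enc_cell //= /is1.
have -> : (nth None (map Some d) (rg r) == Some true) = nth false d (rg r).
  case: (ltnP (rg r) (size d)) => H; last by rewrite !nth_default ?size_map.
  by rewrite (nth_map false) //; case: nth.
case: nth; last first.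
  have -> : setr rg s (rg s + false) = rg.
    by apply: functional_extensionality => i; rewrite /setr addn0; case: eqP => // ->.
  by apply: texb_le (texb_home_le _ _ _ _ (rm r)) => //; lia.
rewrite addn1; apply: texb_seq; last exact: texb_inc.
exact: texb_home_le.
Qed.

Lemma texb_app d rg o b m : size o <= m ->
  texb (t_app b) (enc d rg o) 0%Z (6 * m + 8) (enc d rg (rcons o b)) 0%Z.
Proof.
move=> om; apply: texb_le (texb_seq (texb_to_end _ _ _) (texb_seq (texb_wr _ _ _) _));
  last by rewrite upd_out; apply: texb_to_origin; rewrite size_rcons.
lia.
Qed.

Lemma texb_out d rg o r m : r < NR -> rg r <= m -> size o <= m ->
  texb (t_out r) (enc d rg o) 0%Z (16 * W * m.+1) (enc d rg (rcons o (0 < rg r))) 0%Z.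
Proof.
move=> rN rm om; rewrite /t_out.
apply: texb_le (texb_seq (texb_to_cell r.+2 _) (texb_if
   (B := (W + m * (W + 2) + 4) + (6 * m + 8)) _)).
  by rewrite /W; nia.
rewrite enc_cell // /track; case: ltnP => /= r0;
  (apply: texb_seq; [exact: (texb_home_le _ _ _ _ (leq0n m))|exact: texb_app]).
Qed.

Lemma texb_from_cell j T : texb (mvn MoveR j.+1) T (cell 0 j) j.+2 T 0%Z.
Proof. by apply: texb_mvn; rewrite /cell /dz; lia. Qed.

(** No register exceeds [m + n] during the run, so one counter step costs at most [K * (m + n).+1]
    tape steps. *)
Lemma compile_correct d c s n s' : cexec d c s n s' -> cwf NR c ->
  forall m, cbound m s ->
  texb (compile c) (enc d s.1 s.2) 0%Z (K * n * (m + n).+1) (enc d s'.1 s'.2) 0%Z.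
Proof.
move=> E w m H.
(* For a loop the induction must also speak of [t_loop] started on the tested cell, because an
   unrolled round re-enters there and not at the origin. *)
suff: exists2 B, B <= K * n * (m + n).+1 &
    texb (compile c) (enc d s.1 s.2) 0%Z B (enc d s'.1 s'.2) 0%Z /\
    if c is CWhile r a then exists2 B', r.+4 + (B' + r.+4) = B &
      texb (t_loop r (compile a)) (enc d s.1 s.2) (cell 0 r.+2) B'
                                  (enc d s'.1 s'.2) (cell 0 r.+2) else True.
  by move=> [B HB [/(texb_le HB)]].
elim: E w m H => {c s n s'} /=.
- move=> r rg o rN m [/= H1 H2]; eexists; last by split=> //; exact: (texb_inc _ _ rN (H1 r)).
  by rewrite /K; nia.
- move=> r rg o rN m [/= H1 H2]; eexists; last by split=> //; exact: (texb_dec _ _ rN (H1 r)).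
  by rewrite /K; nia.
- move=> r t rg o /andP [rN sN] m [/= H1 H2].
  eexists; last by split=> //; exact: (texb_bit _ _ rN sN H1).
  by rewrite /K; nia.
- move=> r rg o rN m [/= H1 H2].
  eexists; last by split=> //; exact: (texb_out _ rN (H1 r) H2).
  by rewrite /K; nia.
- move=> a b s n1 s1 n2 s2 E1 IH1 E2 IH2 /andP [wa wb] m H.
  have [_ /(_ _ H) H'] := cexec_bound E1.
  have [B1 HB1 [X1 _]] := IH1 wa _ H; have [B2 HB2 [X2 _]] := IH2 wb _ H'.
  eexists; last by split=> //; exact: (texb_seq X1 X2).
  apply: leq_trans (leq_add HB1 HB2) _.
  rewrite addnA mulnDr mulnDl leq_add2r; apply: leq_mul => //; lia.
- move=> r a s r0 /andP [rN wa] m H.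
  have L : texb (t_loop r (compile a)) (enc d s.1 s.2) (cell 0 r.+2) 1
             (enc d s.1 s.2) (cell 0 r.+2).
    by apply: texb_while0; rewrite enc_cell //= r0.
  exists (r.+4 + (1 + r.+4)); first by rewrite /K /W; nia.
  split; last by exists 1.
  exact: (texb_seq (texb_to_cell _ _) (texb_seq L (texb_from_cell _ _))).
- move=> r a s n1 s1 n2 s2 r0 E1 IH1 E2 IH2 /[dup] w /andP [rN wa] m H.
  have [_ /(_ _ H) H'] := cexec_bound E1.
  have [B1 HB1 [X1 _]] := IH1 wa _ H; have [B2 HB2 [_ [B' HB' X2]]] := IH2 w _ H'.
  have L : texb (t_loop r (compile a)) (enc d s.1 s.2) (cell 0 r.+2)
             (r.+4 + (B1 + r.+4) + B').+1 (enc d s2.1 s2.2) (cell 0 r.+2).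
    apply: texb_whileS X2; first by rewrite enc_cell //= r0.
    exact: (texb_seq (texb_from_cell _ _) (texb_seq X1 (texb_to_cell _ _))).
  eexists; last first.
    split; last by eexists; [reflexivity|exact: L].
    exact: (texb_seq (texb_to_cell _ _) (texb_seq L (texb_from_cell _ _))).
  have : r.+4 + (B1 + r.+4) + B2 <= 2 * W.+2 + K * n1 * (m + n1).+1
         + K * n2 * (m + n1 + n2).+1 by rewrite /W; lia.
  have -> : m + (n1 + n2).+1 = (m + n1 + n2).+1 by lia.
  have : K * n1 * (m + n1).+1 <= K * n1 * (m + n1 + n2).+2 by apply: leq_mul => //; lia.
  have : K * n2 * (m + n1 + n2).+1 <= K * n2 * (m + n1 + n2).+2 by apply: leq_mul => //; lia.
  have -> : (n1 + n2).+1 = n1 + (n2 + 1) by lia.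
  rewrite !mulnDr !mulnDl muln1.
  have : 2 * W.+2 < K * (m + n1 + n2).+2 by rewrite /K /W; nia.
  lia.
Qed.

(* The input, sitting where the output is expected, is consumed from its right end. *)
Definition t_push b :=
  TSeq (mvn MoveL 3) (TSeq skip1 (TSeq (mvn MoveR 1) (TSeq (wr (Some b))
    (TSeq (mvn MoveL 1) (TSeq (wr (Some true)) (home 2)))))).

Definition t_eat b := TSeq (wr None) (TSeq (mvn MoveL 1) (TSeq to_origin (t_push b))).
Definition t_last := TSeq to_end (mvn MoveL 1).
Definition t_load := TSeq (mvn MoveL 2) (TSeq (wr (Some true)) (TSeq (mvn MoveR 1)
  (TSeq t_last (TWhile nonblank (TSeq (TIf is1 (t_eat true) (t_eat false)) t_last))))).

Lemma texb_push d rg o b : 0 < NR -> rg 0 = size d ->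
  texb (t_push b) (enc d rg o) 0%Z (16 * W * (size d).+1)
    (enc (rcons d b) (setr rg 0 (size d).+1) o) 0%Z.
Proof.
move=> NR0 Hd; rewrite /t_push.
apply: texb_le (texb_seq (texb_to_cell 2 _) (texb_seq (texb_skip1_le _ _ NR0 (leqnn _))
  (texb_seq (B1 := 2) (p1 := cell (rg 0) 1) (T1 := enc d rg o) _
   (texb_seq (texb_wr _ _ _) (texb_seq (B1 := 2) (p1 := cell (rg 0) 2)
     (T1 := enc (rcons d b) rg o) _ (texb_seq (texb_wr _ _ _)
     (_ : texb _ _ _ (W + size d * (W + 2) + 4) _ _))))))).
- by rewrite Hd /W; nia.
- by apply: texb_mvn; rewrite /cell /dz; lia.
- by rewrite Hd upd_data; apply: texb_mvn; rewrite /cell /dz; lia.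
- rewrite upd_inc // Hd; apply: texb_home_le => //.
Qed.

Lemma texb_eat d rg o b : 0 < NR -> rg 0 = size d ->
  texb (t_eat b) (enc d rg (rcons o b)) (Z.of_nat (size o).+1)
    (16 * W * (size d).+1 + (3 * size o + 4))
    (enc (rcons d b) (setr rg 0 (size d).+1) o) 0%Z.
Proof.
move=> NR0 Hd.
apply: texb_le (texb_seq (texb_wr _ _ _) (texb_seq (B1 := 2) (p1 := Z.of_nat (size o))
  (T1 := enc d rg o) _ (texb_seq (texb_to_origin _ _ (leqnn _)) (texb_push _ _ NR0 Hd)))).
- by lia.
- by rewrite upd_erase; apply: texb_mvn; rewrite /dz; lia.
Qed.

Lemma texb_last d rg o :
  texb t_last (enc d rg o) 0%Z (3 * size o + 5) (enc d rg o) (Z.of_nat (size o)).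
Proof.
apply: texb_le (texb_seq (texb_to_end _ _ _) (texb_mvn (p' := Z.of_nat (size o)) _ _)).
- by lia.
- by rewrite /dz; lia.
Qed.

Definition rg0 (n : nat) := setr (fun _ => 0) 0 n.

(** Popping letters at the right and pushing them at the left reverses the word. Register 0 is the
    address of the next datum and so ends up as the input length. Each letter is carried across the
    tape, hence the quadratic cost. *)
Lemma texb_load x : 0 < NR ->
  texb t_load (tape_in x) 1 (30 * W * (size x).+1 * (size x).+1)
    (enc (rev x) (rg0 (size x)) [::]) 0%Z.
Proof.
move=> NR0.
(* Invariant: [o] is the unread prefix and [d] the reversed suffix already consumed, counted by
   register 0. *)
have L n o d : size o + size d = n -> texb (TWhile nonblank (TSeq (TIf is1 (t_eat true) (t_eat false)) t_last))
    (enc d (rg0 (size d)) o) (Z.of_nat (size o)) (size o * (16 * W * n.+1 + 6 * n + 11)).+1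
    (enc (d ++ rev o) (rg0 n) [::]) 0%Z.
  elim/last_ind: o d => [|o b IH] d.
    by rewrite /= add0n => ->; rewrite cats0; apply: texb_while0.
  rewrite size_rcons => Hn; have := IH (rcons d b).
  rewrite size_rcons addnS -addSn Hn => /(_ erefl) {}IH.
  rewrite rev_rcons -cat_rcons.
  have b_at : enc d (rg0 (size d)) (rcons o b) (Z.of_nat (size o).+1) = Some b.
    by rewrite enc_out map_rcons nth_rcons size_map ltnn eqxx.
  apply: texb_le (texb_whileS (B1 := 16 * W * n.+1 + 6 * n + 10) _ _ IH); first by lia.
    by rewrite b_at.
  apply: texb_le (texb_seq (texb_if (p' := 0%Z) (T' := enc (rcons d b) (rg0 (size d).+1) o)
     (B := 16 * W * (size d).+1 + (3 * size o + 4)) _) (texb_last _ _ _)).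
    have : 16 * W * (size d).+1 <= 16 * W * n.+1 by apply: leq_mul => //; lia.
    lia.
  have -> : rg0 (size d).+1 = setr (rg0 (size d)) 0 (size d).+1.
    by apply: functional_extensionality => i; rewrite /rg0 /setr; case: eqP.
  by rewrite b_at; case: b {IH b_at}; apply: texb_eat.
have := L (size x) x [::] (addn0 _); rewrite cat0s => {}L.
rewrite /t_load.
apply: texb_le (texb_seq (B1 := 3) (T1 := tape_in x) (p1 := cell 0 0) _ (texb_seq (texb_wr _ _ _)
  (texb_seq (B1 := 2) (T1 := enc [::] (rg0 0) x) (p1 := 0%Z) _ (texb_seq (texb_last _ _ _) L)))).
- by rewrite /W; nia.
- by apply: texb_mvn.
(* Once the marker is written the tape is already an encoding, with no data and the input in the
   place of the output. *)
- suff -> : upd (tape_in x) (cell 0 0) (Some true) = enc [::] (rg0 0) x by apply: texb_mvn.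
  apply: functional_extensionality => i; rewrite /upd /tape_in.
  case: (pos_cases i) => [[n ->]|->|[p' [j' [j'W ->]]]] //.
  + rewrite enc_out; case: Z.eqb_spec => [|_]; first by rewrite /cell; lia.
    by case: Z.ltb_spec => ?; [lia|congr nth; lia].
  + rewrite enc_cell //; case: Z.eqb_spec => [/cell_inj [] // -> -> //|H].
    case: Z.ltb_spec => [_|]; last by rewrite /cell; lia.
    case: j' j'W H => [|[|j]] //= _; last by rewrite /rg0 /setr; case: eqP.
      by case: eqP => // ->.
    by rewrite nth_nil.
Qed.

End Layout.

Fixpoint cmax (c : cprog) : nat :=
  match c with
  | CInc r | CDec r | COut r => r
  | CBit r s => maxn r s
  | CSeq a b => maxn (cmax a) (cmax b)
  | CWhile r a => maxn r (cmax a)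
  end.

Lemma cwf_cmax c NR : cmax c < NR -> cwf NR c.
Proof.
elim: c => [r|r|r s|r|a IHa b IHb|r a IHa] //=; rewrite gtn_max => /andP [Ha Hb].
- by rewrite Ha.
- by rewrite IHa ?IHb.
- by rewrite Ha IHa.
Qed.

(** For [n] at most 1 the additive [k] suffices; from 2 on, [n + 2 <= n ^ 2] and [C <= n ^ C]. *)
Lemma poly_absorb C e : exists k, forall n, C * (n + 2) ^ e <= n ^ k + k.
Proof.
exists (C * 3 ^ e + (C + 2 * e)) => n; case: (leqP n 1) => n1.
  have : C * (n + 2) ^ e <= C * 3 ^ e by rewrite leq_mul //; case: e => // e; rewrite leq_exp2r //; lia.
  lia.
have H : C * (n + 2) ^ e <= n ^ (C + 2 * e).
  rewrite expnD leq_mul //; first by apply: ltnW; apply: ltn_expl.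
  rewrite expnM; case: e => // e; rewrite leq_exp2r //; nia.
apply: leq_trans H _; apply: leq_trans (leq_addr _ _).
by rewrite leq_exp2l //; lia.
Qed.

Lemma poly_time_cprog (c : cprog) (f : seq bool -> seq bool) C e :
  (forall x, exists n rg, n <= C * (size x + 2) ^ e /\
     cexec (rev x) c (rg0 (size x), [::]) n (rg, f x)) ->
  poly_time_fun f.
Proof.
move=> H; pose NR := (cmax c).+1; pose W := NR.+2.
(* Loading is quadratic in [size x], and simulating [n] steps costs about [n * (size x + n)]; as [n]
   has degree [e], both have degree at most [2 * e + 2]. *)
have [k Hk] := poly_absorb (60 * W * (C + 1) * (C + 2)) (2 * e + 2).
apply: (@poly_time_tprog (TSeq (t_load NR) (TSeq (compile NR c) (mvn MoveR 1))) f k) => x.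
have [n [rg [nC E]]] := H x.
have NR0 : 0 < NR by [].
have wf : cwf NR c by apply: cwf_cmax.
have B : cbound (size x) (rg0 (size x), [::]).
  by split=> //= r; rewrite /rg0 /setr; case: eqP.
have [t tle X] := texb_seq (texb_load x NR0) (texb_seq (compile_correct E wf B)
  (texb_mvn (m := MoveR) (k := 1) (p := 0%Z) (p' := 1%Z) _ erefl)).
exists t; eexists; exists 1%Z; split; first exact: X.
  apply: leq_trans tle (leq_trans _ (Hk (size x))).
  rewrite -/W /=; set s := size x in nC *.
  have e1 : 0 < (s + 2) ^ e by rewrite expn_gt0 addn2.
  rewrite expnD (mulnC 2 e) expnM; set z := (s + 2) ^ e in nC e1 *; clearbody z.
  have h1 : n * (s + n).+1 <= (C * z) * ((C + 1) * z * (s + 2)) by apply: leq_mul => //; nia.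
  have h2 : s.+1 * s.+1 <= (s + 2) ^ 2 * z ^ 2 by rewrite -!mulnn; nia.
  have h3 : n * (s + n).+1 <= C * (C + 1) * ((s + 2) ^ 2 * z ^ 2).
    by apply: leq_trans h1 _; rewrite -!mulnn; nia.
  have h4 : 0 < (s + 2) ^ 2 * z ^ 2 by rewrite muln_gt0 !expn_gt0 addn2 e1.
  rewrite (mulnC (z ^ 2)) -!mulnA; set Y := (s + 2) ^ 2 * z ^ 2 in h2 h3 h4 *.
  have h5 : W * (s.+1 * s.+1) <= W * Y by rewrite leq_mul.
  have h6 : W * (n * (s + n).+1) <= W * (C * (C + 1) * Y) by rewrite leq_mul.
  have h7 : 0 < W * Y by rewrite muln_gt0 h4.
  suff : 30 * (W * Y) + (20 * (W * (C * (C + 1) * Y)) + 2) <= 60 * (W * ((C + 1) * ((C + 2) * Y))) by lia.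
  have -> : W * (C * (C + 1) * Y) = C * (C + 1) * (W * Y) by lia.
  have -> : W * ((C + 1) * ((C + 2) * Y)) = (C + 1) * (C + 2) * (W * Y) by lia.
  by nia.
by move=> i; rewrite (_ : (1 + Z.of_nat i)%Z = Z.of_nat i.+1) ?enc_out //; lia.
Qed.

(** * Functions computable by counter programs *)

Definition cexb d c s B s' := exists2 n, n <= B & cexec d c s n s'.

Lemma cexb_le d c s B1 B2 s' : B1 <= B2 -> cexb d c s B1 s' -> cexb d c s B2 s'.
Proof. by move=> H [n Hn E]; exists n => //; lia. Qed.

Lemma cexb_seq d a b s B1 s1 B2 s2 : cexb d a s B1 s1 -> cexb d b s1 B2 s2 ->
  cexb d (CSeq a b) s (B1 + B2) s2.
Proof. by move=> [n Hn E] [m Hm F]; exists (n + m); [lia|apply: XSeq E F]. Qed.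

Lemma cexb_inc d r rg o : cexb d (CInc r) (rg, o) 1 (setr rg r (rg r).+1, o).
Proof. by exists 1 => //; apply: XInc. Qed.

Lemma cexb_dec d r rg o : cexb d (CDec r) (rg, o) 1 (setr rg r (rg r).-1, o).
Proof. by exists 1 => //; apply: XDec. Qed.

(** [I k] is the state after [k] rounds, and register [r] counts the rounds that remain. *)
Lemma cexb_loop d r a (I : nat -> cstate) N b :
  (forall k, k <= N -> (I k).1 r = N - k) ->
  (forall k, k < N -> cexb d a (I k) b (I k.+1)) ->
  cexb d (CWhile r a) (I 0) (N * b.+1).+1 (I N).
Proof.
move=> Hr Hb; suff H j k : j + k = N -> cexb d (CWhile r a) (I k) (j * b.+1).+1 (I N).
  by apply: H; rewrite addn0.
elim: j k => [|j IH] k E.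
  by rewrite -E; exists 1 => //; apply: XWhile0; rewrite Hr -E ?subnn.
have [|n1 H1 E1] := Hb k; first by lia.
have [|n2 H2 E2] := IH k.+1; first by lia.
exists (n1 + n2).+1; first by rewrite mulSn; lia.
by apply: XWhileS E1 E2; rewrite Hr; lia.
Qed.

Ltac reg_eq := apply: functional_extensionality => ?; rewrite /setr /=;
  repeat case: eqP => ?; subst; try lia; try congruence.

Lemma setr_id rg r v : rg r = v -> setr rg r v = rg.
Proof. by move=> <-; reg_eq. Qed.

Definition cskip r := CWhile r (CDec r).
Definition cclear r := CWhile r (CDec r).
Definition cdrain r t := CWhile r (CSeq (CDec r) (CInc t)).
(** Reading a counter destroys it, so [v] is emptied into both [t] and the scratch register [u], and
    [u] is drained back. *)
Definition ccopy v t u :=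
  CSeq (CWhile v (CSeq (CDec v) (CSeq (CInc t) (CInc u)))) (cdrain u v).

Lemma cexb_skip d r rg o : rg r = 0 -> cexb d (cskip r) (rg, o) 1 (rg, o).
Proof. by move=> H; exists 1 => //; apply: XWhile0. Qed.

Lemma cexb_clear d r rg o : cexb d (cclear r) (rg, o) (2 * rg r).+1 (setr rg r 0, o).
Proof.
have := @cexb_loop d r (CDec r) (fun k => (setr rg r (rg r - k), o)) (rg r) 1.
rewrite subnn subn0 setr_id // mulnC; apply => k Hk /=; first by rewrite /setr eqxx.
have := cexb_dec d r (setr rg r (rg r - k)) o; congr cexb; congr pair; reg_eq.
Qed.

Lemma cexb_drain d r t rg o : r != t ->
  cexb d (cdrain r t) (rg, o) (3 * rg r).+1 (setr (setr rg r 0) t (rg t + rg r), o).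
Proof.
move=> /eqP rt.
have := @cexb_loop d r (CSeq (CDec r) (CInc t))
  (fun k => (setr (setr rg r (rg r - k)) t (rg t + k), o)) (rg r) 2.
rewrite subnn subn0 addn0 (setr_id (erefl (rg r))) (setr_id (erefl (rg t))) mulnC; apply => k Hk /=.
  by rewrite /setr; do 2 case: eqP => //.
have := cexb_seq (cexb_dec d r (setr (setr rg r (rg r - k)) t (rg t + k)) o) (cexb_inc d t _ o).
congr cexb; congr pair; reg_eq.
Qed.

Lemma cexb_copy d v t u rg o : uniq [:: v; t; u] -> rg t = 0 -> rg u = 0 ->
  cexb d (ccopy v t u) (rg, o) (7 * rg v + 2) (setr rg t (rg v), o).
Proof.
rewrite /= !inE negb_or => /and3P [/andP [/eqP vt /eqP vu] /eqP tu _] t0 u0.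
have L : cexb d (CWhile v (CSeq (CDec v) (CSeq (CInc t) (CInc u)))) (rg, o) (4 * rg v).+1
    (setr (setr (setr rg v 0) t (rg v)) u (rg v), o).
  have := @cexb_loop d v (CSeq (CDec v) (CSeq (CInc t) (CInc u)))
    (fun k => (setr (setr (setr rg v (rg v - k)) t k) u k, o)) (rg v) 3.
  rewrite subnn subn0 (setr_id (erefl (rg v))) (setr_id t0) (setr_id u0) mulnC; apply => k Hk /=.
    by rewrite /setr; do 3 case: eqP => //.
  have := cexb_seq (cexb_dec d v (setr (setr (setr rg v (rg v - k)) t k) u k) o)
    (cexb_seq (cexb_inc d t _ o) (cexb_inc d u _ o)).
  congr cexb; congr pair; reg_eq.
have := cexb_seq L (cexb_drain _ _ _ (_ : u != v)).
have uv : u != v by apply/eqP => E; rewrite E in vu.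
move=> /(_ uv).
have -> : setr (setr (setr rg v 0) t (rg v)) u (rg v) u = rg v by rewrite /setr eqxx.
rewrite (_ : (4 * rg v).+1 + (3 * rg v).+1 = 7 * rg v + 2); last by lia.
congr cexb; congr pair; reg_eq.
Qed.

Lemma cexb_copy_fresh d v fr rg o : v < fr -> (forall r, fr <= r -> rg r = 0) ->
  cexb d (ccopy v fr fr.+1) (rg, o) (7 * rg v + 2) (setr rg fr (rg v), o).
Proof.
move=> vfr rz; apply: cexb_copy; rewrite ?rz //= !inE.
by apply/and3P; split=> //; [apply/norP; split; apply/eqP; lia | apply/eqP; lia].
Qed.

(* Closed under bounded sums but not under iteration, so that every value is polynomially bounded.
   The list e is a de Bruijn environment. *)
Inductive PF : (seq bool -> seq nat -> nat) -> Prop :=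
| PFvar k : PF (fun _ e => nth 0 e k)
| PFsize : PF (fun x _ => size x)
| PFconst c : PF (fun _ _ => c)
| PFbit_rev a : PF a -> PF (fun x e => nth false (rev x) (a x e))
| PFadd a b : PF a -> PF b -> PF (fun x e => a x e + b x e)
| PFsub a b : PF a -> PF b -> PF (fun x e => a x e - b x e)
| PFsum_cons a b : PF a -> PF b -> PF (fun x e => \sum_(0 <= i < a x e) b x (i :: e))
| PFweak a : PF a -> PF (fun x e => a x (behead e))
| PFext a b : PF a -> (forall x e, a x e = b x e) -> PF b.

(** A pure power is a monotone bound even if [g] is not monotone; the [+ 2] in [Bd] keeps the base
    at least 2. *)
Definition polyB (g : nat -> nat) := exists K, forall B, 2 <= B -> g B <= B ^ K.

Lemma polyB_id : polyB id. Proof. by exists 1. Qed.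

Lemma polyB_const c : polyB (fun _ => c).
Proof. by exists c => B B2; apply/ltnW/ltn_expl. Qed.

Lemma polyB_add g h : polyB g -> polyB h -> polyB (fun B => g B + h B).
Proof.
move=> [K HK] [L HL]; exists (K + L).+1 => B B2.
have [hK hL] := (HK _ B2, HL _ B2).
have [p1 p2] : B ^ K <= B ^ (K + L) /\ B ^ L <= B ^ (K + L).
  by rewrite !leq_exp2l // leq_addr leq_addl.
rewrite expnS; apply: leq_trans (leq_mul B2 (leqnn _)); lia.
Qed.

Lemma polyB_mul g h : polyB g -> polyB h -> polyB (fun B => g B * h B).
Proof.
by move=> [K HK] [L HL]; exists (K + L) => B B2; rewrite expnD leq_mul // ?HK ?HL.
Qed.

Lemma polyB_exp g k : polyB g -> polyB (fun B => g B ^ k).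
Proof.
elim: k => [|k IH] H; first exact: (polyB_const 1).
by have [K HK] := polyB_mul H (IH H); exists K => B; rewrite expnS; apply: HK.
Qed.

Lemma polyB_S g : polyB g -> polyB (fun B => (g B).+1).
Proof. by move=> H; have [K HK] := polyB_add H (polyB_const 1); exists K => B /HK; rewrite addn1. Qed.

Lemma polyB_pow k : polyB (fun B => B ^ k).
Proof. exact: polyB_exp polyB_id. Qed.

Ltac polyB := solve [repeat first [assumption | exact: polyB_pow | exact: polyB_const | exact: polyB_id
  | apply: polyB_add | apply: polyB_mul | apply: polyB_exp | apply: polyB_S ]].

Definition Bd (x : seq bool) (e : seq nat) := size x + sumn e + 2.

(** [vm] lists the registers of the environment and [fr] is the first free register. Only [fr] may
    differ afterwards, so scratch registers are returned to zero and register 0 keeps the input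
    length. *)
Definition PFcomputes (f : seq bool -> seq nat -> nat) (g : nat -> nat) vm fr c :=
  forall x rg o, rg 0 = size x -> (forall r, fr <= r -> rg r = 0) ->
  cexb (rev x) c (rg, o) (g (Bd x (map rg vm))) (setr rg fr (f x (map rg vm)), o).

(** The same [g] bounds value and time, since a value may become the number of rounds of a sum. *)
Definition PFimpl f := exists g, [/\ polyB g, forall x e, f x e <= g (Bd x e) &
  forall vm fr, 0 < fr -> all (fun r => 0 < r < fr) vm -> exists c, PFcomputes f g vm fr c].

Lemma map_setr rg vm r v : r \notin vm -> map (setr rg r v) vm = map rg vm.
Proof.
move=> H; apply/eq_in_map => i Hi; rewrite /setr; case: eqP => // E.
by rewrite -E Hi in H.
Qed.

Lemma notin_vm fr vm r : all (fun r => 0 < r < fr) vm -> fr <= r -> r \notin vm.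
Proof.
by move=> /allP H fr_r; apply/negP => /H; lia.
Qed.

Lemma all_vm_le fr fr' vm : fr <= fr' -> all (fun r => 0 < r < fr) vm ->
  all (fun r => 0 < r < fr') vm.
Proof. by move=> H; apply: sub_all => r; lia. Qed.

Lemma setrE rg r v : setr rg r v r = v. Proof. by rewrite /setr eqxx. Qed.

Lemma setr_ne rg r v i : i != r -> setr rg r v i = rg i.
Proof. by rewrite /setr => /negbTE ->. Qed.

Lemma PFimpl2 a b : PFimpl a -> PFimpl b -> exists ga gb,
  [/\ polyB ga, polyB gb, forall x e, a x e <= ga (Bd x e), forall x e, b x e <= gb (Bd x e) &
  forall vm fr, 0 < fr -> all (fun r => 0 < r < fr) vm -> exists c,
    forall x rg o, rg 0 = size x -> (forall r, fr <= r -> rg r = 0) ->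
    let e := map rg vm in
    cexb (rev x) c (rg, o) (ga (Bd x e) + gb (Bd x e))
      (setr (setr rg fr (a x e)) fr.+1 (b x e), o)].
Proof.
move=> [ga [Pa Va Ha]] [gb [Pb Vb Hb]]; exists ga, gb; split=> // vm fr fr0 Hvm.
have [ca Hca] := Ha vm fr fr0 Hvm.
have [|cb Hcb] := Hb vm fr.+1 isT; first exact: all_vm_le Hvm.
exists (CSeq ca cb) => x rg o r0 rz e.
apply: cexb_seq (Hca x rg o r0 rz) _.
have := Hcb x (setr rg fr (a x e)) o.
rewrite map_setr ?(notin_vm Hvm) //; apply.
  by rewrite setr_ne // neq_ltn fr0.
by move=> r Hr; rewrite setr_ne ?rz //; lia.
Qed.

Lemma PF_impl f : PF f -> PFimpl f.
Proof.
elim=> {f}.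
- move=> k; exists (fun B => 7 * B + 2); split; first by polyB.
    move=> x e; suff : nth 0 e k <= sumn e by rewrite /Bd; lia.
    by elim: e k => [|a e IH] [|k] //=; [rewrite leq_addr|have := IH k; lia].
  move=> vm fr fr0 Hvm; case: (ltnP k (size vm)) => kvm; last first.
    exists (cskip fr) => x rg o r0 rz.
    rewrite [nth _ _ _]nth_default ?size_map // setr_id ?rz //.
    by apply: cexb_le (cexb_skip _ _ _); rewrite ?rz //; lia.
  have /andP [v0 vfr] := allP Hvm _ (mem_nth 0 kvm).
  exists (ccopy (nth 0 vm k) fr fr.+1) => x rg o r0 rz.
  rewrite (nth_map 0) //.
  apply: cexb_le (cexb_copy_fresh _ _ _ _) => //.
  suff : rg (nth 0 vm k) <= sumn (map rg vm) by rewrite /Bd; lia.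
  elim: vm k kvm {Hvm v0 vfr} => // a vm IH [|k] /=; [lia|move/IH; lia].
- exists (fun B => 7 * B + 2); split; first by polyB.
    by move=> x e; rewrite /Bd; lia.
  move=> vm fr fr0 Hvm; exists (ccopy 0 fr fr.+1) => x rg o r0 rz.
  rewrite -r0; apply: cexb_le (cexb_copy_fresh _ _ _ _) => //.
  by rewrite r0 /Bd; lia.
- move=> c; exists (fun B => c + 1); split; [by polyB|by lia|].
  move=> vm fr fr0 Hvm; elim: c => [|c [p IH]].
    exists (cskip fr) => x rg o r0 rz.
    by rewrite setr_id ?rz //; apply: cexb_skip; rewrite rz.
  exists (CSeq p (CInc fr)) => x rg o r0 rz.
  have := cexb_seq (IH x rg o r0 rz) (cexb_inc _ fr _ _).
  have -> : setr rg fr c.+1 = setr (setr rg fr c) fr (setr rg fr c fr).+1.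
    by rewrite setrE; reg_eq.
  by apply: cexb_le; lia.
- move=> a _ [g [Pg Hg Ha]]; exists (fun B => 3 * g B + 3); split; first by polyB.
    by move=> x e; case: nth => //; lia.
  move=> vm fr fr0 Hvm; have [|c Hc] := Ha vm fr.+1 isT; first exact: all_vm_le Hvm.
  exists (CSeq c (CSeq (CBit fr.+1 fr) (cclear fr.+1))) => x rg o r0 rz.
  have X := Hc x rg o r0 (fun r H => rz r (ltnW H)).
  have Y : cexb (rev x) (CBit fr.+1 fr) (setr rg fr.+1 (a x (map rg vm)), o) 1
     (setr (setr rg fr.+1 (a x (map rg vm))) fr (nth false (rev x) (a x (map rg vm))), o).
    exists 1 => //.
    have := XBit (rev x) fr.+1 fr (setr rg fr.+1 (a x [seq rg i | i <- vm])) o.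
    by rewrite setrE setr_ne ?neq_ltn ?ltnSn // rz.
  apply: cexb_le; last first.
    have := cexb_seq X (cexb_seq Y (cexb_clear _ fr.+1 _ _)); congr cexb.
    congr pair; reg_eq.
    by rewrite rz.
  have := Hg x (map rg vm); rewrite /setr /= eqxx; case: eqP; lia.
- move=> a b _ IHa _ IHb; have [ga [gb [Pa Pb Va Vb H]]] := PFimpl2 IHa IHb.
  exists (fun B => ga B + 4 * gb B + 1); split; first by polyB.
    by move=> x e; have := (Va x e, Vb x e) => -[]; lia.
  move=> vm fr fr0 Hvm; have [c Hc] := H vm fr fr0 Hvm.
  exists (CSeq c (cdrain fr.+1 fr)) => x rg o r0 rz.
  apply: cexb_le; last first.
    have ne : fr.+1 != fr by lia.
    have := cexb_seq (Hc x rg o r0 rz) (cexb_drain _ _ _ ne).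
    congr cexb; congr pair; reg_eq; by rewrite rz.
  by rewrite setrE; have := Vb x (map rg vm); lia.
- move=> a b _ IHa _ IHb; have [ga [gb [Pa Pb Va Vb H]]] := PFimpl2 IHa IHb.
  exists (fun B => ga B + 4 * gb B + 1); split; first by polyB.
    by move=> x e; have := (Va x e, Vb x e) => -[]; lia.
  move=> vm fr fr0 Hvm; have [c Hc] := H vm fr fr0 Hvm.
  exists (CSeq c (CWhile fr.+1 (CSeq (CDec fr.+1) (CDec fr)))) => x rg o r0 rz.
  have := Hc x rg o r0 rz; set e := map rg vm => /= X.
  have := @cexb_loop (rev x) fr.+1 (CSeq (CDec fr.+1) (CDec fr))
    (fun k => (setr (setr rg fr (a x e - k)) fr.+1 (b x e - k), o)) (b x e) 2.
  rewrite subnn !subn0 => L; apply: cexb_le; last first.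
    have -> : setr rg fr (a x e - b x e) = setr (setr rg fr (a x e - b x e)) fr.+1 0.
      by reg_eq; rewrite rz.
    apply: cexb_seq X (L _ _) => k Hk /=; first by rewrite setrE.
    have := cexb_seq (cexb_dec (rev x) fr.+1 (setr (setr rg fr (a x e - k)) fr.+1 (b x e - k)) o)
      (cexb_dec _ fr _ _).
    congr cexb; congr pair; reg_eq.
  by have := Vb x e; lia.
- move=> a b _ [ga [Pa Va Ha]] _ [gb [Pb Vb Hb]].
  (* [gb] need not be monotone; its bounding power, at a base enlarged to absorb the loop index,
     covers all rounds uniformly. *)
  case: (Pb) => Kb HKb; pose gb' B := (B + ga B) ^ Kb.
  have bB x e k : k <= a x e -> gb (Bd x (k :: e)) <= gb' (Bd x e).
    move=> Hk; apply: leq_trans (HKb _ _) _; first by rewrite /Bd; lia.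
    case: Kb HKb @gb' => [|Kb] _ //=; rewrite leq_exp2r // /Bd /=.
    by have := Va x e; rewrite /Bd; lia.
  have Pb' : polyB gb' by apply: polyB_exp; apply: polyB_add => //; exact: polyB_id.
  exists (fun B => ga B + ga B * (4 * gb' B + 4) + 3 * ga B + 2); split; first by polyB.
    move=> x e; apply: (@leq_trans (\sum_(0 <= i < a x e) gb' (Bd x e))).
      rewrite big_nat [X in _ <= X]big_nat; apply: leq_sum => i /andP [_ Hi].
      by apply: leq_trans (Vb _ _) (bB _ _ _ (ltnW Hi)).
    rewrite sum_nat_const_nat subn0.
    have := Va x e; nia.
  move=> vm fr fr0 Hvm; have [|ca Hca] := Ha vm fr.+1 isT; first exact: all_vm_le Hvm.
  have [|cb Hcb] := Hb (fr.+2 :: vm) fr.+3 isT.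
    by rewrite /= ltnSn; apply: all_vm_le Hvm; lia.
  (* [fr] accumulates the sum, [fr.+1] counts the remaining rounds, [fr.+2] is the index and [fr.+3]
     receives the summand. *)
  pose body := CSeq cb (CSeq (cdrain fr.+3 fr) (CSeq (CInc fr.+2) (CDec fr.+1))).
  exists (CSeq ca (CSeq (CWhile fr.+1 body) (cclear fr.+2))) => x rg o r0 rz.
  have := Hca x rg o r0 (fun r H => rz r (ltnW H)); set e := map rg vm => X.
  set N := a x e in X.
  have [Sg [Sg0 SgS SgN]] : exists Sg : nat -> nat, [/\ Sg 0 = 0,
      forall k, Sg k.+1 = Sg k + b x (k :: e) & Sg N = \sum_(0 <= i < N) b x (i :: e)].
    exists (fun k => \sum_(0 <= i < k) b x (i :: e)).
    by split=> // [|k]; [rewrite big_geq|rewrite big_nat_recr].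
  rewrite -SgN; pose I k := (setr (setr (setr rg fr.+1 (N - k)) fr.+2 k) fr (Sg k), o).
  have L : cexb (rev x) (CWhile fr.+1 body) (I 0) (N * (4 * gb' (Bd x e) + 4).+1).+1 (I N).
    apply: cexb_loop => k Hk.
      by rewrite /I /= setr_ne; [rewrite setr_ne ?setrE //; lia|lia].
    have E : map (I k).1 (fr.+2 :: vm) = k :: e.
      rewrite /= setr_ne; last by lia.
      by rewrite setrE !map_setr // (notin_vm Hvm) //; lia.
    have B1 : cexb (rev x) cb (I k) (gb (Bd x (k :: e))) (setr (I k).1 fr.+3 (b x (k :: e)), o).
      have := Hcb x (I k).1 o; rewrite E; apply; rewrite /I /=; first by rewrite !setr_ne //; lia.
      by move=> r Hr; rewrite !setr_ne ?rz //; lia.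
    have ne : fr.+3 != fr by lia.
    apply: cexb_le; last first.
      have := cexb_seq B1 (cexb_seq (cexb_drain _ _ _ ne)
         (cexb_seq (cexb_inc _ fr.+2 _ _) (cexb_dec _ fr.+1 _ _))).
      have Sk := SgS k; rewrite /I /=; congr cexb; congr pair; reg_eq; rewrite ?rz //; lia.
    rewrite setrE; have := bB x e k (ltnW Hk).
    have := Vb x (k :: e); lia.
  apply: cexb_le; last first.
    have I0 : I 0 = (setr rg fr.+1 N, o).
      by rewrite /I; congr pair; reg_eq; rewrite ?Sg0 rz //; lia.
    rewrite -I0 in X; have := cexb_seq X (cexb_seq L (cexb_clear _ fr.+2 _ _)).
    congr cexb; congr pair; reg_eq; rewrite ?rz //; lia.
  rewrite setr_ne; last by lia.
  rewrite setrE; have := Va x e; rewrite -/N => VN.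
  have : N * (4 * gb' (Bd x e) + 4) <= ga (Bd x e) * (4 * gb' (Bd x e) + 4) by rewrite leq_mul.
  lia.
- move=> a _ [g [[K HK] Hg Ha]].
  have gK x e : g (Bd x (behead e)) <= Bd x e ^ K.
    apply: leq_trans (HK _ _) _; first by rewrite /Bd; lia.
    case: K {HK} => [|K] //; rewrite leq_exp2r // /Bd; case: e => //= *; lia.
  exists (fun B => B ^ K); split; [exact: polyB_pow| |].
    by move=> x e; apply: leq_trans (Hg _ _) (gK _ _).
  move=> vm fr fr0 Hvm; have [||c Hc] := Ha (behead vm) fr => //.
    by case: vm Hvm => //= v vm /andP [].
  exists c => x rg o r0 rz; have := Hc x rg o r0 rz; rewrite -behead_map.
  by apply: cexb_le; apply: gK.
- move=> a b _ [g [Pg Hg Ha]] E; exists g; split=> // [x e|vm fr fr0 Hvm].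
    by rewrite -E.
  by have [c Hc] := Ha vm fr fr0 Hvm; exists c => x rg o r0 rz; rewrite -E; apply: Hc.
Qed.

Theorem PF_poly_time (N : seq bool -> seq nat -> nat) (g : seq bool -> seq nat -> nat) :
  PF N -> PF g ->
  poly_time_fun (fun x => mkseq (fun i => 0 < g x [:: i]) (N x [::])).
Proof.
move=> /PF_impl [gN [PN VN HN]] /PF_impl [gg [Pg Vg Hg]].
have [cN HcN] := HN [::] 1 isT isT; have [cg Hcg] := Hg [:: 2] 3 isT isT.
case: (Pg) => Kb HKb; pose gg' B := (B + gN B) ^ Kb.
have gB x k : k <= N x [::] -> gg (Bd x [:: k]) <= gg' (Bd x [::]).
  move=> Hk; apply: leq_trans (HKb _ _) _; first by rewrite /Bd; lia.
  case: Kb HKb @gg' => [|Kb] _ //=; rewrite leq_exp2r // /Bd /=.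
  by have := VN x [::]; rewrite /Bd /=; lia.
have Pg' : polyB gg' by apply: polyB_exp; apply: polyB_add => //; exact: polyB_id.
have [K HK] : polyB (fun B => gN B + gN B * (4 * gg' B + 4) + 3 * gN B + 2) by polyB.
(* Register 1 counts the letters still to be written, register 2 is the position, and register 3
   holds the value tested for positivity. *)
pose body := CSeq cg (CSeq (COut 3) (CSeq (cclear 3) (CSeq (CInc 2) (CDec 1)))).
apply: (@poly_time_cprog (CSeq cN (CWhile 1 body)) _ 1 K) => x.
set n := N x [::]; pose o k := mkseq (fun i => 0 < g x [:: i]) k.
have X := HcN x (rg0 (size x)) [::] (setrE _ _ _) (fun r H => setr_ne _ _ (lt0n_neq0 H)).
pose I k := (setr (setr (rg0 (size x)) 1 (n - k)) 2 k, o k).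
have L : cexb (rev x) (CWhile 1 body) (I 0) (n * (4 * gg' (Bd x [::]) + 4).+1).+1 (I n).
  apply: cexb_loop => k Hk //.
  have B1 := Hcg x (I k).1 (o k) _ _.
  have {}B1 : cexb (rev x) cg (I k) (gg (Bd x [:: k])) (setr (I k).1 3 (g x [:: k]), o k).
    apply: B1 => // r Hr.
    by rewrite /I /rg0 /= !setr_ne //; lia.
  apply: cexb_le; last first.
    have B2 : cexb (rev x) (COut 3) (setr (I k).1 3 (g x [:: k]), o k) 1
                (setr (I k).1 3 (g x [:: k]), o k.+1).
      by exists 1 => //; rewrite /o mkseqS; apply: XOut.
    have := cexb_seq B1 (cexb_seq B2 (cexb_seq (cexb_clear _ 3 _ _)
        (cexb_seq (cexb_inc _ 2 _ _) (cexb_dec _ 1 _ _)))).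
    by congr cexb; rewrite /I /=; congr pair; rewrite /rg0; reg_eq.
  rewrite setrE; have := gB x k (ltnW Hk).
  have := Vg x [:: k]; lia.
have I0 : I 0 = (setr (rg0 (size x)) 1 n, [::]).
  by rewrite /I; congr pair; reg_eq.
rewrite -I0 in X; have [t tle T] := cexb_seq X L.
exists t, (I n).1; split; last exact: T.
apply: leq_trans tle _; rewrite mul1n; apply: leq_trans (HK _ _); last by lia.
have -> : size x + 2 = Bd x [::] by rewrite /Bd /= addn0.
rewrite /=; have := VN x [::]; rewrite -/n => Vn.
have : n * (4 * gg' (Bd x [::]) + 4) <= gN (Bd x [::]) * (4 * gg' (Bd x [::]) + 4) by rewrite leq_mul.
lia.
Qed.

(** * Arithmetic, tests and words in the class [PF] *)

Notation PB p := (PF (fun x e => nat_of_bool (p x e))).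

(** The index becomes a separate argument of the summand; in the environment [i :: e] it is the head
    and [behead] recovers [e]. *)
Lemma PFsum a (b : seq bool -> seq nat -> nat -> nat) :
  PF a -> PF (fun x e => b x (behead e) (nth 0 e 0)) ->
  PF (fun x e => \sum_(0 <= i < a x e) b x e i).
Proof. by move=> Ha Hb; apply: PFext (PFsum_cons Ha Hb) _. Qed.

Lemma PFS a : PF a -> PF (fun x e => (a x e).+1).
Proof. by move=> Ha; apply: PFext (PFadd Ha (PFconst 1)) _ => x e; rewrite addn1. Qed.

Lemma PFpred a : PF a -> PF (fun x e => (a x e).-1).
Proof. by move=> Ha; apply: PFext (PFsub Ha (PFconst 1)) _ => x e; rewrite subn1. Qed.

Lemma PFmul a b : PF a -> PF b -> PF (fun x e => a x e * b x e).
Proof.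
move=> Ha Hb; apply: (PFext (PFsum (b := fun x e _ => b x e) Ha (PFweak Hb))) => x e.
by rewrite sum_nat_const_nat subn0.
Qed.

Lemma PBleq a b : PF a -> PF b -> PB (fun x e => a x e <= b x e).
Proof.
move=> Ha Hb; apply: PFext (PFsub (PFconst 1) (PFsub Ha Hb)) _ => x e.
by case: leqP; lia.
Qed.

Lemma PBand p q : PB p -> PB q -> PB (fun x e => p x e && q x e).
Proof. by move=> Hp Hq; apply: PFext (PFmul Hp Hq) _ => x e; rewrite mulnb. Qed.

Lemma PBneg p : PB p -> PB (fun x e => ~~ p x e).
Proof. by move=> Hp; apply: PFext (PFsub (PFconst 1) Hp) _ => x e; case: (p x e). Qed.

Lemma PBor p q : PB p -> PB q -> PB (fun x e => p x e || q x e).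
Proof.
move=> Hp Hq; apply: PFext (PBneg (PBand (PBneg Hp) (PBneg Hq))) _ => x e.
by rewrite negb_and !negbK.
Qed.

Lemma PBeq (a b : seq bool -> seq nat -> nat) : PF a -> PF b -> PB (fun x e => a x e == b x e).
Proof.
by move=> Ha Hb; apply: PFext (PBand (PBleq Ha Hb) (PBleq Hb Ha)) _ => x e; rewrite -eqn_leq.
Qed.

Lemma PFif p a b : PB p -> PF a -> PF b -> PF (fun x e => if p x e then a x e else b x e).
Proof.
move=> Hp Ha Hb; apply: PFext (PFadd (PFmul Hp Ha) (PFmul (PBneg Hp) Hb)) _ => x e.
by case: (p x e) => /=; lia.
Qed.

Lemma PBif p q r : PB p -> PB q -> PB r -> PB (fun x e => if p x e then q x e else r x e).
Proof. by move=> Hp Hq Hr; apply: PFext (PFif Hp Hq Hr) _ => x e; case: (p x e). Qed.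

(** The quotient counts the positive multiples of [b] up to [a]; the factor gives the convention for
    division by zero. *)
Lemma divn_sum a b : a %/ b = (0 < b) * \sum_(0 <= i < a) (i.+1 * b <= a).
Proof.
case: b => [|b]; first by rewrite divn0.
rewrite mul1n (eq_bigr (fun i => (i < a %/ b.+1) : nat)) => [|i _]; last by rewrite leq_divRL.
have H n q : \sum_(0 <= i < n) (i < q) = minn n q.
  elim: n => [|n IH]; first by rewrite big_geq // min0n.
  by rewrite big_nat_recr //= IH; case: ltnP; lia.
by rewrite H; apply/esym/minn_idPr; rewrite leq_div.
Qed.

Lemma PFdiv a b : PF a -> PF b -> PF (fun x e => a x e %/ b x e).
Proof.
move=> Ha Hb; apply: PFext (PFmul (PBleq (PFconst 1) Hb) (PFsum (b := fun x e i =>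
  i.+1 * b x e <= a x e) Ha (PBleq (PFmul (PFS (PFvar 0)) (PFweak Hb)) (PFweak Ha)))) _ => x e.
by rewrite divn_sum.
Qed.

Lemma PFmod a b : PF a -> PF b -> PF (fun x e => a x e %% b x e).
Proof.
move=> Ha Hb; apply: PFext (PFsub Ha (PFmul (PFdiv Ha Hb) Hb)) _ => x e.
by rewrite [X in X - _](divn_eq _ (b x e)) addKn.
Qed.

Lemma PFexp a k : PF a -> PF (fun x e => a x e ^ k).
Proof.
move=> Ha; elim: k => [|k IH]; first exact: PFconst.
by apply: PFext (PFmul Ha IH) _ => x e; rewrite expnS.
Qed.

(** Constant tables bring the transition function of a fixed machine into [PF]. *)
Lemma PFtab s a : PF a -> PF (fun x e => nth 0 s (a x e)).
Proof.
elim: s a => [|c s IH] a Ha.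
  by apply: PFext (PFconst 0) _ => x e; rewrite nth_nil.
apply: PFext (PFif (PBeq Ha (PFconst 0)) (PFconst c) (IH _ (PFpred Ha))) _ => x e.
by case: (a x e).
Qed.

(** The input is stored reversed, so the bit is read at the mirrored position; the length test is
    needed because truncated subtraction would send an index out of range to a valid one. *)
Lemma PBbit a : PF a -> PB (fun x e => nth false x (a x e)).
Proof.
move=> Ha; apply: PFext (PBand (PBleq (PFS Ha) PFsize) (PFbit_rev (PFsub PFsize (PFS Ha)))) _.
move=> x e; case: ltnP => H /=; last by rewrite nth_default.
by rewrite nth_rev ?subnSK //; [congr (nat_of_bool (nth _ _ _))|]; lia.
Qed.

(** The letter predicate must stay in [PF] at every index expression, which is what shifting for a
    concatenation requires. *)
Definition PFword (s : seq bool -> seq bool) := exists N p,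
  [/\ PF (fun x _ => N x), forall a, PF a -> PB (fun x e => p x (a x e)) &
      forall x, s x = mkseq (p x) (N x)].

Lemma PFword_poly s : PFword s -> poly_time_fun s.
Proof.
move=> [N [p [HN Hp Hs]]].
have [M [k H]] := PF_poly_time HN (Hp _ (PFvar 0)).
exists M, k => x; have [t [H1 [H2 H3]]] := H x; exists t; split=> //; split=> //.
by rewrite H3 Hs; apply: eq_mkseq => i; case: (p x _).
Qed.

Lemma PFword_mkseq N p : PF (fun x _ => N x) -> (forall a, PF a -> PB (fun x e => p x (a x e))) ->
  PFword (fun x => mkseq (p x) (N x)).
Proof. by exists N, p. Qed.

Lemma PFword_ext s s' : PFword s -> s =1 s' -> PFword s'.
Proof. by move=> [N [p [HN Hp Hs]]] E; exists N, p; split=> // x; rewrite -E. Qed.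

Lemma PFword_cat s1 s2 : PFword s1 -> PFword s2 -> PFword (fun x => s1 x ++ s2 x).
Proof.
move=> [N1 [p1 [HN1 Hp1 Hs1]]] [N2 [p2 [HN2 Hp2 Hs2]]].
exists (fun x => N1 x + N2 x), (fun x i => if i < N1 x then p1 x i else p2 x (i - N1 x)).
split=> [|a Ha|x]; first exact: PFadd.
  by apply: PBif; [apply: PBleq => //; apply: PFS|apply: Hp1|apply: Hp2; apply: PFsub].
rewrite Hs1 Hs2; apply: (@eq_from_nth _ false); first by rewrite size_cat !size_mkseq.
move=> i; rewrite nth_cat size_cat !size_mkseq => Hi; rewrite [RHS]nth_mkseq //.
by case: ltnP => H; rewrite nth_mkseq //; lia.
Qed.

Lemma PFword_unary N : PF (fun x _ => N x) -> PFword (fun x => unary (N x)).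
Proof.
move=> HN; apply: PFword_ext (PFword_mkseq (PFS HN) (p := fun x i => i < N x) _) _ => [a Ha|x].
  by apply: PBleq => //; apply: PFS.
rewrite /unary; apply: (@eq_from_nth _ false); first by rewrite size_mkseq size_cat size_nseq addn1.
move=> i; rewrite size_mkseq => Hi; rewrite nth_mkseq // nth_cat size_nseq nth_nseq.
by case: ltnP => // H; rewrite (_ : i - N x = 0) //; lia.
Qed.

Ltac pf1 := lazymatch goal with
| |- PF (fun x e => nat_of_bool (leq (@?a x e) (@?b x e))) => apply: (@PBleq a b)
| |- PF (fun x e => nat_of_bool (andb (@?a x e) (@?b x e))) => apply: (@PBand a b)
| |- PF (fun x e => nat_of_bool (orb (@?a x e) (@?b x e))) => apply: (@PBor a b)
| |- PF (fun x e => nat_of_bool (negb (@?a x e))) => apply: (@PBneg a)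
| |- PF (fun x e => nat_of_bool (@eq_op _ (@?a x e) (@?b x e))) => apply: (@PBeq a b)
| |- PF (fun x e => nat_of_bool (nth false x (@?a x e))) => apply: (@PBbit a)
| |- PF (fun x e => nat_of_bool (@?a x e)) => first [exact: PFconst | apply: PBif]
| |- PF (fun x e => addn (@?a x e) (@?b x e)) => apply: (@PFadd a b)
| |- PF (fun x e => subn (@?a x e) (@?b x e)) => apply: (@PFsub a b)
| |- PF (fun x e => muln (@?a x e) (@?b x e)) => apply: (@PFmul a b)
| |- PF (fun x e => divn (@?a x e) (@?b x e)) => apply: (@PFdiv a b)
| |- PF (fun x e => modn (@?a x e) (@?b x e)) => apply: (@PFmod a b)
| |- PF (fun x e => expn (@?a x e) ?k) => apply: (@PFexp a k)
| |- PF (fun x e => S (@?a x e)) => apply: (@PFS a)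
| |- PF (fun x e => predn (@?a x e)) => apply: (@PFpred a)
| |- PF (fun x e => nth 0 ?s (@?a x e)) => apply: (@PFtab s a)
| |- PF (fun x e => size x) => exact: PFsize
| |- PF (fun x e => nth 0 e ?k) => exact: PFvar
| |- PF _ => first [exact: PFconst | apply: PFif]
end.
Ltac pf := repeat first [assumption | pf1].

(** * The Cook-Levin theorem *)

Definition code (a : sym) : nat := if a is Some b then b.+1 else 0.
Definition decode (k : nat) : sym := if k is k'.+1 then Some (0 < k') else None.

Lemma codeK : cancel code decode. Proof. by case=> [[]|]. Qed.
Lemma code_lt3 a : code a < 3. Proof. by case: a => [[]|]. Qed.

Lemma div_pair u m r : r < m -> (u * m + r) %/ m = u.
Proof. by move=> H; rewrite divnMDl ?divn_small ?addn0 //; lia. Qed.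

Lemma mod_pair u m r : r < m -> (u * m + r) %% m = r.
Proof. by move=> H; rewrite modnMDl modn_small. Qed.

Lemma pair_lt u m r n : r < m -> u < n -> u * m + r < n * m.
Proof. by move=> H1 H2; apply: (@leq_trans (u.+1 * m)); rewrite ?leq_mul // mulSn; lia. Qed.

Lemma nth_pair_enc x w i : nth None (map Some (pair_enc x w)) i =
  if i < 2 * size x then Some (nth false x (i %/ 2))
  else if i == 2 * size x then Some false
  else if i == (2 * size x).+1 then Some true
  else nth None (map Some w) (i - (2 * size x).+2).
Proof.
rewrite /pair_enc; elim: x i => [|b x IH] i /=; first by case: i => [|[|i]] //=; rewrite subSS subSS subn0.
case: i => [|[|i]]; rewrite mulnS //=.
rewrite (IH i) !ltnS !eqSS.
have -> : i.+2 %/ 2 = (i %/ 2).+1 by rewrite -addn2 divnDr // addn1.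
by [].
Qed.

Lemma size_pair_enc x w : size (pair_enc x w) = 2 * size x + 2 + size w.
Proof.
rewrite /pair_enc size_cat /= (_ : size _ = 2 * size x); first by lia.
by elim: x => //= b x IH; rewrite IH; lia.
Qed.

Section Tableau.
Variables (M : TM) (k1 k2 : nat).
Let q := tm_q M.

(** A halted machine repeats its configuration, so the output can be inspected at one fixed time.
    Moves are shifted by one to be natural numbers. *)
Definition next (s a : nat) : nat * nat * nat :=
  if tm_delta (inord s : 'I_q.+1) (decode a) is Some (s', w, m)
  then (nat_of_ord s', code w, Z.to_nat (dz m + 1)) else (s, a, 1).

(** Phrased as a lookup in a finite list so that [PFtab] applies. *)
Definition next_tab (f : nat * nat * nat -> nat) k :=
  nth 0 (mkseq (fun k => f (next (k %/ 3) (k %% 3))) (q.+1 * 3)) k.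
Definition next_state s a := next_tab (fun r => r.1.1) (s * 3 + a).
Definition next_sym s a := next_tab (fun r => r.1.2) (s * 3 + a).
Definition next_move s a := next_tab (fun r => r.2) (s * 3 + a).

Lemma next_tabE f s a : s <= q -> a < 3 -> next_tab f (s * 3 + a) = f (next s a).
Proof.
by move=> Hs Ha; rewrite /next_tab nth_mkseq ?pair_lt // div_pair // mod_pair.
Qed.

Definition step_or_stay (c : config M) : config M := if step c is Some c' then c' else c.

(** Cells are numbered from the head, so a move renumbers the tape: new cell [i] is old cell
    [i + next_move - 1], and the freshly written cell is the one where this number is 0. *)
Lemma next_step (c : config M) :
  let s := state_of c in let a := code (cells_of c 0%Z) in
  [/\ state_of (step_or_stay c) = next_state s a :> nat,
      next_move s a <= 2, next_sym s a < 3 &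
   forall i, code (cells_of (step_or_stay c) i) =
     if (i + Z.of_nat (next_move s a) =? 1)%Z then next_sym s a
     else code (cells_of c (i + Z.of_nat (next_move s a) - 1)%Z)].
Proof.
move=> s a; have sq : s <= q by rewrite -ltnS.
have Ha : a < 3 by exact: code_lt3.
rewrite /next_state /next_move /next_sym !next_tabE // /next inord_val codeK.
rewrite /step_or_stay; case E: tm_delta => [[[s' w] m]|].
  have [c' [-> -> H]] := step_cells E; split=> //=; first by case: m {E H}.
    exact: code_lt3.
  move=> i; rewrite H /upd.
  have -> : Z.of_nat (Z.to_nat (dz m + 1)) = (dz m + 1)%Z by case: m {E H}.
  case: Z.eqb_spec => ?; case: Z.eqb_spec => ? //; try lia.
  by congr code; congr cells_of; lia.
rewrite (step_None E); split=> //= i.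
case: Z.eqb_spec => [?|_]; first by rewrite (_ : i = 0%Z) //; lia.
by congr code; congr cells_of; lia.
Qed.

Variable x : seq bool.
Definition wit_max := size x ^ k2 + k2.
Definition time_max := (2 * size x + 2 + wit_max) ^ k1 + k1.
Let T := time_max.
(* Cell j of a tableau row is the tape cell at distance j - H from the head, and T + 1 cells on
   either side suffice. *)
Definition center := time_max.+1.
Let H := center.
Definition width := 2 * time_max + 4.
Let W := width.
Definition nattr := q + 4.
Let A := nattr.

Definition vX t j a := (t * W + j) * A + a.
(** States share the grid of variables with the symbols: they use the attributes from 3 on, in
    column 0. *)
Definition vQ t s := vX t 0 (s + 3).
Definition nvars := T.+1 * W * A.
(** A clause number is a mixed-radix code of time, column, state, two symbols and kind; a kind that
    ignores some digits is merely repeated. *)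
Definition nclauses := T * (2 * T + 2) * q.+1 * 3 * 3 * 9.

Definition guess j := (H + (2 * size x).+2 <= j) && (j < H + (2 * size x).+2 + wit_max).
Definition init_sym j :=
  if j < H then 0
  else if j - H < 2 * size x then (nth false x ((j - H) %/ 2)).+1
  else if j - H == 2 * size x then 1
  else if j - H == (2 * size x).+1 then 2 else 0.

(* Kinds 0 and 1 propagate the cells and the state along a step, 2 to 4 describe the initial row,
   where the witness is a guessed word followed by blanks, and 5 to 8 exclude every output other
   than [:: true].  All clauses but those guessing the witness are Horn, which is why an assignment
   may only contain too many facts, never too few. *)
Definition sat_kind k t j s a b v (y : bool) : bool :=
  if k == 0 then
    ~~ y && ((v == vQ t s) || (v == vX t H a) || (v == vX t j.+1 b)) ||
    y && (v == vX t.+1 (j.+2 - next_move s a) (if j.+1 == H then next_sym s a else b))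
  else if k == 1 then
    ~~ y && ((v == vQ t s) || (v == vX t H a)) || y && (v == vQ t.+1 (next_state s a))
  else if k == 2 then
    y && (if guess j.+1 then (v == vX 0 j.+1 0) || (v == vX 0 j.+1 1) || (v == vX 0 j.+1 2)
          else v == vX 0 j.+1 (init_sym j.+1))
  else if k == 3 then
    ~~ guess j.+1 || (~~ y && (v == vX 0 j.+1 0)) || (y && (v == vX 0 j.+2 0))
  else if k == 4 then y && (v == vQ 0 0)
  else if k == 5 then ~~ y && (v == vX T H 0)
  else if k == 6 then ~~ y && (v == vX T H 1)
  else if k == 7 then ~~ y && (v == vX T H.+1 1)
  else ~~ y && (v == vX T H.+1 2).

Definition sat c v y :=
  let k := c %% 9 in let c1 := c %/ 9 in
  let b := c1 %% 3 in let c2 := c1 %/ 3 in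
  let a := c2 %% 3 in let c3 := c2 %/ 3 in
  let s := c3 %% q.+1 in let c4 := c3 %/ q.+1 in
  sat_kind k (c4 %/ (2 * T + 2)) (c4 %% (2 * T + 2)) s a b v y.

Definition satisfied (al : nat -> bool) k t j s a b :=
  exists2 v, v < nvars & sat_kind k t j s a b v (al v).

Lemma satisfied_clauses al :
  (forall c, c < nclauses -> exists2 v, v < nvars & sat c v (al v)) <->
  (forall k t j s a b, k < 9 -> t < T -> j < 2 * T + 2 -> s <= q -> a < 3 -> b < 3 ->
     satisfied al k t j s a b).
Proof.
split=> [Hc k t j s a b k9 tT jT sq a3 b3|Hc c cC].
  have := Hc (((((t * (2 * T + 2) + j) * q.+1 + s) * 3 + a) * 3 + b) * 9 + k).
  rewrite /sat !(div_pair, mod_pair) //; apply.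
  by rewrite /nclauses !pair_lt.
have T0 : 0 < T by move: cC; rewrite /nclauses; case: T.
apply: Hc; rewrite ?ltn_mod ?ltn_divLR //; lia.
Qed.

Lemma vX_lt t j a : t <= T -> j < W -> a < A -> vX t j a < nvars.
Proof. by move=> Ht Hj Ha; rewrite /nvars; do 2 apply: pair_lt => //. Qed.

Lemma vQ_lt t s : t <= T -> s <= q -> vQ t s < nvars.
Proof. move=> Ht Hs; apply: vX_lt => //; first by rewrite /W /width addnS.
by rewrite /A /nattr !addnS !ltnS !addn0. Qed.

Lemma sym_lt a : a < 3 -> a < A. Proof. by rewrite /A /nattr; lia. Qed.

Definition run_at (c : config M) t := iter t step_or_stay c.
Definition row c t j := code (cells_of (run_at c t) (Z.of_nat j - Z.of_nat H)%Z).
Definition facts c v : bool :=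
  let a := v %% A in let j := v %/ A %% W in let t := v %/ A %/ W in
  if a < 3 then row c t j == a else (state_of (run_at c t) == a - 3 :> nat).

Lemma facts_X c t j a : j < W -> a < 3 -> facts c (vX t j a) = (row c t j == a).
Proof.
by move=> Hj Ha; rewrite /facts /vX !(div_pair, mod_pair) ?Ha // sym_lt.
Qed.

Lemma facts_Q c t s : s <= q -> facts c (vQ t s) = (state_of (run_at c t) == s :> nat).
Proof.
by move=> Hs; rewrite /facts /vQ /vX !(div_pair, mod_pair) ?addn3 ?subSS ?subn0 // ?ltnS /W /width ?addnS // /A /nattr !addnS !ltnS !addn0.
Qed.

Lemma row_center c t : row c t H = code (cells_of (run_at c t) 0%Z).
Proof. by rewrite /row Z.sub_diag. Qed.

(** One step in the coordinates of kinds 0 and 1; as a move is at most 2, [j.+2 - next_move s a]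
    never truncates. *)
Lemma row_step c t j (s := state_of (run_at c t)) (a := row c t H) :
  [/\ state_of (run_at c t.+1) = next_state s a :> nat,
      next_move s a <= 2, next_sym s a < 3 &
   row c t.+1 (j.+2 - next_move s a) =
     if j.+1 == H then next_sym s a else row c t j.+1].
Proof.
have := next_step (run_at c t); rewrite -row_center -/s -/a => -[h1 h2 h3 h4].
split=> //.
have -> : row c t j.+1 = code (cells_of (run_at c t) (Z.of_nat j.+2 - Z.of_nat H - 1)%Z).
  by rewrite /row; congr code; congr cells_of; lia.
rewrite [LHS]h4.
have -> : (Z.of_nat (j.+2 - next_move s a) - Z.of_nat H + Z.of_nat (next_move s a) = Z.of_nat j.+2 - Z.of_nat H)%Z by lia.
by case: Z.eqb_spec; case: eqP => // *; lia.
Qed.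

Lemma row_lt3 c t j : row c t j < 3. Proof. exact: code_lt3. Qed.

Lemma init_row w j : size w <= wit_max ->
  let: r := row (init M (pair_enc x w)) 0 j in
  if guess j then r = code (nth None (map Some w) (j - H - (2 * size x).+2)) else r = init_sym j.
Proof.
rewrite /row [run_at _ 0]/run_at [iter 0 _ _]/= init_cells nth_pair_enc /guess /init_sym /H.
move: center wit_max => h p sw.
case: Z.ltb_spec => h1.
  have h1' : j < h by lia.
  by rewrite h1' leqNgt (leq_trans h1' (leq_addr _ _)).
have h1' : h <= j by lia.
rewrite (ltnNge j h) h1' /=.
have -> : Z.to_nat (Z.of_nat j - Z.of_nat h) = j - h by lia.
case: ifP => h2; first by move: h2; do 3 (case: ifP => ?; try lia).
move: h2; case: ifP => ?; first by case: nth.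
do 2 (case: ifP => ? //).
by move=> h2; rewrite nth_default // size_map; lia.
Qed.

Section Kinds.
Variables (t j s a b v : nat) (y : bool).

Lemma sat_kind0 : sat_kind 0 t j s a b v y =
  ~~ y && ((v == vQ t s) || (v == vX t H a) || (v == vX t j.+1 b)) ||
    y && (v == vX t.+1 (j.+2 - next_move s a) (if j.+1 == H then next_sym s a else b)).
Proof. by []. Qed.

Lemma sat_kind1 : sat_kind 1 t j s a b v y =
  ~~ y && ((v == vQ t s) || (v == vX t H a)) || y && (v == vQ t.+1 (next_state s a)).
Proof. by []. Qed.

Lemma sat_kind2 : sat_kind 2 t j s a b v y =
  y && (if guess j.+1 then (v == vX 0 j.+1 0) || (v == vX 0 j.+1 1) || (v == vX 0 j.+1 2)
        else v == vX 0 j.+1 (init_sym j.+1)).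
Proof. by []. Qed.

Lemma sat_kind3 : sat_kind 3 t j s a b v y =
  ~~ guess j.+1 || (~~ y && (v == vX 0 j.+1 0)) || (y && (v == vX 0 j.+2 0)).
Proof. by []. Qed.

Lemma sat_kind4 : sat_kind 4 t j s a b v y = y && (v == vQ 0 0).
Proof. by []. Qed.

Lemma sat_kind5 : sat_kind 5 t j s a b v y = ~~ y && (v == vX T H 0).
Proof. by []. Qed.

Lemma sat_kind6 : sat_kind 6 t j s a b v y = ~~ y && (v == vX T H 1).
Proof. by []. Qed.

Lemma sat_kind7 : sat_kind 7 t j s a b v y = ~~ y && (v == vX T H.+1 1).
Proof. by []. Qed.

Lemma sat_kind8 : sat_kind 8 t j s a b v y = ~~ y && (v == vX T H.+1 2).
Proof. by []. Qed.

End Kinds.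

Lemma width_center : W = T + H + 3. Proof. by rewrite /W /width /H /center -/T; lia. Qed.
Lemma T_lt_center : H = T.+1. Proof. by []. Qed.

Lemma init_sym_lt3 j : init_sym j < 3.
Proof.
rewrite /init_sym; case: ifP => // _; case: ifP => _; first by case: nth.
by case: ifP => // _; case: ifP.
Qed.

Lemma sat_complete w : size w <= wit_max -> let c := init M (pair_enc x w) in
  row c T H = 2 -> row c T H.+1 = 0 ->
  forall k t j s a b, k < 9 -> t < T -> j < 2 * T + 2 -> s <= q -> a < 3 -> b < 3 ->
  satisfied (facts c) k t j s a b.
Proof.
move=> sw c cH cH1 k t j s a b k9 tT jT sq a3 b3.
have WH := width_center; have HT := T_lt_center.
have W0 : 0 < W by rewrite WH; lia.
have HW : H < W by rewrite WH; lia.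
have jW : j.+1 < W by rewrite WH HT; lia.
have jW2 : j.+2 < W by rewrite WH HT; lia.
have X_lt u i d : u <= T -> i < W -> d < 3 -> vX u i d < nvars.
  by move=> *; apply: vX_lt => //; apply: sym_lt.
have tT' := ltnW tT.
have notT r (D : r != 2) : (r == 2) = false by apply/negbTE.
have final i d : i < W -> d < 3 -> row c T i != d ->
    exists2 v, v < nvars & ~~ facts c v && (v == vX T i d).
  move=> iW d3 D; exists (vX T i d); first exact: X_lt.
  by rewrite facts_X // D eqxx.
have [R1 R2 R3 R4] := row_step c t j.
rewrite /satisfied.
have : k \in iota 0 9 by rewrite mem_iota.
rewrite /= !inE; do ! (case/orP; [move/eqP=> -> {k k9}| ]); last move/eqP => -> {k k9}.
(* A premise that fails in the run satisfies the clause by itself; if all premises hold, so does the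
   conclusion. *)
- have [Es|Es] := eqVneq (state_of (run_at c t) : nat) s; last first.
    by exists (vQ t s); [exact: vQ_lt|rewrite sat_kind0 facts_Q // (negbTE Es) eqxx].
  have [Ea|Ea] := eqVneq (row c t H) a; last first.
    by exists (vX t H a); [exact: X_lt|rewrite sat_kind0 facts_X // (negbTE Ea) eqxx !orbT].
  have [Eb|Eb] := eqVneq (row c t j.+1) b; last first.
    by exists (vX t j.+1 b); [exact: X_lt|rewrite sat_kind0 facts_X // (negbTE Eb) eqxx !orbT].
  rewrite Es Ea Eb in R2 R3 R4.
  have v3 : (if j.+1 == H then next_sym s a else b) < 3 by case: ifP.
  have nW : j.+2 - next_move s a < W by apply: leq_ltn_trans (leq_subr _ _) jW2.
  exists (vX t.+1 (j.+2 - next_move s a) (if j.+1 == H then next_sym s a else b)).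
    exact: X_lt.
  by rewrite sat_kind0 facts_X // R4 !eqxx orbT.
- have [Es|Es] := eqVneq (state_of (run_at c t) : nat) s; last first.
    by exists (vQ t s); [exact: vQ_lt|rewrite sat_kind1 facts_Q // (negbTE Es) eqxx].
  have [Ea|Ea] := eqVneq (row c t H) a; last first.
    by exists (vX t H a); [exact: X_lt|rewrite sat_kind1 facts_X // (negbTE Ea) eqxx !orbT].
  rewrite Es Ea in R1.
  have nq : next_state s a <= q by rewrite -R1 -ltnS.
  exists (vQ t.+1 (next_state s a)); first exact: vQ_lt.
  by rewrite sat_kind1 facts_Q // R1 !eqxx orbT.
- have := init_row j.+1 sw; rewrite -/c; case G: (guess j.+1) => E.
    have r3 := row_lt3 c 0 j.+1.
    exists (vX 0 j.+1 (row c 0 j.+1)); first exact: X_lt.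
    rewrite sat_kind2 G facts_X // eqxx.
    by move: r3; case: (row c 0 j.+1) => [|[|[|]]] // _; rewrite eqxx ?orbT.
  have i3 := init_sym_lt3 j.+1.
  exists (vX 0 j.+1 (init_sym j.+1)); first exact: X_lt.
  by rewrite sat_kind2 G facts_X // E !eqxx.
- case G: (guess j.+1); last first.
    by exists (vX 0 0 0); [exact: X_lt|rewrite sat_kind3 G].
  have [E|E] := eqVneq (row c 0 j.+1) 0; last first.
    by exists (vX 0 j.+1 0); [exact: X_lt|rewrite sat_kind3 facts_X // (negbTE E) eqxx orbT].
  exists (vX 0 j.+2 0); first exact: X_lt.
  rewrite sat_kind3 facts_X // eqxx andbT; apply/orP; right; apply/eqP.
  have := init_row j.+1 sw; have := init_row j.+2 sw; rewrite G -/c E.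
  case: ifP => [_ ->|G' -> E'].
    case E' : (nth None (map Some w) _) => [[]|] // _.
    by rewrite nth_default // size_map; move: E'; case: (ltnP (j.+1 - H - (2 * size x).+2) (size w)) => h;
      [rewrite (nth_map false)|move: G; rewrite /guess; lia].
  move: G G'; rewrite /guess /init_sym => /andP [g1 g2] /negbT g3.
  case: ifP => // h1; case: ifP => h2; first by lia.
  by case: ifP => h3; [lia|case: ifP => // h4; lia].
- exists (vQ 0 0); first exact: vQ_lt.
  by rewrite sat_kind4 facts_Q // eqxx /c; case: pair_enc.
- by apply: final => //; rewrite cH.
- by apply: final => //; rewrite cH.
- by apply: final => //; rewrite ?cH1 // WH HT; lia.
- by apply: final => //; rewrite ?cH1 // WH HT; lia.
Qed.

Lemma time_max_gt0 : 0 < T.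
Proof. by rewrite /T /time_max addn_gt0 expn_gt0 addn2. Qed.

(** The assignment need not describe a run, but the implications force it to contain every fact, in
    a window around the head, of the run on a witness read off its first row. The excluded outputs
    then decide the last row. *)
Lemma sat_sound al :
  (forall k t j s a b, k < 9 -> t < T -> j < 2 * T + 2 -> s <= q -> a < 3 -> b < 3 ->
    satisfied al k t j s a b) ->
  exists w, let c := init M (pair_enc x w) in
    [/\ size w <= wit_max, row c T H = 2 & row c T H.+1 = 0].
Proof.
move=> sat_al; have T0 := time_max_gt0; have HT := T_lt_center; have WH := width_center.
have J0 : 0 < 2 * T + 2 by lia.
have trans t j s a b : t < T -> j < 2 * T + 2 -> s <= q -> a < 3 -> b < 3 ->
    al (vQ t s) -> al (vX t H a) -> al (vX t j.+1 b) ->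
    al (vX t.+1 (j.+2 - next_move s a) (if j.+1 == H then next_sym s a else b)).
  move=> h1 h2 h3 h4 h5 a1 a2 a3; have [//|v _] := sat_al 0 t j s a b _ h1 h2 h3 h4 h5.
  rewrite sat_kind0; case E: (al v) => /=; first by move/eqP => <-.
  by rewrite orbF -orbA => /or3P [] /eqP D; rewrite D ?a1 ?a2 ?a3 in E.
have trans_state t s a : t < T -> s <= q -> a < 3 ->
    al (vQ t s) -> al (vX t H a) -> al (vQ t.+1 (next_state s a)).
  move=> h1 h3 h4 a1 a2; have [//|//|v _] := sat_al 1 t 0 s a 0 _ h1 J0 h3 h4.
  rewrite sat_kind1; case E: (al v) => /=; first by move/eqP => <-.
  by rewrite orbF => /orP [] /eqP D; rewrite D ?a1 ?a2 in E.
have init0 j : j < 2 * T + 2 ->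
    if guess j.+1 then al (vX 0 j.+1 0) || al (vX 0 j.+1 1) || al (vX 0 j.+1 2)
    else al (vX 0 j.+1 (init_sym j.+1)).
  move=> h2; have [//|//|//|//|v _] := sat_al 2 0 j 0 0 0 _ T0 h2.
  rewrite sat_kind2; case: ifP => _ /andP [av]; last by move/eqP <-.
  by rewrite -orbA => /or3P [] /eqP <-; rewrite av ?orbT.
have prop0 j : j < 2 * T + 2 -> guess j.+1 -> al (vX 0 j.+1 0) -> al (vX 0 j.+2 0).
  move=> h2 G a1; have [//|//|//|//|v _] := sat_al 3 0 j 0 0 0 _ T0 h2.
  rewrite sat_kind3 G /=; case E: (al v) => /=; first by move/eqP => <-.
  by rewrite orbF => /eqP D; rewrite D a1 in E.
have initQ : al (vQ 0 0).
  have [//|//|//|//|v _] := sat_al 4 0 0 0 0 0 _ T0 J0.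
  by rewrite sat_kind4 => /andP [av /eqP <-].
pose B := H + (2 * size x).+2; pose g i := al (vX 0 (B + i) 0).
(* The first cell marked blank ends the witness. Every cell before it carries a bit, and one marked
   with both bits is read as 1. *)
pose m := find g (iota 0 wit_max).
have mp : m <= wit_max by rewrite -[X in _ <= X](size_iota 0) find_size.
pose w := mkseq (fun i => al (vX 0 (B + i) 2)) m.
have sw : size w = m by rewrite size_mkseq.
exists w; set c := init M (pair_enc x w).
have base j : j < 2 * T + 2 -> al (vX 0 j.+1 (row c 0 j.+1)).
  move=> h2; have I0 := init0 j h2.
  have sw' : size w <= wit_max by rewrite sw.
  have := init_row j.+1 sw'; rewrite -/c; case: ifP I0 => [G I0 ->|_ I0 -> //].
  have [i iB] : exists i, j.+1 = B + i.
    by exists (j.+1 - B); move: G; rewrite /guess /B; lia.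
  have -> : j.+1 - H - (2 * size x).+2 = i by rewrite iB /B; lia.
  have ip : i < wit_max by move: G; rewrite /guess iB /B; lia.
  case: (ltnP i m) => im.
    have gi : ~~ g i by have := before_find 0 im; rewrite nth_iota // add0n => ->.
    rewrite (nth_map false) ?sw // nth_mkseq // -iB.
    case E: (al (vX 0 j.+1 2)) => //=.
    by move: I0; rewrite E orbF iB => /orP [] // gi'; rewrite /g gi' in gi.
  rewrite nth_default; last by rewrite size_map -/w sw.
  rewrite -[code None]/0 iB.
  have gm : g m.
    have : has g (iota 0 wit_max) by rewrite has_find size_iota -/m; lia.
    by move/(nth_find 0); rewrite -/m nth_iota ?add0n //; lia.
  rewrite -/(g i); have : B + i <= 2 * T + 2 by lia.
  elim: i im ip {iB} => [|i IH] im ip h; first by have -> : 0 = m by lia.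
  case: (ltnP i m) => im'; first by have -> : i.+1 = m by lia.
  have gi : g i by apply: IH; lia.
  rewrite /g addnS; have Bi : B + i = (B + i).-1.+1 by rewrite /B; lia.
  rewrite Bi; apply: prop0; rewrite -?Bi //; first by lia.
  by rewrite /guess /B; lia.
(* The controlled window loses one column at each end per step; after [T] steps exactly the head
   column [H = T + 1] and its right neighbour remain. *)
have main t : t <= T -> al (vQ t (state_of (run_at c t))) /\
    forall j, t <= j -> j + t < 2 * T + 2 -> al (vX t j.+1 (row c t j.+1)).
  elim: t => [_|t IH tT].
    split; last by move=> j _; rewrite addn0; apply: base.
    by move: initQ; rewrite /c; case: pair_enc.
  have [aQ aX] := IH (ltnW tT).
  have sq : state_of (run_at c t) <= q by rewrite -ltnS.
  have r3 := row_lt3 c t.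
  have aH : al (vX t H (row c t H)) by rewrite HT; apply: aX; lia.
  have R j := row_step c t j.
  have [R1 R2 _ _] := R 0; rewrite R1; split; first exact: trans_state.
  move=> j tj jt.
  have Mj : j.+2 = (j + next_move (state_of (run_at c t)) (row c t H)).+2 - next_move (state_of (run_at c t)) (row c t H).
    by rewrite -!addSn addnK.
  set mv := next_move _ _ in R2 Mj.
  have [j' Ej] : exists j', j + mv = j'.+1.
    by exists (j + mv).-1; lia.
  have [_ _ _] := R j'; rewrite -/mv.
  have -> : j'.+2 - mv = j.+1 by lia.
  move=> ->.
  have -> : j.+1 = j'.+2 - mv by lia.
  by apply: trans => //; [lia|apply: aX; lia].
have [_ aT] := main T (leqnn _).
have aH : al (vX T H (row c T H)) by rewrite HT; apply: aT; lia.
have aH1 : al (vX T H.+1 (row c T H.+1)) by apply: aT; lia.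
have fin5 : ~~ al (vX T H 0).
  have [//|//|//|//|v _] := sat_al 5 0 0 0 0 0 _ T0 J0.
  by rewrite sat_kind5 => /andP [av /eqP <-].
have fin6 : ~~ al (vX T H 1).
  have [//|//|//|//|v _] := sat_al 6 0 0 0 0 0 _ T0 J0.
  by rewrite sat_kind6 => /andP [av /eqP <-].
have fin7 : ~~ al (vX T H.+1 1).
  have [//|//|//|//|v _] := sat_al 7 0 0 0 0 0 _ T0 J0.
  by rewrite sat_kind7 => /andP [av /eqP <-].
have fin8 : ~~ al (vX T H.+1 2).
  have [//|//|//|//|v _] := sat_al 8 0 0 0 0 0 _ T0 J0.
  by rewrite sat_kind8 => /andP [av /eqP <-].
have r1 := row_lt3 c T H; have r2 := row_lt3 c T H.+1.
split; first by rewrite sw.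
  by move: aH r1; case: (row c T H) => [|[|[|]]] // h; rewrite h in fin5 fin6.
by move: aH1 r2; case: (row c T H.+1) => [|[|[|]]] // h; rewrite h in fin7 fin8.
Qed.

End Tableau.

(** The output runs from the head to the first blank, so these two cells decide whether it is
    [[:: true]]. *)
Lemma output_true M k1 k2 x c :
  let t := time_max k1 k2 x in let h := center k1 k2 x in
  (row k1 k2 x c t h = 2 /\ row k1 k2 x c t h.+1 = 0) <-> output (@run_at M c t) = [:: true].
Proof.
move=> t h; rewrite row_center /row.
have -> : (Z.of_nat h.+1 - Z.of_nat h = 1)%Z by lia.
case: (run_at c t) => [[[s l] a] r]; rewrite /cells_of /= (cells_ge0 l a r 0) (cells_ge0 l a r 1) /=.
by case: a => [[|]|]; case: r => [|[[]|] r]; split=> // -[].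
Qed.

Lemma halted_stay M (c : config M) t T : t <= T -> halted (run t c) -> run T c = run t c.
Proof.
move=> /subnKC <-; move: (T - t) => u; rewrite /halted => H.
elim: u => [|u IH]; first by rewrite addn0.
by rewrite addnS /run iterS -/(run (t + u) c) IH; move: H; case: step.
Qed.

(** [sat x c v y] says that giving [v] the value [y] satisfies clause [c]. This local description,
    in [PF] at any arguments, is all that the reduction queries. *)
Theorem cook_levin L : in_NP L -> exists NC NV sat,
  [/\ PF (fun x _ => NC x), PF (fun x _ => NV x),
      forall c v y, PF c -> PF v -> PB y -> PB (fun x e => sat x (c x e) (v x e) (y x e)) &
      forall x, L x <-> exists al : nat -> bool,
        forall c, c < NC x -> exists2 v, v < NV x & sat x c v (al v)].
Proof.
move=> [V [k2 [[f [[M [k1 HM]] HV]] HL]]].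
exists (nclauses M k1 k2), (nvars M k1 k2), (sat M k1 k2); split.
- by rewrite /nclauses /time_max /wit_max; pf.
- by rewrite /nvars /width /nattr /time_max /wit_max; pf.
- move=> c v y Hc Hv Hy.
  rewrite /sat /sat_kind /guess /init_sym /next_sym /next_move /next_state /next_tab
    /vQ /vX /center /width /nattr /time_max /wit_max.
  by pf.
move=> x.
have acc w : size w <= wit_max k2 x -> V (pair_enc x w) <->
   output (run_at (init M (pair_enc x w)) (time_max k1 k2 x)) = [:: true].
  move=> sw; have [t [Ht [h o]]] := HM (pair_enc x w); rewrite HV -o.
  rewrite -(halted_stay (T := time_max k1 k2 x) _ h) //.
  apply: leq_trans Ht _; rewrite /time_max leq_add2r size_pair_enc.
  by case: (k1) => // k; rewrite leq_exp2r // leq_add2l.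
rewrite HL; split=> [[w [sw Vw]]|[al /satisfied_clauses Hal]].
  exists (facts k1 k2 x (init M (pair_enc x w))); apply/satisfied_clauses.
  have /output_true [r1 r2] : output (run_at (init M (pair_enc x w)) (time_max k1 k2 x)) = [:: true].
    by apply/acc.
  exact: sat_complete.
have [w [sw r1 r2]] := sat_sound Hal; exists w; split=> //.
by apply/acc => //; apply/output_true.
Qed.

(** * Votes with one floating candidate *)

Lemma sum_perm m (v : {perm 'I_m}) (F : 'I_m -> nat) : \sum_a F (v a) = \sum_a F a.
Proof. by rewrite [RHS](reindex_inj (@perm_inj _ v)). Qed.

Lemma sum_ord_lt m n : n <= m -> \sum_(i < m) (i < n) = n.
Proof.
elim: m n => [|m IH] n; first by rewrite leqn0 => /eqP ->; rewrite big_ord0.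
rewrite big_ord_recr /=; case: (ltngtP n m.+1) => // [nm|->] _; first by rewrite IH //; lia.
rewrite (eq_bigr (fun=> 1)) => [|i _]; last by rewrite (ltn_trans (ltn_ord i)).
by rewrite sum_nat_const card_ord muln1 addn1.
Qed.

Lemma sum_perm_lt m (v : {perm 'I_m}) a : \sum_b (v b < v a) = v a.
Proof. by rewrite (sum_perm v (fun i => i < v a)) sum_ord_lt // ltnW. Qed.

Section Ranking.
Variables (m : nat) (k : 'I_m -> nat).
Hypothesis k_inj : injective k.

Definition rank (a : 'I_m) := \sum_b (k b < k a).

Lemma rank_lt a : rank a < m.
Proof.
rewrite /rank (bigD1 a) //= ltnn add0n.
have : \sum_(b | b != a) (k b < k a) <= \sum_(b | b != a) 1.
  by apply: leq_sum => b _; case: (_ < _).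
have : \sum_(b : 'I_m) 1 = m by rewrite sum_nat_const card_ord muln1.
rewrite (bigD1 a) //=; lia.
Qed.

Lemma rank_homo a b : k a < k b -> rank a < rank b.
Proof.
move=> ab; rewrite /rank (bigD1 a) //= ltnn add0n [X in _ < X](bigD1 a) //= ab ltnS.
by apply: leq_sum => c _; case: (ltnP (k c) (k a)) => // h; rewrite (ltn_trans h ab).
Qed.

Lemma rank_inj : injective (fun a => Ordinal (rank_lt a)).
Proof.
move=> a b /(congr1 val) /= E; apply: k_inj.
by case: (ltngtP (k a) (k b)) => // /rank_homo; rewrite E ltnn.
Qed.

Definition vote_of : {perm 'I_m} := perm rank_inj.

Lemma vote_ofE a : vote_of a = rank a :> nat. Proof. by rewrite permE. Qed.

Lemma vote_of_lt a b : (vote_of a < vote_of b) = (k a < k b).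
Proof.
rewrite !vote_ofE; case: (ltngtP (k a) (k b)) => [/rank_homo //|/rank_homo|/k_inj ->].
  by move=> h; apply/negbTE; rewrite -leqNgt ltnW.
by rewrite ltnn.
Qed.

Lemma sum_rank : \sum_a rank a = \sum_(a < m) a.
Proof. by rewrite -(sum_perm vote_of (fun i => nat_of_ord i)); apply: eq_bigr => a _; rewrite vote_ofE. Qed.

Definition rev_rel : rel 'I_m := fun a b => k b < k a.

(** [rev_rel] is total, so it has only one extension, and the points there are the ranks in the
    original order. *)
Lemma extends_rev v a : extends v rev_rel -> m.-1 - v a = rank a.
Proof.
move=> H; have Hv b : (v b < v a) = (k a < k b).
  case: (ltngtP (k a) (k b)) => [/H //|/H h|/k_inj ->]; last by rewrite ltnn.
  by apply/negbTE; rewrite -leqNgt ltnW.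
have : rank a + v a + 1 = m; last by have := rank_lt a; lia.
rewrite -sum_perm_lt /rank -big_split /= (bigD1 a) //= !ltnn !add0n.
rewrite (eq_bigr (fun=> 1)) => [|b /eqP ba]; last first.
  rewrite Hv; case: (ltngtP (k a) (k b)) => // /k_inj E; by rewrite E in ba.
have : \sum_(b : 'I_m) 1 = m by rewrite sum_nat_const card_ord muln1.
rewrite (bigD1 a) //=; lia.
Qed.

Definition rev_vote : {perm 'I_m} := (vote_of * perm rev_ord_inj)%g.

Lemma rev_vote_extends : extends rev_vote rev_rel.
Proof.
move=> a b ab; rewrite !permM !permE /=.
by have := rank_homo ab; have := rank_lt a; have := rank_lt b; lia.
Qed.

Lemma rev_rel_strict : strict_partial_order rev_rel.
Proof. by split=> [a|a b c ab bc]; rewrite /rev_rel ?ltnn //; apply: ltn_trans bc ab. Qed.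

Lemma rev_rel_total a b : a != b -> rev_rel a b || rev_rel b a.
Proof.
by rewrite /rev_rel => /eqP ab; case: (ltngtP (k a) (k b)) => // /k_inj.
Qed.

End Ranking.

Definition key (t0 t1 t2 t3 a : nat) : nat :=
  if a == t0 then 0 else if a == t1 then 1 else if a == t2 then 2
  else if a == t3 then 3 else 4 + a.

Lemma key_inj t0 t1 t2 t3 : injective (key t0 t1 t2 t3).
Proof.
move=> a b; rewrite /key.
by repeat (case: eqP => ? //); lia.
Qed.

Lemma ikey_inj m t0 t1 t2 t3 : injective (fun a : 'I_m => key t0 t1 t2 t3 a).
Proof. by move=> a b /key_inj /val_inj. Qed.

(* The vote t0 > t1 > t2 > t3 > ... in which t0 is released from t1, ..., t_w; if flip is set (and
   w is 1) it is instead forced below t1. *)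
Definition gad (t0 t1 t2 t3 w : nat) (flip : bool) (a b : nat) : bool :=
  ((key t0 t1 t2 t3 a < key t0 t1 t2 t3 b) && ~~ ((a == t0) && (key t0 t1 t2 t3 b <= w)))
  || [&& flip, a == t1 & b == t0].

Section Gadget.
Variables (m t1 t2 t3 w : nat) (flip : bool) (t0 : 'I_m).
Hypotheses (t01 : t0 != t1 :> nat) (w3 : w <= 3) (wflip : flip -> 0 < w).
Let k (a : 'I_m) := key t0 t1 t2 t3 a.
Let O : rel 'I_m := fun a b => gad t0 t1 t2 t3 w flip a b.

Let k_inj : injective k := @ikey_inj m t0 t1 t2 t3.

Lemma k_t0 : k t0 = 0. Proof. by rewrite /k /key eqxx. Qed.

Lemma k_eq0 a : (k a == 0) = (a == t0).
Proof. by rewrite -k_t0 (inj_eq k_inj). Qed.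

Lemma k_t1 (a : 'I_m) : (a == t1 :> nat) = (k a == 1).
Proof.
rewrite /k /key; case: (eqVneq (a : nat) t0) => [->|_]; first by rewrite (negbTE t01).
by case: ifP => // _; case: ifP => // _; case: ifP.
Qed.

Lemma OE a b : O a b = ((k a < k b) && ~~ ((k a == 0) && (k b <= w))) || [&& flip, k a == 1 & k b == 0].
Proof. by rewrite /O /gad -k_t1 !k_eq0. Qed.

Lemma gad_strict : strict_partial_order O.
Proof. by split=> [a|a b c]; rewrite !OE; lia. Qed.

(** Every incomparable pair contains [t0], whose key is 0, so the sum of its keys determines it, and
    this sum is at most [w]. *)
Lemma gad_unknown : unknown_pairs O <= 4.
Proof.
rewrite /unknown_pairs.
set S := [set p | _].
have inj : {in S &, injective (fun p : 'I_m * 'I_m => inord (k p.1 + k p.2) : 'I_4)}.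
  move=> [a b] [a' b']; rewrite !inE !OE /= => /andP [/andP [ab h1] h2] /andP [/andP [ab' h1'] h2'].
  have nk (c d : 'I_m) : c < d -> k c <> k d by move=> + /k_inj E; rewrite E ltnn.
  have := nk _ _ ab; have := nk _ _ ab' => n' n.
  move/(congr1 (@nat_of_ord 4)) => /=; rewrite !inordK; try lia.
  move=> E; have [[E1 E2]|[E1 E2]] : (k a = k a' /\ k b = k b') \/ (k a = k b' /\ k b = k a') by lia.
    by rewrite (k_inj E1) (k_inj E2).
  by move: ab ab'; rewrite (k_inj E1) (k_inj E2); lia.
by rewrite -(card_in_imset inj) (leq_trans (max_card _)) // card_ord.
Qed.

(** A released candidate earns one point by overtaking [t0]. *)
Definition gain (v : {perm 'I_m}) (a : 'I_m) : bool := (0 < k a <= w) && (v a < v t0).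

Lemma gain_t0 v : gain v t0 = false. Proof. by rewrite /gain k_t0. Qed.

(** The order among the candidates other than [t0] is total, so only the side on which [t0] lies can
    change the position of [a]. *)
Lemma gad_rank v a : extends v O -> a != t0 -> v a + gain v a = rank k a.
Proof.
move=> H at0; rewrite -sum_perm_lt /rank [in LHS](bigD1 t0) //= [in RHS](bigD1 t0) //= k_t0.
rewrite lt0n k_eq0 at0.
rewrite (eq_bigr (fun b => (k b < k a) : nat)) => [|b bt0].
  suff E : (v t0 < v a) + gain v a = 1 by rewrite addnAC E.
  have ka : 0 < k a by rewrite lt0n k_eq0.
  have := H t0 a; rewrite OE k_t0 /gain ka /=.
  case: (leqP (k a) w) => [_ _|_ /(_ isT) ->] //.
  by case: ltngtP => // /val_inj /perm_inj /eqP; rewrite eq_sym (negbTE at0).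
have := H b a; have := H a b; rewrite !OE.
have b0 : 0 < k b by rewrite lt0n k_eq0.
have a0 : 0 < k a by rewrite lt0n k_eq0.
case: (ltngtP (k a) (k b)) => [ab h _|ab _ h|/k_inj -> _ _]; last by rewrite ltnn.
  by rewrite ltnNge ltnW ?h //; lia.
by rewrite h //; lia.
Qed.

(** Positions have a constant sum, so [t0] loses exactly what the others gain. *)
Lemma gad_loss v : extends v O -> v t0 = \sum_a gain v a :> nat.
Proof.
move=> H.
have : \sum_a v a = \sum_a rank k a.
  by rewrite (sum_rank k_inj) -(sum_perm v (fun i => nat_of_ord i)).
rewrite (bigD1 t0) //= [in RHS](bigD1 t0) //= [in RHS](eq_bigr (fun a => v a + gain v a)) => [|a at0]; last first.
  by rewrite gad_rank.
have -> : rank k t0 = 0 by rewrite /rank big1 // => b _; rewrite k_t0 ltn0.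
rewrite big_split /= [in \sum_a gain v a](bigD1 t0) //= gain_t0; lia.
Qed.

(** The reversed vote cancels the base order and leaves only the transfer. The loss stands on the
    left to avoid truncated subtraction. *)
Lemma gad_score v u a : extends v O -> extends u (rev_rel k) ->
  (m.-1 - v a) + (m.-1 - u a) + (a == t0) * v t0 = m.-1 + gain v a.
Proof.
move=> Hv Hu; rewrite (extends_rev k_inj a Hu).
have := ltn_ord (v a).
have [->|at0] := eqVneq a t0.
  have -> : rank k t0 = 0 by rewrite /rank big1 // => b _; rewrite k_t0 ltn0.
  by rewrite gain_t0; lia.
by have := gad_rank Hv at0; rewrite mul0n; lia.
Qed.

Lemma gad_flip v : extends v O -> flip -> forall a : 'I_m, a = t1 :> nat -> v a < v t0.
Proof. by move=> H fl a /eqP Ha; apply: H; rewrite /O /gad fl Ha eqxx orbT. Qed.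

(** The two extreme completions: [t0] stays on top or drops just below the other tops. When [w < 3]
    these coincide, so the drop passes only the released candidate. *)
Lemma gad_vote (x : bool) : (flip -> x) -> (x -> 0 < w) -> (w < 3 -> t2 = t1 /\ t3 = t1) ->
  extends (if x then vote_of (@ikey_inj m t1 t2 t3 t0) else vote_of (@ikey_inj m t0 t1 t2 t3)) O.
Proof.
move=> fx xw w12 a b; rewrite /O /gad; case: x fx xw => [_ /(_ isT) w0|fx _]; rewrite vote_of_lt; last first.
  by case: flip fx => [/(_ isT)|_] //=; rewrite orbF => /andP [].
have [{w12} /w12 [-> ->]|w3'] := ltnP w 3; rewrite /k /key.
  by repeat (case: eqP => ? //=); move: t01; lia.
by repeat (case: eqP => ? //=); move: t01; lia.
Qed.

End Gadget.

Lemma sum_prod A B (F : nat -> nat) :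
  \sum_(g < A * B) F g = \sum_(i < A) \sum_(k < B) F (i * B + k).
Proof.
elim: A => [|A IH]; first by rewrite !big_ord0.
by rewrite mulSnr big_split_ord big_ord_recr /= IH.
Qed.

(** * The reduction from satisfiability *)

Lemma sum2 (F : nat -> nat) : \sum_(k < 2) F k = F 0 + F 1.
Proof. by rewrite !big_ord_recr big_ord0. Qed.

Section Reduction.
Variables (C V : nat) (sat : nat -> nat -> bool -> bool).

(* A node nd = c * V + v stands for the occurrence of variable v at clause c; the candidates are
   x_nd = nd, d_nd = N + nd, l_nd = 2 N + nd, u_c = 3 N + c, then c0 = 3 N + C, e, f and z. *)
Definition nodes := C * V.
Local Notation N := nodes.
Definition cand_e := (3 * N + C).+1.
Local Notation Y := cand_e.
Definition cand_f := Y.+1.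
Definition cand_z := Y.+2.
Definition ncand := Y.+3.
Local Notation f := cand_f. Local Notation z := cand_z. Local Notation m := ncand.

(** The same variable at the preceding clause, cyclically. *)
Definition prev nd := if nd < V then nd + N - V else nd - V.
(* Against the true vote, the initial lead of e over a candidate is -2 for the x's, 2 for the d's
   and l's, V for the u's and 1 for c0; the strict inequalities needed by e come from here. *)
Definition rho i :=
  if i < N then V + 5 + i
  else if i < 3 * N then V + 1 + i
  else if i < 3 * N + C then 3 + i
  else if i == 3 * N + C then V + 2 + i else V + 3 + i.
(** Large enough for every offset [rho i] and for the boosts, which use at most [boost_height + 3]
    transfers. *)
Definition copies := V + 2 * Y + 30.
Local Notation K := copies.
(** Two choice gadgets per node; then, for each candidate up to [e], [K] free transfers and [K]
    places for forced ones, of which [rho i] are in use. *)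
Definition ngad := N * 2 + Y.+1 * (K + K).
Local Notation G := ngad.

Definition choice g := g < N * 2.
Definition pcand g := (g - N * 2) %/ (K + K).
Definition pcopy g := (g - N * 2) %% (K + K).
(** The free transfers indexed by [e] go from [e] to [z]; in all other gadgets outside the choices
    the donor is [f]. *)
Definition pboost g := (pcopy g < K) && (pcand g == Y).

Definition top0 g := if choice g then g %/ 2 else if pboost g then Y else f.
Definition top1 g := if choice g then N + g %/ 2 else if pboost g then z else pcand g.
(** Choice 1 at a node and choice 0 at the next clause feed the same [l], which can afford one point
    only: hence the implication between the copies of a variable. *)
Definition top2 g :=
  if choice g then 2 * N + (if g %% 2 == 1 then g %/ 2 else prev (g %/ 2)) else top1 g.
(** A literal that satisfies the clause sends its point to [f] and so spares [u]. *)
Definition top3 g :=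
  if choice g then (if sat (g %/ 2 %/ V) (g %/ 2 %% V) (g %% 2 == 1) then f else 3 * N + g %/ 2 %/ V)
  else top1 g.
Definition wid g := if choice g then 3 else if pcopy g < K + rho (pcand g) then 1 else 0.
Definition flp g :=
  if choice g then false else (K <= pcopy g) && (pcopy g < K + rho (pcand g)).

Definition vote_rel (j a b : nat) : bool :=
  let g := j %/ 2 in
  if j %% 2 == 0 then gad (top0 g) (top1 g) (top2 g) (top3 g) (wid g) (flp g) a b
  else key (top0 g) (top1 g) (top2 g) (top3 g) b < key (top0 g) (top1 g) (top2 g) (top3 g) a.

(* Each gadget contributes two votes, which cancel out unless t0 moves in the first one. *)
Definition profile : seq (rel 'I_m) := mkseq (fun j => fun a b : 'I_m => vote_rel j a b) (G * 2).

Lemma choice_lt g : choice g -> g %/ 2 < N. Proof. by rewrite /choice; lia. Qed.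

Lemma pcand_lt g : g < G -> ~~ choice g -> pcand g < Y.+1.
Proof.
rewrite /choice /ngad /pcand -leqNgt => gG h; rewrite ltn_divLR; last by rewrite /copies; lia.
lia.
Qed.

Lemma node_clause nd : nd < N -> nd %/ V < C.
Proof. by rewrite /nodes; case: V => [|V']; [rewrite muln0|move=> h; rewrite ltn_divLR]. Qed.

Lemma prev_lt nd : nd < N -> prev nd < N.
Proof. by rewrite /prev => h; case: (ltnP nd V) => ?; lia. Qed.

Lemma rho_copies i : i < Y.+1 -> rho i <= K.
Proof. by rewrite /rho /copies /cand_e; do 4 (case: ifP => _; first lia); lia. Qed.

Lemma tops g : g < G ->
  [/\ top0 g < m, top0 g != top1 g, wid g <= 3, flp g -> 0 < wid g &
      wid g < 3 -> top2 g = top1 g /\ top3 g = top1 g].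
Proof.
move=> gG; rewrite /top0 /top2 /top3 /top1 /wid /flp /ncand.
case c: (choice g).
  by have h := choice_lt c; rewrite /cand_e; split=> //; lia.
have ip := pcand_lt gG (negbT c); case: ifP => b; case: ifP => w; split=> //;
  rewrite /cand_f /cand_z ?w ?andbF //; lia.
Qed.

Definition t0 g : 'I_m := inord (top0 g).

Lemma t0E g : g < G -> t0 g = top0 g :> nat.
Proof. by move=> /tops [h _ _ _ _]; rewrite inordK. Qed.

Definition vote_rel_ord j : rel 'I_m := fun a b => vote_rel j a b.

Lemma in_profile P : in_info_set profile P <->
  size P = G * 2 /\ forall j, j < G * 2 -> extends (nth 1%g P j) (vote_rel_ord j).
Proof.
rewrite /in_info_set /profile size_mkseq; split=> -[h1 h2]; split=> // i hi.
  by have := h2 _ hi; rewrite nth_mkseq.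
by rewrite nth_mkseq //; apply: h2.
Qed.

Lemma vote_rel_even g : g < G -> vote_rel_ord (g * 2) =
  fun a b : 'I_m => gad (t0 g) (top1 g) (top2 g) (top3 g) (wid g) (flp g) a b.
Proof. by move=> gG; rewrite /vote_rel_ord /vote_rel mulnK // modnMl t0E. Qed.

Lemma vote_rel_odd g : g < G -> vote_rel_ord (g * 2 + 1) =
  rev_rel (fun a : 'I_m => key (t0 g) (top1 g) (top2 g) (top3 g) a).
Proof. by move=> gG; rewrite /vote_rel_ord /vote_rel divnMDl // modnMDl addn0 t0E. Qed.

Definition gn (P : seq {perm 'I_m}) g (a : 'I_m) : bool :=
  gain (top1 g) (top2 g) (top3 g) (wid g) (t0 g) (nth 1%g P (g * 2)) a.

Lemma profile_admissible : admissible profile.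
Proof.
move=> j; rewrite /profile size_mkseq => jG /=; rewrite nth_mkseq //.
rewrite -/(vote_rel_ord j) (divn_eq j 2).
have gG : j %/ 2 < G by rewrite ltn_divLR.
have [h1 h2 h3 h4 h5] := tops gG; rewrite -(t0E gG) in h2.
have : j %% 2 < 2 by rewrite ltn_mod.
case: (j %% 2) => [|[|//]] _.
  rewrite addn0 vote_rel_even //.
  by split; [exact: gad_strict|exact: gad_unknown].
rewrite vote_rel_odd //; split; first exact: rev_rel_strict.
rewrite /unknown_pairs (_ : [set p | _] = set0) ?cards0 //.
apply/setP => -[a b]; rewrite !inE /=; apply/negbTE/negP => /andP [/andP [ab n1] n2].
have ab' : a != b by apply/eqP => E; rewrite E ltnn in ab.
have := rev_rel_total (@ikey_inj m (t0 (j %/ 2)) (top1 (j %/ 2)) (top2 (j %/ 2)) (top3 (j %/ 2))) ab'.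
by rewrite (negbTE n1) (negbTE n2).
Qed.

Lemma profile_gad P g : in_info_set profile P -> g < G ->
  extends (nth 1%g P (g * 2)) (fun a b : 'I_m => gad (t0 g) (top1 g) (top2 g) (top3 g) (wid g) (flp g) a b) /\
  extends (nth 1%g P (g * 2 + 1)) (rev_rel (fun a : 'I_m => key (t0 g) (top1 g) (top2 g) (top3 g) a)).
Proof.
move=> /in_profile [_ h] gG; split; first by rewrite -vote_rel_even //; apply: h; lia.
by rewrite -vote_rel_odd //; apply: h; lia.
Qed.

Lemma profile_score P a : in_info_set profile P ->
  borda_score P a + \sum_(g < G) (a == t0 g) * \sum_b gn P g b = G * m.-1 + \sum_(g < G) gn P g a.
Proof.
move=> HP; have [sP _] := (in_profile P).1 HP.
rewrite /borda_score (big_nth 1%g) sP big_mkord (sum_prod G 2 (fun j => m.-1 - nth 1%g P j a)) -big_split /=.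
have -> : G * m.-1 = \sum_(g < G) m.-1 by rewrite sum_nat_const card_ord.
rewrite -big_split /=; apply: eq_bigr => g _.
have [e1 e2] := profile_gad HP (ltn_ord g).
have [h1 h2 h3 h4 h5] := tops (ltn_ord g); rewrite -(t0E (ltn_ord g)) in h2.
rewrite (sum2 (fun k => m.-1 - nth 1%g P (g * 2 + k) a)) addn0.
have := gad_score h2 h3 h4 a e1 e2.
by rewrite (gad_loss h2 h3 h4 e1).
Qed.

Lemma sum_indicator (T x : nat) : T < m -> \sum_(a < m) (a == T :> nat) * x = x.
Proof.
move=> Tm; rewrite (bigD1 (Ordinal Tm)) //= eqxx mul1n big1 ?addn0 // => a.
by rewrite -val_eqE /= => /negbTE ->.
Qed.

(** It is [t0] that lies below, having let [T] pass. *)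
Definition below (P : seq {perm 'I_m}) g T : bool := nth 1%g P (g * 2) (inord T : 'I_m) < nth 1%g P (g * 2) (t0 g).
Definition gD P nd b := below P (nd * 2 + b) (top1 (nd * 2 + b)).
Definition gL P nd b := below P (nd * 2 + b) (top2 (nd * 2 + b)).
Definition gU P nd b := below P (nd * 2 + b) (top3 (nd * 2 + b)).
Definition pidx i k := N * 2 + (i * (K + K) + k).
Definition gH P i := \sum_(k < K) below P (pidx i k) (top1 (pidx i k)).

Definition lcand nd b := 2 * N + (if b == 1 then nd else prev nd).
Definition ucand nd b := if sat (nd %/ V) (nd %% V) (b == 1) then f else 3 * N + nd %/ V.

Lemma choice_node nd b : nd < N -> b < 2 ->
  [/\ nd * 2 + b < G, choice (nd * 2 + b), top0 (nd * 2 + b) = nd,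
      top1 (nd * 2 + b) = N + nd & top2 (nd * 2 + b) = lcand nd b /\ top3 (nd * 2 + b) = ucand nd b].
Proof.
move=> h1 h2; have c : choice (nd * 2 + b) by rewrite /choice; lia.
have d : (nd * 2 + b) %/ 2 = nd by rewrite divnMDl // divn_small // addn0.
have e : (nd * 2 + b) %% 2 = b by rewrite modnMDl modn_small.
by rewrite /top0 /top1 /top2 /top3 c d e; split=> //; rewrite /ngad; lia.
Qed.

Lemma pidx_spec i k : i < Y.+1 -> k < K + K ->
  [/\ pidx i k < G, choice (pidx i k) = false, pcand (pidx i k) = i & pcopy (pidx i k) = k].
Proof.
move=> h1 h2; have c : choice (pidx i k) = false by rewrite /choice /pidx; lia.
split=> //.
- by rewrite /pidx /ngad ltn_add2l; apply: (@leq_trans (i.+1 * (K + K))); rewrite ?leq_mul // mulSn; lia.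
- by rewrite /pcand /pidx addKn divnMDl ?divn_small ?addn0 //; lia.
- by rewrite /pcopy /pidx addKn modnMDl modn_small.
Qed.

Lemma lcand_bounds nd b : nd < N -> 2 * N <= lcand nd b < 3 * N.
Proof. by move=> h; have := prev_lt h; rewrite /lcand; case: ifP; lia. Qed.

Lemma ucand_bounds nd b : nd < N -> 3 * N <= ucand nd b < m.
Proof.
move=> h; have := node_clause h; rewrite /ucand /ncand /cand_f /cand_e.
by move: (nd %/ V) => c hc; case: ifP => _; apply/andP; split; lia.
Qed.

Lemma inord_eq (a : 'I_m) T : (a == T :> nat) -> inord T = a.
Proof. by move=> /eqP <-; rewrite inord_val. Qed.

Lemma choice_gain P nd b a : nd < N -> b < 2 ->
  gn P (nd * 2 + b) a = (a == N + nd :> nat) * gD P nd b + (a == lcand nd b :> nat) * gL P nd b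
    + (a == ucand nd b :> nat) * gU P nd b :> nat.
Proof.
move=> h1 h2; have [gG c e0 e1 [e2 e3]] := choice_node h1 h2.
have [l1 l2] := andP (lcand_bounds b h1); have [u1 u2] := andP (ucand_bounds b h1).
rewrite /gn /gain /wid c /key (t0E gG) e0 e1 e2 e3 /gD /gL /gU /below e1 e2 e3.
case: (eqVneq (a : nat) nd) => [ea|_]; first by do 3 (case: eqP => [?|_]; first lia).
case: (eqVneq (a : nat) (N + nd)) => [ea|_].
  rewrite (inord_eq (introT eqP ea)) mul1n.
  by do 2 (case: eqP => [?|_]; first lia); rewrite !mul0n !addn0.
case: (eqVneq (a : nat) (lcand nd b)) => [ea|_].
  rewrite (inord_eq (introT eqP ea)) mul1n.
  by (case: eqP => [?|_]; first lia); rewrite !mul0n !addn0.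
case: (eqVneq (a : nat) (ucand nd b)) => [ea|_]; last by [].
by rewrite (inord_eq (introT eqP ea)) mul1n.
Qed.

(** The three recipients are ordered among themselves in the vote, so [x] drops below them one after
    the other. *)
Lemma choice_mono P nd b : in_info_set profile P -> nd < N -> b < 2 ->
  (gU P nd b -> gL P nd b) /\ (gL P nd b -> gD P nd b).
Proof.
move=> HP h1 h2; have [gG c e0 e1 [e2 e3]] := choice_node h1 h2.
have [l1 l2] := andP (lcand_bounds b h1); have [u1 u2] := andP (ucand_bounds b h1).
have [E _] := profile_gad HP gG.
rewrite /gU /gL /gD /below e1 e2 e3.
have k1 : key nd (N + nd) (lcand nd b) (ucand nd b) (N + nd) = 1.
  by rewrite /key; case: eqP; [lia|rewrite eqxx].
have k2 : key nd (N + nd) (lcand nd b) (ucand nd b) (lcand nd b) = 2.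
  by rewrite /key; do 2 (case: eqP; first lia); rewrite eqxx.
have k3 : key nd (N + nd) (lcand nd b) (ucand nd b) (ucand nd b) = 3.
  by rewrite /key; do 3 (case: eqP; first lia); rewrite eqxx.
have A := E (inord (N + nd)) (inord (lcand nd b)).
have B := E (inord (lcand nd b)) (inord (ucand nd b)).
have i1 : (inord (N + nd) : 'I_m) = N + nd :> nat by rewrite inordK // /ncand /cand_e; lia.
have i2 : (inord (lcand nd b) : 'I_m) = lcand nd b :> nat by rewrite inordK // /ncand /cand_e; lia.
have i3 : (inord (ucand nd b) : 'I_m) = ucand nd b :> nat by rewrite inordK.
rewrite /gad i1 i2 i3 (t0E gG) e0 e1 e2 e3 k1 k2 k3 in A B.
have {}A := A _; have {}B := B _.
split=> h; [apply: (ltn_trans (B _)) h|apply: (ltn_trans (A _)) h].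
  by apply/orP; left; rewrite /= negb_and; apply/orP; left; apply/eqP; lia.
by apply/orP; left; rewrite /= negb_and; apply/orP; left; apply/eqP; lia.
Qed.

Lemma pair_gain P i k a : i < Y.+1 -> k < K + K ->
  gn P (pidx i k) a = (a == top1 (pidx i k) :> nat) *
    ((k < K + rho i) && below P (pidx i k) (top1 (pidx i k))) :> nat.
Proof.
move=> h1 h2; have [gG c ec ek] := pidx_spec h1 h2.
have [_ h _ _ _] := tops gG.
have [e2 e3] : top2 (pidx i k) = top1 (pidx i k) /\ top3 (pidx i k) = top1 (pidx i k).
  by rewrite /top2 /top3 c.
rewrite /gn /gain /wid c ec ek /key (t0E gG) e2 e3 /below.
case: (eqVneq (a : nat) (top1 (pidx i k))) => [ea|_].
  rewrite ea eq_sym (negbTE h) mul1n (inord_eq (introT eqP ea)); congr nat_of_bool.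
  by case: (k < K + rho i).
by case: eqP => //; case: (k < K + rho i).
Qed.

Lemma pair_top1 i k : i < Y.+1 -> k < K + K ->
  top1 (pidx i k) = if (k < K) && (i == Y) then z else i.
Proof. by move=> h1 h2; have [_ c ec ek] := pidx_spec h1 h2; rewrite /top1 /pboost c ec ek. Qed.

Lemma pair_top0 i k : i < Y.+1 -> k < K + K ->
  top0 (pidx i k) = if (k < K) && (i == Y) then Y else f.
Proof. by move=> h1 h2; have [_ c ec ek] := pidx_spec h1 h2; rewrite /top0 /pboost c ec ek. Qed.

(** A flipped gadget has no freedom: in every completion exactly [rho i] forced transfers reach
    [i]. *)
Lemma offset_below P i k : in_info_set profile P -> i < Y.+1 -> k < K ->
  (K + k < K + rho i) && below P (pidx i (K + k)) (top1 (pidx i (K + k))) = (k < rho i).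
Proof.
move=> HP h1 h2; rewrite ltn_add2l; case: ltnP => //= kr.
have kK : K + k < K + K by rewrite ltn_add2l.
have [gG c ec ek] := pidx_spec h1 kK.
have [E _] := profile_gad HP gG; have [_ h _ _ _] := tops gG.
rewrite -(t0E gG) in h.
have fl : flp (pidx i (K + k)) by rewrite /flp c ec ek leq_addr ltn_add2l.
apply: (gad_flip E fl).
by rewrite inordK // (pair_top1 h1 kK) [K + k < K]ltnNge leq_addr /= /ncand; lia.
Qed.

Lemma sum_lt_rho i : i < Y.+1 -> \sum_(k < K) (k < rho i) = rho i.
Proof. by move=> /rho_copies; apply: sum_ord_lt. Qed.

Lemma gad_sum (F : nat -> nat) : \sum_(g < G) F g =
  \sum_(nd < N) \sum_(b < 2) F (nd * 2 + b) + \sum_(i < Y.+1) (\sum_(k < K) F (pidx i k) + \sum_(k < K) F (pidx i (K + k))).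
Proof.
rewrite /ngad big_split_ord /= sum_prod; congr addn.
rewrite (sum_prod _ _ (fun g => F (N * 2 + g))); apply: eq_bigr => i _.
by rewrite big_split_ord.
Qed.

(** Balance of losses and gains over choices, free transfers and forced offsets, from which the
    scores of the various candidates are specialised. *)
Lemma score_eq P (a : 'I_m) : in_info_set profile P ->
  borda_score P a
  + (\sum_(nd < N) (a == nd :> nat) * \sum_(b < 2) (gD P nd b + gL P nd b + gU P nd b)
     + \sum_(i < Y.+1) ((a == (if i == Y :> nat then Y else f) :> nat) * gH P i + (a == f :> nat) * rho i))
  = G * m.-1 +
    (\sum_(nd < N) \sum_(b < 2) ((a == N + nd :> nat) * gD P nd b + (a == lcand nd b :> nat) * gL P nd b
        + (a == ucand nd b :> nat) * gU P nd b)
     + \sum_(i < Y.+1) ((a == (if i == Y :> nat then z else i) :> nat) * gH P i + (a == i :> nat) * rho i)).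
Proof.
move=> HP; rewrite -[RHS]addn0.
have := profile_score a HP.
rewrite (gad_sum (fun g => (a == t0 g) * \sum_b gn P g b)) (gad_sum (fun g => gn P g a)) => S.
have E1 : \sum_(nd < N) \sum_(b < 2) (a == t0 (nd * 2 + b)) * \sum_c gn P (nd * 2 + b) c =
    \sum_(nd < N) (a == nd :> nat) * \sum_(b < 2) (gD P nd b + gL P nd b + gU P nd b).
  apply: eq_bigr => nd _; rewrite big_distrr /=; apply: eq_bigr => b _.
  have [gG c e0 e1 [e2 e3]] := choice_node (ltn_ord nd) (ltn_ord b).
  rewrite -val_eqE /= (t0E gG) e0; congr muln.
  rewrite (eq_bigr _ (fun c _ => choice_gain P c (ltn_ord nd) (ltn_ord b))) !big_split /=.
  have := ltn_ord nd; have := lcand_bounds b (ltn_ord nd); have := ucand_bounds b (ltn_ord nd).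
  have hm : 3 * N < m by rewrite /ncand /cand_e; lia.
  by move=> *; rewrite !sum_indicator //; lia.
have E2 : \sum_(nd < N) \sum_(b < 2) gn P (nd * 2 + b) a =
  \sum_(nd < N) \sum_(b < 2) ((a == N + nd :> nat) * gD P nd b + (a == lcand nd b :> nat) * gL P nd b
        + (a == ucand nd b :> nat) * gU P nd b).
  by do 2 (apply: eq_bigr => ? _); rewrite choice_gain.
have sumgn i k : i < Y.+1 -> k < K + K -> \sum_b gn P (pidx i k) b =
    (k < K + rho i) && below P (pidx i k) (top1 (pidx i k)).
  move=> hi hk; rewrite (eq_bigr _ (fun c _ => pair_gain P c hi hk)) sum_indicator //.
  by rewrite (pair_top1 hi hk); case: ifP => _; rewrite /ncand /cand_z; lia.
have E3 (i : 'I_Y.+1) : \sum_(k < K) (a == t0 (pidx i k)) * (\sum_b gn P (pidx i k) b) +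
    \sum_(k < K) (a == t0 (pidx i (K + k))) * (\sum_b gn P (pidx i (K + k)) b) =
    (a == (if i == Y :> nat then Y else f) :> nat) * gH P i + (a == f :> nat) * rho i.
  congr addn.
    rewrite /gH big_distrr /=; apply: eq_bigr => k _.
    have hk : k < K + K by rewrite ltn_addr.
    have [gG _ _ _] := pidx_spec (ltn_ord i) hk.
    by rewrite sumgn // -val_eqE /= (t0E gG) pair_top0 // ltn_ord ltn_addr.
  rewrite -(sum_lt_rho (ltn_ord i)) big_distrr /=; apply: eq_bigr => k _.
  have hk : K + k < K + K by rewrite ltn_add2l.
  have [gG _ _ _] := pidx_spec (ltn_ord i) hk.
  by rewrite sumgn // -val_eqE /= (t0E gG) pair_top0 // ltnNge leq_addr /= offset_below.
have E4 (i : 'I_Y.+1) : \sum_(k < K) gn P (pidx i k) a + \sum_(k < K) gn P (pidx i (K + k)) a =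
    (a == (if i == Y :> nat then z else i) :> nat) * gH P i + (a == i :> nat) * rho i.
  congr addn.
    rewrite /gH big_distrr /=; apply: eq_bigr => k _.
    have hk : k < K + K by rewrite ltn_addr.
    by rewrite pair_gain // pair_top1 // ltn_ord ltn_addr.
  rewrite -(sum_lt_rho (ltn_ord i)) big_distrr /=; apply: eq_bigr => k _.
  have hk : K + k < K + K by rewrite ltn_add2l.
  by rewrite pair_gain // offset_below // pair_top1 // ltnNge leq_addr.
rewrite E1 E2 (eq_bigr _ (fun i _ => E3 i)) (eq_bigr _ (fun i _ => E4 i)) in S.
by rewrite addn0.
Qed.

(** * Completions with prescribed transfers *)

Section Realize.
Variables (act : nat -> nat -> bool) (hc : nat -> nat).

Definition fires g : bool :=
  if choice g then act (g %/ 2) (g %% 2)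
  else if pcopy g < K then pcopy g < hc (pcand g) else pcopy g < K + rho (pcand g).

Definition realizer : seq {perm 'I_m} := mkseq (fun j =>
  let g := j %/ 2 in
  if j %% 2 == 0 then
    if fires g then vote_of (@ikey_inj m (top1 g) (top2 g) (top3 g) (t0 g))
    else vote_of (@ikey_inj m (t0 g) (top1 g) (top2 g) (top3 g))
  else rev_vote (@ikey_inj m (t0 g) (top1 g) (top2 g) (top3 g))) (G * 2).

Lemma realizer_info : in_info_set profile realizer.
Proof.
apply/in_profile; split; first by rewrite size_mkseq.
move=> j jG; rewrite nth_mkseq //.
have gG : j %/ 2 < G by rewrite ltn_divLR.
have [h1 h2 h3 h4 h5] := tops gG; rewrite -(t0E gG) in h2.
rewrite [in X in extends _ X](divn_eq j 2); have : j %% 2 < 2 by rewrite ltn_mod.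
case: (j %% 2) => [|[|//]] _ /=; last by rewrite vote_rel_odd //; apply: rev_vote_extends.
rewrite addn0 vote_rel_even //; apply: gad_vote => //.
- by rewrite /flp /fires; case: ifP => // _ /andP [h ->]; rewrite ltnNge h.
- rewrite /fires /wid; case: ifP => // _; case: (ltnP (pcopy _) K) => [h _|_ ->] //.
  by rewrite ltn_addr.
Qed.

Lemma realizer_below g T : g < G -> T < m -> T \in [:: top1 g; top2 g; top3 g] ->
  T != top0 g -> top0 g \notin [:: top1 g; top2 g; top3 g] ->
  below realizer g T = fires g.
Proof.
move=> gG Tm; rewrite !inE => hT nT0; rewrite !negb_or => /and3P [n1 n2 n3].
rewrite /below nth_mkseq; last by lia.
cbv beta zeta; rewrite mulnK // modnMl eqxx; case: (fires g); rewrite vote_of_lt !(t0E gG) (inordK Tm).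
  rewrite /key (negbTE n1) (negbTE n2) (negbTE n3) eqxx.
  by case/or3P: hT => -> //; [case: ifP|case: ifP => // _; case: ifP].
by rewrite {2}/key eqxx ltn0.
Qed.

Lemma realizer_choice nd b : nd < N -> b < 2 ->
  [/\ gD realizer nd b = act nd b, gL realizer nd b = act nd b & gU realizer nd b = act nd b].
Proof.
move=> h1 h2; have [gG c e0 e1 [e2 e3]] := choice_node h1 h2.
have [l1 l2] := andP (lcand_bounds b h1); have [u1 u2] := andP (ucand_bounds b h1).
have hm : 3 * N < m by rewrite /ncand /cand_e; lia.
have <- : fires (nd * 2 + b) = act nd b.
  by rewrite /fires c divnMDl // modnMDl divn_small // modn_small // addn0.
have n0 : top0 (nd * 2 + b) \notin [:: top1 (nd * 2 + b); top2 (nd * 2 + b); top3 (nd * 2 + b)].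
  by rewrite !inE e0 e1 e2 e3 !negb_or; apply/and3P; split; apply/eqP; lia.
split; apply: realizer_below => //; rewrite ?inE ?eqxx ?orbT // ?e0 ?e1 ?e2 ?e3 //; try lia.
Qed.

Lemma realizer_H i : i < Y.+1 -> hc i <= K -> gH realizer i = hc i.
Proof.
move=> hi hK; rewrite -[RHS](sum_ord_lt hK); apply: eq_bigr => k _.
have kK : k < K + K by rewrite ltn_addr.
have [gG c ec ek] := pidx_spec hi kK; have [h0 h1 _ _ _] := tops gG.
have e2 : top2 (pidx i k) = top1 (pidx i k) by rewrite /top2 c.
have e3 : top3 (pidx i k) = top1 (pidx i k) by rewrite /top3 c.
rewrite realizer_below ?e2 ?e3 ?inE ?eqxx //.
- by rewrite /fires c ec ek ltn_ord.
- by rewrite (pair_top1 hi kK); case: ifP => _; rewrite /ncand /cand_z; lia.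
- by rewrite eq_sym.
- by rewrite !orbb.
Qed.

End Realize.

Lemma sum_at n a (F : nat -> nat) : a < n -> \sum_(i < n) (a == i :> nat) * F i = F a.
Proof.
move=> an; rewrite (bigD1 (Ordinal an)) //= eqxx mul1n big1 ?addn0 // => i.
by rewrite -val_eqE /= eq_sym => /negbTE ->.
Qed.

Definition next_node nd := if nd + V < N then nd + V else nd + V - N.

Lemma V_le_nodes : 0 < N -> V <= N.
Proof. by rewrite /nodes muln_gt0 => /andP [h _]; rewrite leq_pmull. Qed.

(** Inverting [prev] reduces the gains of an [l] to two single terms. *)
Lemma prev_next nd nd' : nd < N -> nd' < N -> (nd == prev nd') = (next_node nd == nd').
Proof.
move=> h1 h2; have h3 : V <= N by apply: V_le_nodes; lia.
rewrite /prev /next_node; case: (ltnP nd' V) => ?; case: ltnP => ?; apply/eqP/eqP; lia.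
Qed.

Lemma next_node_lt nd : nd < N -> next_node nd < N.
Proof.
move=> h1; have h3 : V <= N by apply: V_le_nodes; lia.
by rewrite /next_node; case: (ltnP (nd + V) N) => ?; lia.
Qed.

(** * Scores of the individual candidates *)

Section Scores.
Variables (P : seq {perm 'I_m}).
Hypothesis HP : in_info_set profile P.
Local Notation S := (borda_score P).
Local Notation B := (G * m.-1).

Definition cgain (a : nat) := \sum_(nd < N) \sum_(b < 2) ((a == N + nd :> nat) * gD P nd b
   + (a == lcand nd b :> nat) * gL P nd b + (a == ucand nd b :> nat) * gU P nd b).

Lemma score_y (a : 'I_m) : a < Y ->
  S a + \sum_(nd < N) (a == nd :> nat) * \sum_(b < 2) (gD P nd b + gL P nd b + gU P nd b)
  = B + cgain a + gH P a + rho a.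
Proof.
move=> aY; have := score_eq a HP; rewrite -/(cgain a).
have n1 : (a == Y :> nat) = false by apply/eqP; lia.
have n2 : (a == f :> nat) = false by apply/eqP; rewrite /cand_f; lia.
rewrite [X in _ + (_ + X) = _]big1 => [|i _]; last first.
  by case: ifP => _; rewrite ?n1 ?n2.
rewrite addn0 => ->; rewrite -!addnA; congr (_ + (_ + _)).
rewrite -(@sum_at Y.+1 a (gH P)) 1?ltnW // -(@sum_at Y.+1 a rho) 1?ltnW // -big_split /=.
apply: eq_bigr => i _; congr (_ * _ + _); congr nat_of_bool.
by case: (nat_of_ord i =P Y) => [->|//]; rewrite n1; apply/eqP; rewrite /cand_z; lia.
Qed.

Lemma score_x nd (a : 'I_m) : nd < N -> a = nd :> nat ->
  S a + \sum_(b < 2) (gD P nd b + gL P nd b + gU P nd b) = B + gH P a + rho a.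
Proof.
move=> h1 ea; have aY : a < Y by rewrite /cand_e; lia.
have := score_y aY; rewrite ea (@sum_at N nd (fun nd => \sum_(b < 2) (gD P nd b + gL P nd b + gU P nd b))) //.
rewrite (_ : cgain nd = 0) ?addn0 //.
rewrite /cgain big1 // => nd' _; rewrite big1 // => b _.
have := lcand_bounds b (ltn_ord nd'); have := ucand_bounds b (ltn_ord nd').
by move=> ? ?; do 3 (case: eqP => [?|_]; first lia).
Qed.

Lemma score_mid (a : 'I_m) : N <= a < Y -> S a = B + cgain a + gH P a + rho a.
Proof.
move=> /andP [h1 aY]; rewrite -(score_y aY) big1 ?addn0 // => nd _.
by case: eqP => // E; have := ltn_ord nd; rewrite -E ltnNge h1.
Qed.

Lemma cgain_d nd : nd < N -> cgain (N + nd) = \sum_(b < 2) gD P nd b.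
Proof.
move=> h; rewrite -(@sum_at N nd (fun nd => \sum_(b < 2) gD P nd b)) //.
apply: eq_bigr => nd' _; rewrite big_distrr /=; apply: eq_bigr => b _.
have := lcand_bounds b (ltn_ord nd'); have := ucand_bounds b (ltn_ord nd').
move=> ? ?; rewrite eqn_add2l; do 2 (case: (N + nd =P _) => [?|_]; first lia).
by rewrite !mul0n !addn0.
Qed.

Lemma cgain_l nd : nd < N -> cgain (2 * N + nd) = gL P nd 1 + gL P (next_node nd) 0.
Proof.
move=> h; rewrite -(@sum_at N nd (fun nd => gL P nd 1 : nat)) //.
rewrite -(@sum_at N (next_node nd) (fun nd => gL P nd 0 : nat)) ?next_node_lt // -big_split /=.
apply: eq_bigr => nd' _; rewrite (sum2 (fun b => (2 * N + nd == N + nd' :> nat) * gD P nd' b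
   + (2 * N + nd == lcand nd' b :> nat) * gL P nd' b + (2 * N + nd == ucand nd' b :> nat) * gU P nd' b)).
have := ucand_bounds 0 (ltn_ord nd'); have := ucand_bounds 1 (ltn_ord nd'); have := ltn_ord nd'.
move=> ? ? ?; rewrite /lcand /= !eqn_add2l prev_next //.
do 3 (case: (2 * N + nd =P _) => [?|_]; first lia).
by rewrite !mul0n !addn0 !add0n addnC.
Qed.

Lemma cgain_u c : c < C -> cgain (3 * N + c) =
  \sum_(v < V) \sum_(b < 2) ~~ sat c v (b == 1 :> nat) * gU P (c * V + v) b.
Proof.
move=> hc; rewrite /cgain.
rewrite -(@sum_at C c (fun c => \sum_(v < V) \sum_(b < 2) ~~ sat c v (b == 1 :> nat) * gU P (c * V + v) b)) //.
rewrite (sum_prod C V (fun nd => \sum_(b < 2) ((3 * N + c == N + nd :> nat) * gD P nd b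
   + (3 * N + c == lcand nd b :> nat) * gL P nd b + (3 * N + c == ucand nd b :> nat) * gU P nd b))).
apply: eq_bigr => c' _; rewrite big_distrr /=; apply: eq_bigr => v _.
rewrite big_distrr /=; apply: eq_bigr => b _.
have ndN : c' * V + v < N.
  by rewrite /nodes; apply: (@leq_trans (c'.+1 * V)); rewrite ?leq_mul // mulSn addnC ltn_add2r.
have := lcand_bounds b ndN => ?.
do 2 (case: (3 * N + c =P _) => [?|_]; first lia).
rewrite !mul0n !add0n /ucand.
have V0 : 0 < V by apply: leq_ltn_trans (ltn_ord v).
rewrite divnMDl // modnMDl divn_small // modn_small // addn0.
case: (sat c' v _); last by rewrite eqn_add2l mul1n.
by case: (3 * N + c =P f) => [|_]; [rewrite /cand_f /cand_e; lia|rewrite mul0n muln0].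
Qed.

Lemma cgain_c0 : cgain (3 * N + C) = 0.
Proof.
rewrite /cgain big1 // => nd _; rewrite big1 // => b _.
have := lcand_bounds b (ltn_ord nd); have := node_clause (ltn_ord nd); have := ltn_ord nd => ? h ?.
rewrite /ucand; do 2 (case: (3 * N + C =P _) => [?|_]; first lia).
case: ifP => _; case: eqP => //; rewrite /cand_f /cand_e; move: h; move: (nd %/ V) => c; lia.
Qed.

Lemma score_e (a : 'I_m) : a = Y :> nat -> S a + gH P Y = B + rho Y.
Proof.
move=> ea; have := score_eq a HP; rewrite ea -/(cgain Y).
have YN : 3 * N + C < Y by [].
rewrite [X in _ + (X + _) = _]big1 => [|nd _]; last first.
  by case: eqP => // E; have := ltn_ord nd; lia.
rewrite add0n (_ : cgain Y = 0); last first.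
  rewrite /cgain big1 // => nd _; rewrite big1 // => b _.
  have := lcand_bounds b (ltn_ord nd); have := node_clause (ltn_ord nd); have := ltn_ord nd => ? h ?.
  rewrite /ucand; do 2 (case: (Y =P _) => [?|_]; first lia).
  case: ifP => _; case: eqP => //; rewrite /cand_f; first by lia.
  by move: h; move: (nd %/ V) => c; lia.
have n2 : (Y == f :> nat) = false by apply/eqP; rewrite /cand_f; lia.
have n3 : (Y == z :> nat) = false by apply/eqP; rewrite /cand_z; lia.
rewrite !add0n -[in gH P Y](@sum_at Y.+1 Y (gH P)) // -[rho Y](@sum_at Y.+1 Y rho) //.
congr (_ + _ = _ + _); apply: eq_bigr => i _.
  rewrite n2 mul0n addn0; congr (nat_of_bool _ * _).
  by case: (nat_of_ord i =P Y) => [->|h]; rewrite ?n2 //; apply/esym/eqP; lia.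
rewrite (_ : (Y == (if i == Y :> nat then z else i) :> nat) = false) //.
by case: (nat_of_ord i =P Y) => [_|h] //; apply/eqP; lia.
Qed.

Lemma cgain_top a : Y < a -> cgain a <= (a == f) * (N * 2).
Proof.
move=> aY; apply: (@leq_trans (\sum_(nd < N) \sum_(b < 2) (a == f))); last first.
  by rewrite !sum_nat_const !card_ord; lia.
apply: leq_sum => nd _; apply: leq_sum => b _.
have := lcand_bounds b (ltn_ord nd); have := node_clause (ltn_ord nd); have := ltn_ord nd => ? h ?.
have YN : 3 * N + C < Y by [].
do 2 (case: (a =P _) => [?|_]; first lia).
rewrite /ucand !mul0n !add0n; case: ifP => _; first by case: gU; rewrite ?muln1 ?muln0.
by case: eqP => // E; move: E h; move: (nd %/ V) => c; lia.
Qed.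

Lemma score_z (a : 'I_m) : a = z :> nat -> S a = B + gH P Y.
Proof.
move=> ea; have := score_eq a HP; rewrite ea -/(cgain z).
have zY : Y < z by rewrite /cand_z; lia.
have zf : (z == f :> nat) = false by apply/eqP; rewrite /cand_z /cand_f; lia.
have := cgain_top zY; rewrite zf mul0n leqn0 => /eqP ->.
rewrite [X in _ + (X + _) = _]big1 => [|nd _]; last first.
  by case: eqP => // E; have := ltn_ord nd; rewrite -E /cand_z /cand_e; lia.
rewrite [X in _ + (_ + X) = _]big1 => [|i _]; last first.
  have zY' : (z == Y :> nat) = false by apply/eqP; lia.
  by case: ifP => _; rewrite ?zY' ?zf.
rewrite !addn0 add0n => ->; congr (_ + _).
rewrite -[RHS](@sum_at Y.+1 Y (gH P)) //; apply: eq_bigr => i _.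
rewrite [Y == i]eq_sym.
have -> : (z == i :> nat) = false by apply/eqP; have := ltn_ord i; lia.
rewrite mul0n addn0; case: (nat_of_ord i =P Y) => [->|h]; first by rewrite eqxx.
by have -> : (z == i :> nat) = false by apply/eqP; have := ltn_ord i; lia.
Qed.

Lemma sum_rho : Y.+1 <= \sum_(i < Y.+1) rho i.
Proof.
rewrite -[X in X <= _](card_ord Y.+1) -sum1_card; apply: leq_sum => i _.
by rewrite /rho; do 4 (case: ifP => _; first lia); lia.
Qed.

(** [f] pays at least one forced point for each candidate up to [e] and receives at most one from
    each of the [N * 2] choice gadgets. *)
Lemma score_f (a : 'I_m) : a = f :> nat -> S a + Y.+1 <= B + N * 2.
Proof.
move=> ea; have := score_eq a HP; rewrite ea -/(cgain f).
have fY : Y < f by [].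
have fz : (f == z :> nat) = false by apply/eqP; rewrite /cand_z /cand_f; lia.
have cg : cgain f <= N * 2 by have := cgain_top fY; rewrite eqxx mul1n.
rewrite [X in _ = _ + (_ + X)]big1 => [|i _]; last first.
  have fi : (f == i :> nat) = false by apply/eqP; have := ltn_ord i; lia.
  by case: ifP => _; rewrite fi ?fz.
rewrite [X in _ + (_ + X) = _]big_split /=.
have -> : \sum_(i < Y.+1) (f == f) * rho i = \sum_(i < Y.+1) rho i.
  by apply: eq_bigr => i _; rewrite eqxx mul1n.
have := sum_rho; lia.
Qed.

End Scores.

Definition formula_sat := exists al : nat -> bool,
  forall c, c < C -> exists2 v, v < V & sat c v (al v).

Lemma tot_cons (U : {perm 'I_m}) P a : borda_score (U :: P) a = (m.-1 - U a) + borda_score P a.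
Proof. by rewrite /borda_score big_cons. Qed.

Definition e_ord : 'I_m := inord Y.
Definition f_ord : 'I_m := inord f.
Definition c_ord : 'I_m := inord (3 * N + C).
Definition z_ord : 'I_m := inord z.

Lemma eE : e_ord = Y :> nat. Proof. by rewrite inordK // /ncand; lia. Qed.
Lemma fE : f_ord = f :> nat. Proof. by rewrite inordK // /ncand /cand_f; lia. Qed.
Lemma zE : z_ord = z :> nat. Proof. by rewrite inordK // /ncand /cand_z; lia. Qed.
Lemma cE : c_ord = 3 * N + C :> nat. Proof. by rewrite inordK // /ncand /cand_e; lia. Qed.

Lemma rhoE : [/\ forall i, i < N -> rho i = V + 5 + i,
  forall i, N <= i < 3 * N -> rho i = V + 1 + i,
  forall i, 3 * N <= i < 3 * N + C -> rho i = 3 + i,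
  rho (3 * N + C) = V + 2 + (3 * N + C) & rho Y = V + 3 + Y].
Proof.
rewrite /rho; split=> [i h|i h|i h||].
- by rewrite h.
- by case: ifP; [lia|case: ifP => //; lia].
- by do 2 (case: ifP; first lia); case: ifP => //; lia.
- by do 3 (case: ifP; first lia); rewrite eqxx.
- by do 4 (case: ifP; rewrite ?/cand_e; first lia).
Qed.

Lemma score_c P : in_info_set profile P ->
  borda_score P c_ord = G * m.-1 + gH P (3 * N + C) + (V + 2 + (3 * N + C)).
Proof.
move=> HP; rewrite (score_mid HP) cE ?cgain_c0 ?addn0; last by rewrite /cand_e; lia.
by have [_ _ _ -> _] := rhoE.
Qed.

(* At every node the loss of x forces exactly one of the two choice gadgets to fire, and the l's
   force the choice at clause c to be repeated at clause c + 1 (cyclically), so that it depends on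
   the variable only; u_c then says that some variable satisfies clause c. *)
Lemma e_wins_sat P : in_info_set profile P -> borda_winner (1%g :: P) e_ord ->
  gH P Y = 0 /\ formula_sat.
Proof.
move=> HP [W1 W2].
(* A candidate before [e] would win a tie, so the inequality is strict. *)
have lt_e (a : 'I_m) : a < Y -> m.-1 - a + borda_score P a + gH P Y < G * m.-1 + m.-1 + V + 3.
  move=> aY; have := W1 a; have := W2 a; rewrite !tot_cons !perm1 eE.
  have := score_e HP eE; have [_ _ _ _ ->] := rhoE => E h1 h2.
  have : m.-1 - a + borda_score P a <> m.-1 - Y + borda_score P e_ord by move/h1; lia.
  by move: E h2; rewrite /ncand; lia.
(* [e] leads [c0] by at most one point, so it has none to give to [z]. *)
have hY : gH P Y = 0.
  by have := lt_e c_ord; rewrite (score_c HP) cE /ncand /cand_e => /(_ _); lia.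
split=> //; rewrite hY in lt_e.
have [rx rd ru _ _] := rhoE.
pose D := gD P; pose L := gL P; pose U := gU P.
have xloss nd : nd < N -> 3 <= (D nd 0 + L nd 0 + U nd 0) + (D nd 1 + L nd 1 + U nd 1).
  move=> h; have hm : nd < m by rewrite /ncand /cand_e; lia.
  have E : (Ordinal hm : nat) = nd by [].
  have := lt_e (Ordinal hm); have := score_x HP h E; rewrite E rx //.
  rewrite (sum2 (fun b => gD P nd b + gL P nd b + gU P nd b)) -/D -/L -/U /ncand /cand_e.
  by move=> e1 /(_ _); lia.
have dgain nd : nd < N -> D nd 0 + D nd 1 <= 1.
  move=> h; have hm : N + nd < m by rewrite /ncand /cand_e; lia.
  have E : (Ordinal hm : nat) = N + nd by [].
  have := lt_e (Ordinal hm); rewrite (score_mid HP) E ?cgain_d // ?rd; try (rewrite /cand_e; lia).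
  rewrite (sum2 (fun b => gD P nd b : nat)) -/D /ncand /cand_e => /(_ _); lia.
have lgain nd : nd < N -> L nd 1 + L (next_node nd) 0 <= 1.
  move=> h; have hm : 2 * N + nd < m by rewrite /ncand /cand_e; lia.
  have E : (Ordinal hm : nat) = 2 * N + nd by [].
  have := lt_e (Ordinal hm); rewrite (score_mid HP) E ?cgain_l // ?rd; try (rewrite /cand_e; lia).
  by rewrite -/L /ncand /cand_e => /(_ _); lia.
have ugain c : c < C -> \sum_(v < V) \sum_(b < 2) ~~ sat c v (b == 1 :> nat) * U (c * V + v) b < V.
  move=> h; have hm : 3 * N + c < m by rewrite /ncand /cand_e; lia.
  have E : (Ordinal hm : nat) = 3 * N + c by [].
  have := lt_e (Ordinal hm); rewrite (score_mid HP) E ?cgain_u // ?ru; try (rewrite /cand_e; lia).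
  by rewrite -/U /ncand /cand_e => /(_ _); lia.
(* A loss of at least 3 with at most one gain of [d]: by monotonicity one gadget fires completely
   and the other not at all. *)
have node nd : nd < N -> [/\ L nd 1 = U nd 1, L nd 0 = ~~ U nd 1 & U nd 0 = ~~ U nd 1].
  move=> h; have := xloss _ h; have := dgain _ h.
  have [] := choice_mono HP h (isT : 0 < 2); have [] := choice_mono HP h (isT : 1 < 2).
  rewrite -/D -/L -/U.
  by case: (D nd 0); case: (L nd 0); case: (U nd 0); case: (D nd 1); case: (L nd 1); case: (U nd 1) => //=;
    do ! (move=> /(_ isT) // || move=> _).
have step nd : nd < N -> U nd 1 -> U (next_node nd) 1.
  move=> h u; have := lgain _ h; have [-> _ _] := node _ h; have [_ -> _] := node _ (next_node_lt h).
  by rewrite u; case: (U (next_node nd) 1).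
have in_N c v : c < C -> v < V -> c * V + v < N.
  by move=> hc hv; rewrite /nodes; apply: (@leq_trans (c.+1 * V)); rewrite ?leq_mul // mulSn addnC ltn_add2r.
have up c v : c < C -> v < V -> U v 1 -> U (c * V + v) 1.
  elim: c => [//|c IH] hc hv u; have := IH (ltnW hc) hv u.
  move/(step _ (in_N _ _ (ltnW hc) hv)); rewrite /next_node.
  have := in_N _ _ hc hv; rewrite mulSn => h.
  rewrite (_ : c * V + v + V = V + c * V + v); last by lia.
  by rewrite h.
(* The chain closes after the last clause, so the implications also lead back to clause 0 and all
   copies of a variable agree. *)
have around v : v < V -> 0 < C -> U (C.-1 * V + v) 1 -> U v 1.
  move=> hv C0; have hC : C.-1 < C by lia.
  move/(step _ (in_N _ _ hC hv)); rewrite /next_node.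
  have NE : N = C.-1 * V + V by rewrite /nodes -{1}(prednK C0) mulSn addnC.
  rewrite NE (_ : C.-1 * V + v + V = C.-1 * V + V + v); last by lia.
  by rewrite ltnNge leq_addr /= addKn.
have rest c v : c < C -> v < V -> U (c * V + v) 1 -> U v 1.
  move=> hc hv u; apply: around => //; first by lia.
  have [k Ek] : exists k, C.-1 = c + k by exists (C.-1 - c); lia.
  rewrite Ek.
  have : c + k < C -> U ((c + k) * V + v) 1.
    elim: k {Ek} => [|k IH]; rewrite ?addn0 // addnS => hk.
    have := IH (ltnW hk); move/(step _ (in_N _ _ (ltnW hk) hv)); rewrite /next_node.
    have := in_N _ _ hk hv; rewrite mulSn => h.
    rewrite (_ : (c + k) * V + v + V = V + (c + k) * V + v); last by lia.
    by rewrite h.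
  by apply; lia.
exists (fun v => U v 1) => c hc.
have := ugain c hc.
case: (boolP [exists v : 'I_V, sat c v (U v 1)]) => [/existsP [v hv] _|].
  by exists v.
(* If no variable satisfied clause [c], each of the [V] variables would give a point to its [u],
   which can afford fewer than [V]. *)
rewrite negb_exists => /forallP no; rewrite ltnNge => /negP []; rewrite -[X in X <= _](card_ord V) -sum1_card.
apply: leq_sum => v _; rewrite (sum2 (fun b => ~~ sat c v (b == 1) * U (c * V + v) b)) /=.
have h := in_N _ _ hc (ltn_ord v); have [_ _ ->] := node _ h.
have := no v; have := up c v hc (ltn_ord v); have := rest c v hc (ltn_ord v).
case: (U (c * V + v) 1); first by move=> /(_ isT) -> _ -> ; rewrite addn1.
by case: (U v 1) => [_ /(_ isT)|_ _ ->].
Qed.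

End Reduction.

(** Maximising [F] compares scores first and breaks ties by the smaller index. *)
Lemma borda_winner_ex m (P : seq {perm 'I_m}) (a0 : 'I_m) : exists w, borda_winner P w.
Proof.
pose F (a : 'I_m) := borda_score P a * m + (m.-1 - a).
case: (@arg_maxnP _ a0 predT F isT) => w _ H; exists w.
have H' d : borda_score P d * m + (m.-1 - d) <= borda_score P w * m + (m.-1 - w) by apply: H.
split=> d; have := H' d; have := ltn_ord d; have := ltn_ord w; last by move=> ? ? + E; rewrite E; lia.
case: (leqP (borda_score P d) (borda_score P w)) => // h.
have : (borda_score P w).+1 * m <= borda_score P d * m by rewrite leq_mul.
by rewrite mulSn; lia.
Qed.

(** * The vote exchanging [e] and [f], and the exclusion of all others *)

Section Domination.
Variables (C V : nat) (sat : nat -> nat -> bool -> bool).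
Local Notation N := (nodes C V).
Local Notation Y := (cand_e C V).
Local Notation f := (cand_f C V).
Local Notation z := (cand_z C V).
Local Notation m := (ncand C V).
Local Notation K := (copies C V).
Local Notation G := (ngad C V).
Local Notation B := (G * m.-1).
Local Notation Po := (profile C V sat).
Local Notation c0 := (c_ord C V).
Local Notation eo := (e_ord C V).
Local Notation fo := (f_ord C V).
Local Notation zo := (z_ord C V).

Definition true_vote : {perm 'I_m} := 1%g.
Definition swap_vote : {perm 'I_m} := tperm eo fo.

Lemma mE : m = Y + 3. Proof. by rewrite /ncand addn3. Qed.
Lemma zYE : z = Y + 2. Proof. by rewrite /cand_z addn2. Qed.
Lemma fYE : f = Y + 1. Proof. by rewrite /cand_f addn1. Qed.
Lemma YE : Y = 3 * N + C + 1. Proof. by rewrite /cand_e addn1. Qed.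

Lemma cand_cases (a : 'I_m) : [\/ a < Y, a = eo, a = fo | a = zo].
Proof.
have := ltn_ord a; have h1 := eE C V; have h2 := fE C V; have h3 := zE C V.
have mE := mE; have fY := fYE; have zY := zYE.
case: (ltngtP a Y) => h am; first by constructor 1; lia.
  case: (ltngtP a f) => h'; first by lia.
    by constructor 4; apply: val_inj => /=; rewrite h3; lia.
  by constructor 3; apply: val_inj => /=; rewrite h2.
by constructor 2; apply: val_inj => /=; rewrite h1.
Qed.

Lemma swap_lt (a : 'I_m) : a < Y -> swap_vote a = a.
Proof.
by move=> h; rewrite tpermD // -val_eqE /= ?eE ?fE ?fYE neq_ltn; lia.
Qed.

Lemma swap_z : swap_vote zo = zo.
Proof. by rewrite tpermD // -val_eqE /= ?eE ?fE ?zE ?fYE ?zYE; lia. Qed.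

Lemma swap_e : swap_vote eo = fo. Proof. exact: tpermL. Qed.
Lemma swap_f : swap_vote fo = eo. Proof. exact: tpermR. Qed.

(** The deficit of [f] against [c0] exceeds the whole range of points of one vote. *)
Lemma f_loses (U : {perm 'I_m}) P : in_info_set Po P ->
  borda_score (U :: P) fo < borda_score (U :: P) c0.
Proof.
move=> HP; rewrite !tot_cons; have := score_f HP (fE C V); have := score_c HP.
have := mE; have := YE; lia.
Qed.

Lemma winner_not_f (U : {perm 'I_m}) P w : in_info_set Po P -> borda_winner (U :: P) w -> w != fo.
Proof.
move=> HP [W _]; apply/eqP => E; have := f_loses U HP; have := W c0; rewrite E; lia.
Qed.

Lemma swap_scores P :
  [/\ forall a : 'I_m, a < Y -> borda_score (swap_vote :: P) a = borda_score (true_vote :: P) a,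
      (borda_score (swap_vote :: P) eo).+1 = borda_score (true_vote :: P) eo &
      borda_score (swap_vote :: P) zo = borda_score (true_vote :: P) zo].
Proof.
have mE := mE; have fY := fYE.
split=> [a h||]; rewrite !tot_cons perm1.
- by rewrite swap_lt.
- by rewrite swap_e eE fE; lia.
- by rewrite swap_z.
Qed.

(** If [e] wins, nothing was transferred to [z], which is then too weak to inherit the victory. *)
Lemma winner_e_z P : in_info_set Po P -> borda_winner (true_vote :: P) eo ->
  borda_score (swap_vote :: P) zo < borda_score (swap_vote :: P) c0.
Proof.
move=> HP W; have [h _] := e_wins_sat HP W.
have [_ _ ->] := swap_scores P; rewrite !tot_cons perm1 (score_z HP (zE C V)) h.
have := score_c HP; have := mE; have := YE; have := zYE; have := zE C V; lia.
Qed.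

(** The swap moves one point from [e] to [f], which never wins. If [e] loses its victory, the only
    worse heir would be [z], excluded by [winner_e_z]. *)
Lemma swap_weak P : in_info_set Po P -> weakly_better true_vote swap_vote true_vote P.
Proof.
move=> HP w1 w2 W1 W2; rewrite !perm1.
have n1 := winner_not_f HP W1; have n2 := winner_not_f HP W2.
have [s1 s2 s3] := swap_scores P.
have Y1 := eE C V; have m1 := mE; have z1 := zE C V; have zY := zYE.
case: (cand_cases w2) => h2; last 1 first.
- by rewrite h2 z1; have := ltn_ord w1; lia.
- case: (cand_cases w1) => h1.
  + by have := W1.1 w2; have := W2.1 w1; have := W1.2 w2; rewrite !s1 //; lia.
  + have := W1.1 w2; have := W2.1 w1; rewrite h1 s1 //; lia.
  + by rewrite h1 eqxx in n1.
  + have := W1.1 w2; have := W2.1 w1; have := W1.2 w2; rewrite h1 s1 // s3; lia.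
- case: (cand_cases w1) => h1; rewrite h2; first by rewrite Y1 ltnW.
  + by rewrite h1.
  + by rewrite h1 eqxx in n1.
  + by have := W1.1 c0; rewrite h2 in W2; have := winner_e_z HP W2; rewrite h1; lia.
- by rewrite h2 eqxx in n2.
Qed.

(** A winner other than [e] keeps its score while only the hopeless [f] improves, so it remains the
    winner. *)
Lemma swap_strict_e P w1 w2 : in_info_set Po P -> borda_winner (swap_vote :: P) w1 ->
  borda_winner (true_vote :: P) w2 -> w1 < w2 -> w2 = eo.
Proof.
move=> HP W1 W2 lt12; have n1 := winner_not_f HP W1; have n2 := winner_not_f HP W2.
have [s1 s2 s3] := swap_scores P.
have Y1 := eE C V; have m1 := mE; have z1 := zE C V; have zY := zYE.
case: (cand_cases w2) => h2 //; last 1 first.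
- case: (cand_cases w1) => h1.
  + have := W1.1 w2; have := W2.1 w1; have := W2.2 w1; rewrite h2 s3 (s1 _ h1); lia.
  + have := W1.1 w2; have := W2.1 w1; rewrite h1 h2 s3; lia.
  + by rewrite h1 eqxx in n1.
  + by rewrite h1 h2 ltnn in lt12.
- have h1 : w1 < Y by lia.
  have := W1.1 w2; have := W2.1 w1; have := W2.2 w1; rewrite !s1 //; lia.
- by rewrite h2 eqxx in n2.
Qed.

Lemma next_node_mod nd : nd < N -> next_node C V nd %% V = nd %% V.
Proof.
move=> h; rewrite /next_node; case: ltnP => h'; first by rewrite modnDr.
have : 0 < C by move: h; rewrite /nodes; case: (C).
case E: C h h' => [//|C'] h h' _; rewrite /nodes mulSn in h h' *.
have -> : nd + V - (V + C' * V) = nd - C' * V by lia.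
have h2 : C' * V <= nd by lia.
by rewrite -[in RHS](subnK h2) addnC modnMDl.
Qed.

Lemma sat_e_wins : formula_sat C V sat -> exists P, [/\ in_info_set Po P,
  borda_score P eo = B + (V + 3 + Y), borda_score P zo = B &
  forall a : 'I_m, a < Y -> borda_score P a <= B + (V + 2 + a)].
Proof.
(* At every node the gadget matching the value of the variable fires, and no free transfer is
   used. *)
move=> [al Hal]; pose act nd b := (b == 1) == al (nd %% V).
pose P := realizer C V sat act (fun _ => 0).
have HP : in_info_set Po P by apply: realizer_info.
have H0 i : i < Y.+1 -> gH P i = 0 by move=> h; rewrite realizer_H.
have Hc nd b h1 h2 := @realizer_choice C V sat act (fun _ => 0) nd b h1 h2.
have [rx rd ru rc re] := rhoE C V.
have YN := YE.
exists P; split=> //.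
- by have := score_e HP (eE C V); rewrite H0 // addn0 re.
- by rewrite (score_z HP (zE C V)) H0 // addn0.
move=> a aY; have Ha := H0 a (ltnW aY).
case: (ltnP a N) => aN.
  have := score_x HP aN erefl; rewrite Ha rx //.
  rewrite (sum2 (fun b => gD P a b + gL P a b + gU sat P a b)).
  have [//|//|-> -> ->] := Hc a 0; have [//|//|-> -> ->] := Hc a 1.
  by rewrite /act; case: (al _) => /=; lia.
rewrite (score_mid HP) ?aN // Ha addn0.
case: (ltnP a (2 * N)) => a2.
  have [nd ndN E] : exists2 nd, nd < N & a = N + nd :> nat by exists (a - N); lia.
  rewrite rd; last by lia.
  rewrite E cgain_d // (sum2 (fun b => gD P nd b : nat)).
  have [//|//|-> _ _] := Hc nd 0; have [//|//|-> _ _] := Hc nd 1.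
  by rewrite /act; case: (al _) => /=; lia.
case: (ltnP a (3 * N)) => a3.
  have [nd ndN E] : exists2 nd, nd < N & a = 2 * N + nd :> nat by exists (a - 2 * N); lia.
  rewrite rd; last by lia.
  rewrite E cgain_l //.
  have nn := next_node_lt ndN.
  have [//|//|_ -> _] := Hc nd 1; have [//|//|_ -> _] := Hc (next_node C V nd) 0.
  by rewrite /act next_node_mod //; case: (al _) => /=; lia.
case: (ltnP a (3 * N + C)) => a4; last first.
  have E : a = 3 * N + C :> nat by lia.
  by rewrite E cgain_c0 rc; lia.
have [c cC E] : exists2 c, c < C & a = 3 * N + c :> nat by exists (a - 3 * N); lia.
rewrite ru; last by lia.
rewrite E cgain_u //; have [v vV sv] := Hal c cC.
(* Each variable sends at most one point to [u], and a satisfying one sends none. *)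
suff : \sum_(v < V) \sum_(b < 2) ~~ sat c v (b == 1 :> nat) * gU sat P (c * V + v) b < V by lia.
have D : (\sum_(v' < V) 1 = V) by rewrite sum1_card card_ord.
rewrite -[X in _ < X]D (bigD1 (Ordinal vV)) //= [X in _ < X](bigD1 (Ordinal vV)) //=.
have T (v' : 'I_V) : \sum_(b < 2) ~~ sat c v' (b == 1 :> nat) * gU sat P (c * V + v') b = ~~ sat c v' (al v').
  have h : c * V + v' < N.
    rewrite /nodes; apply: (@leq_trans (c.+1 * V)); rewrite ?leq_mul //.
    by rewrite mulSn addnC ltn_add2r.
  rewrite (sum2 (fun b => ~~ sat c v' (b == 1) * gU sat P (c * V + v') b)).
  have [//|_ _ ->] := Hc _ 0 h; have [//|_ _ ->] := Hc _ 1 h.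
  rewrite /act modnMDl (modn_small (ltn_ord v')).
  by case: (al v') => /=; rewrite ?muln0 ?muln1 ?addn0.
have /= -> := T (Ordinal vV); rewrite sv /= add0n ltnS; apply: leq_sum => v' _; rewrite T.
by case: sat.
Qed.

Theorem swap_dominates : dominates Po true_vote swap_vote true_vote <-> formula_sat C V sat.
Proof.
split=> [[_ [P [HP [w1 [w2 [W1 [W2]]]]]]]|fs].
  rewrite !perm1 => lt12; have E := swap_strict_e HP W1 W2 lt12.
  by rewrite E in W2; have [_] := e_wins_sat HP W2.
split; first exact: swap_weak.
have [P [HP Pe Pz Py]] := sat_e_wins fs; exists P; split=> //.
have [w1 W1] := borda_winner_ex (swap_vote :: P) eo; exists w1, eo.
have YN := YE; have m1 := mE; have fY := fYE; have zY := zYE; have e1 := eE C V; have z1 := zE C V.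
have [s1 s2 s3] := swap_scores P.
have te : borda_score (true_vote :: P) eo = B + m.-1 + V + 3.
  by rewrite tot_cons perm1 Pe e1; lia.
have ty (a : 'I_m) : a < Y -> borda_score (true_vote :: P) a < B + m.-1 + V + 3.
  by move=> h; have := Py a h; rewrite tot_cons perm1; lia.
have tz : borda_score (true_vote :: P) zo < B + m.-1 + V + 2.
  by rewrite tot_cons perm1 Pz z1; lia.
have tf (U : {perm 'I_m}) := f_loses U HP.
have cY : c0 < Y by rewrite cE; lia.
(* [c0] is exactly one point behind [e]: the swap produces a tie between them, which favours
   [c0]. *)
have tc : borda_score (true_vote :: P) c0 = B + m.-1 + V + 2.
  have := ty c0 cY; rewrite tot_cons perm1 (score_c HP) cE; lia.
split=> //; split.
  split=> d; case: (cand_cases d) => h.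
  + by have := ty d h; rewrite te; lia.
  + by rewrite h.
  + by rewrite h; have := tf true_vote; rewrite te tc; lia.
  + by rewrite h te; lia.
  + by have := ty d h; rewrite te; lia.
  + by rewrite h.
  + by rewrite h; have := tf true_vote; rewrite te tc; lia.
  + by rewrite h te; lia.
rewrite !perm1 e1; case: (cand_cases w1) => h //.
+ have := W1.1 c0; have := W1.2 c0; rewrite h s1 //; lia.
+ by have := winner_not_f HP W1; rewrite h eqxx.
+ have := W1.1 c0; rewrite h s3 s1 //; lia.
Qed.

(** Above any unboosted score by more than the range of one vote, and above every [rho i], so that
    [T - rho i] is a genuine difference. *)
Definition boost_height := V + 2 * Y + 20.
Local Notation T := boost_height.

(* The boosters let p and q lead by far, with a tie broken for p under the true vote. *)
Lemma boost_profile (p q : 'I_m) : p < Y -> p < q -> q < Y \/ q = zo -> q <= p + 3 ->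
  exists P, [/\ in_info_set Po P, borda_score P p = B + T, borda_score P q = B + T + (q - p) &
    forall a, a != p -> a != q -> borda_score P a <= B + V + 5 + Y].
Proof.
move=> pY pq qz qp; have YN := YE; have m1 := mE; have zY := zYE; have z1 := zE C V; have e1 := eE C V.
have KE : K = V + 2 * Y + 30 by [].
(* If [q] is [z], then [q <= p + 3] forces [p] to be [c0] and [q - p = 3]; [z] is fed by the
   transfers indexed by [e], hence [T + 3] at [Y]. *)
pose hc i := if i == p :> nat then T - rho C V i
  else if q < Y then (if i == q :> nat then T + (q - p) - rho C V i else 0)
  else if i == Y then T + 3 else 0.
have hK i : hc i <= K.
  by rewrite /hc /T KE; do 3 (case: ifP => _ //; try lia).
pose P := realizer C V sat (fun _ _ => false) hc.
have HP : in_info_set Po P by apply: realizer_info.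
have HH i : i < Y.+1 -> gH P i = hc i by move=> h; rewrite realizer_H.
have Hc nd b h1 h2 := @realizer_choice C V sat (fun _ _ => false) hc nd b h1 h2.
have cg a : cgain sat P a = 0.
  rewrite /cgain big1 // => nd _; rewrite big1 // => b _.
  by have [-> -> ->] := Hc _ _ (ltn_ord nd) (ltn_ord b); rewrite !muln0.
have rmax i : i < Y.+1 -> rho C V i <= V + 5 + Y.
  by move=> h; rewrite /rho; do 4 (case: ifP => _; first lia); lia.
have Sy (a : 'I_m) : a < Y -> borda_score P a = B + hc a + rho C V a.
  move=> aY; have := score_y HP aY; rewrite cg HH 1?ltnW // addn0 big1 ?addn0 // => nd _.
  rewrite big1 ?muln0 // => b _.
  by have [-> -> ->] := Hc _ _ (ltn_ord nd) (ltn_ord b).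
have qo : q < Y -> hc q = T + (q - p) - rho C V q.
  by move=> h; rewrite /hc h eqxx gtn_eqF.
exists P; split=> //.
- by rewrite Sy // /hc eqxx /T; have := rmax p (ltnW pY); lia.
- case: qz => h; first by rewrite Sy // qo // /T; have := rmax q (ltnW h); lia.
  have n1 : (Y < Y) = false by rewrite ltnn.
  have n2 : (zo < Y) = false by rewrite z1; lia.
  have n3 : (Y == p :> nat) = false by rewrite gtn_eqF.
  by rewrite h (score_z HP z1) HH // /hc h n2 n3 eqxx; move: qp pq; rewrite h z1; lia.
move=> a ap aq; case: (cand_cases a) => h.
- have n1 : (a == p :> nat) = false by apply/negbTE.
  have n2 : (a == q :> nat) = false by apply/negbTE.
  have n3 : (a == Y :> nat) = false by rewrite ltn_eqF.
  have := rmax a (ltnW h).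
  rewrite Sy // /hc n1 n2 n3; case: ifP => _; lia.
- by rewrite h; have := score_e HP e1; have := rmax Y (ltnSn _); lia.
- by rewrite h; have := score_f HP (fE C V); lia.
- case: qz => h'; last by rewrite h h' eqxx in aq.
  have n3 : (Y == p :> nat) = false by rewrite gtn_eqF.
  by rewrite h (score_z HP z1) HH // /hc h' n3 (gtn_eqF h'); lia.
Qed.

(** In the boosted completion the true vote makes [p] and [q] tie and [p] win; a vote placing them
    closer would hand the victory to [q], which is worse. *)
Lemma dominating_gap (U : {perm 'I_m}) (p q : 'I_m) :
  (forall P, in_info_set Po P -> weakly_better true_vote U true_vote P) ->
  p < Y -> p < q -> q < Y \/ q = zo -> q <= p + 3 -> U p + (q - p) <= U q.
Proof.
move=> HU pY pq qz qp; case: leqP => // lt.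
have [P [HP Sp Sq So]] := boost_profile pY pq qz qp.
have m1 := mE; have := ltn_ord q; have := ltn_ord (U q); have := ltn_ord (U p) => ? ? ?.
have Tdef : T = V + 2 * Y + 20 by [].
have W2 : borda_winner (true_vote :: P) p.
  split=> d; rewrite !tot_cons !perm1 Sp; case: (eqVneq d p) => [->|dp];
    rewrite ?Sp //; case: (eqVneq d q) => [->|dq]; rewrite ?Sq; try lia.
    by have := So d dp dq; lia.
  by have := So d dp dq; lia.
have [w1 W1] := borda_winner_ex (U :: P) p.
have w1q : w1 = q.
  apply/eqP; apply/negPn/negP => nq; have := W1.1 q; rewrite !tot_cons Sq.
  have := ltn_ord (U w1).
  case: (eqVneq w1 p) => [->|np]; first by rewrite Sp; lia.
  by have := So w1 np nq; lia.
have := HU P HP w1 p W1 W2; rewrite !perm1 w1q; lia.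
Qed.

(** The gaps leave no slack: the [Y] candidates before [e] have increasing positions, and [z] lies
    at least three places after the last of them, [c0], among [Y + 3] positions. Only the two places
    between [c0] and [z] are left for [e] and [f]. *)
Lemma dominating_true_or_swap (U : {perm 'I_m}) :
  (forall P, in_info_set Po P -> weakly_better true_vote U true_vote P) ->
  U = true_vote \/ U = swap_vote.
Proof.
move=> HU; have YN := YE; have m1 := mE; have zY := zYE; have z1 := zE C V; have e1 := eE C V.
have f1 := fE C V; have fY := fYE; have c1 := cE C V.
have Om (i : nat) : i < Y -> i < m by lia.
have gap (a b : 'I_m) : b < Y -> b = a.+1 :> nat -> U a < U b.
  move=> bY E; have := dominating_gap HU (p := a) (q := b).
  by move=> /(_ _ _ _ _); rewrite E -addn1 => H; move: (H); lia.
have gz : U c0 + 3 <= U zo.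
  have := dominating_gap HU (p := c0) (q := zo); rewrite z1 c1 => /(_ _ _ (or_intror erefl) _); lia.
have lo i (h : i < Y) : i <= U (Ordinal (Om i h)).
  elim: i h => [//|i IH] h; have h' := ltnW h.
  by have := gap (Ordinal (Om i h')) (Ordinal (Om _ h)) h erefl; have := IH h'; lia.
have cO : c0 = Ordinal (Om _ (ltnSn (3 * N + C))) by apply: val_inj; rewrite /= c1.
have Uc : U c0 = Y.-1 :> nat.
  by have := lo _ (ltnSn (3 * N + C)); rewrite -cO; have := ltn_ord (U zo); lia.
have Uz : U zo = zo by apply: val_inj => /=; have := ltn_ord (U zo); lia.
have hi j (h : Y.-1 - j < Y) : j < Y -> U (Ordinal (Om _ h)) <= Y.-1 - j.
  elim: j h => [|j IH] h jY.
    rewrite (_ : Ordinal _ = c0) ?Uc ?subn0 //; apply: val_inj; rewrite /= c1; lia.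
  have h' : Y.-1 - j < Y by lia.
  have := gap (Ordinal (Om _ h)) (Ordinal (Om _ h')) h'; have := IH h' (ltnW jY) => /=.
  by move=> ? /(_ _); lia.
have Uy (a : 'I_m) : a < Y -> U a = a.
  move=> aY; apply: val_inj; apply/eqP; rewrite /= eqn_leq; apply/andP; split; last first.
    have := lo a aY; congr (_ <= nat_of_ord (U _)); exact: val_inj.
  have h : Y.-1 - (Y.-1 - a) < Y by lia.
  have := hi (Y.-1 - a) h; rewrite (_ : Ordinal _ = a); last by apply: val_inj => /=; lia.
  by move=> /(_ _); lia.
have Uef (a : 'I_m) : a = eo \/ a = fo -> U a = eo \/ U a = fo.
  move=> ha; have h : Y <= a < Y + 2 by case: ha => ->; rewrite ?e1 ?f1; lia.
  case: (cand_cases (U a)) => h'; [|by left|by right|].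
    have := Uy (U a) h' => /perm_inj E; rewrite E in h'; lia.
  by move: h'; rewrite -Uz => /perm_inj E; rewrite E z1 in h; lia.
have ef : eo != fo by rewrite -val_eqE /= e1 f1; lia.
have Uinj : U eo != U fo by apply/eqP => /perm_inj /eqP; rewrite (negbTE ef).
have := Uef eo (or_introl erefl); have := Uef fo (or_intror erefl).
case=> Uf [] Ue; try (by rewrite Ue Uf eqxx in Uinj).
  right; apply/permP => a; case: (cand_cases a) => [h|->|->|->].
  - by rewrite Uy // swap_lt.
  - by rewrite swap_e.
  - by rewrite swap_f.
  - by rewrite swap_z.
left; apply/permP => a; rewrite perm1.
by case: (cand_cases a) => [h|->|->|->] //; rewrite Uy.
Qed.

Theorem swap_dominating_manipulation :
  (exists U, dominates Po true_vote U true_vote) <-> formula_sat C V sat.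
Proof.
split=> [[U HU]|]; last by move/swap_dominates; exists swap_vote.
have [E|E] := dominating_true_or_swap HU.1; last by apply/swap_dominates; rewrite -E.
have [_ [P [_ [w1 [w2 [[W11 W12] [[W21 W22]]]]]]]] := HU; rewrite !perm1 => lt12.
(* The true vote cannot strictly improve on itself, since winners are unique. *)
rewrite E in W11 W12; have := W11 w2; have := W21 w1; have := W22 w1; lia.
Qed.

End Domination.

(** * Encoding of the instances *)

Lemma map_enum_ord (T : Type) m (F : nat -> T) : [seq F a | a : 'I_m <- enum 'I_m] = mkseq F m.
Proof. by rewrite /mkseq -val_enum_ord -map_comp. Qed.

Lemma flatten_mkseq (T : Type) (F : nat -> nat -> T) n k :
  flatten (mkseq (fun i => mkseq (F i) n) k) = mkseq (fun j => F (j %/ n) (j %% n)) (k * n).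
Proof.
elim: k => [|k IH]; first by rewrite mul0n.
rewrite mkseqS flatten_rcons IH mulSnr /mkseq iotaD map_cat add0n; congr (_ ++ _).
rewrite -[in RHS](addn0 (k * n)) iotaDl -map_comp; apply/eq_in_map => i.
by rewrite mem_iota add0n /= => hi; rewrite div_pair // mod_pair.
Qed.

Lemma rel_bits_mkseq m (R : nat -> nat -> bool) :
  rel_bits (fun a b : 'I_m => R a b) = mkseq (fun i => R (i %/ m) (i %% m)) (m * m).
Proof.
rewrite /rel_bits -flatten_mkseq -(@map_enum_ord _ m); congr flatten.
by apply: eq_map => a; rewrite (@map_enum_ord _ m (R a)).
Qed.

Lemma perm_bits_mkseq m (v : {perm 'I_m}) (s : nat -> nat) : (forall a, v a = s a :> nat) ->
  perm_bits v = mkseq (fun i => s (i %/ m) == i %% m) (m * m).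
Proof.
move=> E; rewrite -(rel_bits_mkseq m (fun a i => s a == i)) /perm_bits /rel_bits; congr flatten.
by apply: eq_map => a; apply: eq_map => i; rewrite -val_eqE /= E.
Qed.

Lemma size_rel_bits m (O : rel 'I_m) : size (rel_bits O) = m * m.
Proof. by rewrite size_allpairs size_enum_ord. Qed.

Lemma rel_bits_inj m : injective (@rel_bits m).
Proof.
(* Extending the relation to all numbers makes [rel_bits_mkseq] applicable. *)
pose ext (O : rel 'I_m) (a b : nat) := if insub a is Some i then if insub b is Some j then O i j else false else false.
have extE (O : rel 'I_m) : (fun a b : 'I_m => ext O a b) = O.
  by do 2 (apply: functional_extensionality => ?); rewrite /ext !valK.
move=> O O'; rewrite -[in LHS](extE O) -[in RHS](extE O') !rel_bits_mkseq => E.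
rewrite -(extE O) -(extE O').
apply: functional_extensionality => a; apply: functional_extensionality => b.
have h : a * m + b < m * m by apply: pair_lt.
have := congr1 (fun s => nth false s (a * m + b)) E.
by rewrite !nth_mkseq // div_pair // mod_pair.
Qed.

Lemma perm_bits_inj m : injective (@perm_bits m).
Proof.
move=> u v E; apply/permP => a.
have := @rel_bits_inj m (fun a i => u a == i) (fun a i => v a == i) E.
by move/(congr1 (fun O => O a (u a))); rewrite /= eqxx => /esym /eqP.
Qed.

Lemma unary_inj k k' (s s' : seq bool) : unary k ++ s = unary k' ++ s' -> k = k' /\ s = s'.
Proof.
rewrite /unary; elim: k k' => [|k IH] [|k'] //= [].
  by move=> ->.
by move/IH => [-> ->].
Qed.

Lemma cat_inj (s1 s2 t1 t2 : seq bool) : size s1 = size t1 -> s1 ++ s2 = t1 ++ t2 -> s1 = t1 /\ s2 = t2.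
Proof. by move=> h /eqP; rewrite eqseq_cat // => /andP [/eqP -> /eqP ->]. Qed.

Lemma size_perm_bits m (v : {perm 'I_m}) : size (perm_bits v) = m * m.
Proof. by rewrite size_allpairs size_enum_ord. Qed.

Lemma enc_profile_cat m (Po : seq (rel 'I_m)) s :
  enc_profile Po ++ s = unary m ++ (unary (size Po) ++ (flatten (map (@rel_bits m) Po) ++ s)).
Proof. by rewrite /enc_profile -catA -[(unary (size Po) ++ _) ++ s]catA. Qed.

Lemma enc_profile_size m (Po : seq (rel 'I_m)) m' (Po' : seq (rel 'I_m')) s s' :
  enc_profile Po ++ s = enc_profile Po' ++ s' -> m = m'.
Proof. by rewrite !enc_profile_cat => /unary_inj []. Qed.

(** The unary headers fix the number and the length of the blocks, so the encoding is
    self-delimiting. *)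
Lemma enc_profile_inj m (Po Po' : seq (rel 'I_m)) s s' :
  enc_profile Po ++ s = enc_profile Po' ++ s' -> Po = Po' /\ s = s'.
Proof.
rewrite !enc_profile_cat => /unary_inj [_ /unary_inj []].
elim: Po Po' => [|O Po IH] [|O' Po'] //= [E]; rewrite -!catA => /cat_inj [].
  by rewrite !size_rel_bits.
by move=> /rel_bits_inj -> /(IH _ E) [-> ->].
Qed.

(** The language quantifies over all instances with the given encoding; injectivity leaves only the
    intended one. *)
Lemma domination_enc m (Po : seq (rel 'I_m)) (VM V U : {perm 'I_m}) : admissible Po ->
  DOMINATION_4 (enc_domination Po VM V U) <-> dominates Po VM U V.
Proof.
move=> adm; split=> [[m' [Po' [VM' [V' [U' [E [_ D]]]]]]]|D]; last by exists m, Po, VM, V, U.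
have M := enc_profile_size E; subst m'.
have [e1 E1] := enc_profile_inj E.
have [|e2 E2] := cat_inj _ E1; first by rewrite !size_perm_bits.
have [|e3 e4] := cat_inj _ E2; first by rewrite !size_perm_bits.
by rewrite e1 (perm_bits_inj e2) (perm_bits_inj e3) (perm_bits_inj e4).
Qed.

Lemma dom_manip_enc m (Po : seq (rel 'I_m)) (VM : {perm 'I_m}) : admissible Po ->
  DOMINATING_MANIPULATION_4 (enc_dom_manip Po VM) <-> exists U, dominates Po VM U VM.
Proof.
move=> adm; split=> [[m' [Po' [VM' [E [_ D]]]]]|D]; last by exists m, Po, VM.
have M := enc_profile_size E; subst m'.
by have [e1 /perm_bits_inj e2] := enc_profile_inj E; rewrite e1 e2.
Qed.

Lemma PF_key t0 t1 t2 t3 a : PF t0 -> PF t1 -> PF t2 -> PF t3 -> PF a ->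
  PF (fun x e => key (t0 x e) (t1 x e) (t2 x e) (t3 x e) (a x e)).
Proof. by move=> *; rewrite /key; pf. Qed.

Lemma PB_gad t0 t1 t2 t3 w fl a b : PF t0 -> PF t1 -> PF t2 -> PF t3 -> PF w -> PB fl -> PF a -> PF b ->
  PB (fun x e => gad (t0 x e) (t1 x e) (t2 x e) (t3 x e) (w x e) (fl x e) (a x e) (b x e)).
Proof.
move=> *; rewrite /gad.
by do ! first [assumption | apply: PF_key | pf1].
Qed.

(** * Membership of the encoded instances in the class [PF] *)

Section Instance.
Variables (NC NV : seq bool -> nat) (sat : seq bool -> nat -> nat -> bool -> bool).
Hypotheses (HC : PF (fun x _ => NC x)) (HV : PF (fun x _ => NV x)).
Hypothesis Hsat : forall c v y, PF c -> PF v -> PB y -> PB (fun x e => sat x (c x e) (v x e) (y x e)).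

Ltac pfi := do ! first [assumption | apply: Hsat | pf1].

Lemma PF_nodes : PF (fun x _ => nodes (NC x) (NV x)). Proof. by rewrite /nodes; pfi. Qed.
Lemma PF_e : PF (fun x _ => cand_e (NC x) (NV x)).
Proof. by have := PF_nodes; rewrite /cand_e => ?; pfi. Qed.
Lemma PF_f : PF (fun x _ => cand_f (NC x) (NV x)).
Proof. by have := PF_e; rewrite /cand_f => ?; pfi. Qed.
Lemma PF_z : PF (fun x _ => cand_z (NC x) (NV x)).
Proof. by have := PF_e; rewrite /cand_z => ?; pfi. Qed.
Lemma PF_m : PF (fun x _ => ncand (NC x) (NV x)).
Proof. by have := PF_e; rewrite /ncand => ?; pfi. Qed.
Lemma PF_copies : PF (fun x _ => copies (NC x) (NV x)).
Proof. by have := PF_e; rewrite /copies => ?; pfi. Qed.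
Lemma PF_ngad : PF (fun x _ => ngad (NC x) (NV x)).
Proof. by have := PF_e; have := PF_copies; have := PF_nodes; rewrite /ngad => *; pfi. Qed.

Section Gadgets.
Variable g : seq bool -> seq nat -> nat.
Hypothesis Hg : PF g.

Lemma PF_prev : PF (fun x e => prev (NC x) (NV x) (g x e)).
Proof. by have := PF_nodes; rewrite /prev => *; pfi. Qed.
Lemma PF_rho : PF (fun x e => rho (NC x) (NV x) (g x e)).
Proof. by have := PF_nodes; rewrite /rho => *; pfi. Qed.
Lemma PB_choice : PB (fun x e => choice (NC x) (NV x) (g x e)).
Proof. by have := PF_nodes; rewrite /choice => *; pfi. Qed.
Lemma PF_pcand : PF (fun x e => pcand (NC x) (NV x) (g x e)).
Proof. by have := PF_nodes; have := PF_copies; rewrite /pcand => *; pfi. Qed.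
Lemma PF_pcopy : PF (fun x e => pcopy (NC x) (NV x) (g x e)).
Proof. by have := PF_nodes; have := PF_copies; rewrite /pcopy => *; pfi. Qed.
Lemma PB_pboost : PB (fun x e => pboost (NC x) (NV x) (g x e)).
Proof.
by have := PF_pcand; have := PF_pcopy; have := PF_copies; have := PF_e; rewrite /pboost => *; pfi.
Qed.
End Gadgets.

Section Tops.
Variable g : seq bool -> seq nat -> nat.
Hypothesis Hg : PF g.

Let Hg2 : PF (fun x e => g x e %/ 2). Proof. by pfi. Qed.
Let Hc := PB_choice Hg. Let Hb := PB_pboost Hg. Let Hp := PF_pcand Hg. Let Hk := PF_pcopy Hg.
Let HN := PF_nodes. Let He := PF_e. Let Hf := PF_f. Let Hz := PF_z. Let HK := PF_copies.

Lemma PF_top0 : PF (fun x e => top0 (NC x) (NV x) (g x e)).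
Proof. by rewrite /top0; pfi. Qed.
Lemma PF_top1 : PF (fun x e => top1 (NC x) (NV x) (g x e)).
Proof. by rewrite /top1; pfi. Qed.
Lemma PF_top2 : PF (fun x e => top2 (NC x) (NV x) (g x e)).
Proof. by have := PF_top1; have := PF_prev Hg2; rewrite /top2 => *; pfi. Qed.
Lemma PF_top3 : PF (fun x e => top3 (NC x) (NV x) (sat x) (g x e)).
Proof. by have := PF_top1; rewrite /top3 => *; pfi. Qed.
Lemma PF_wid : PF (fun x e => wid (NC x) (NV x) (g x e)).
Proof. by have := PF_rho Hp; rewrite /wid => *; pfi. Qed.
Lemma PB_flp : PB (fun x e => flp (NC x) (NV x) (g x e)).
Proof. by have := PF_rho Hp; rewrite /flp => *; pfi. Qed.
End Tops.

Lemma PB_vote_rel j a b : PF j -> PF a -> PF b ->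
  PB (fun x e => vote_rel (NC x) (NV x) (sat x) (j x e) (a x e) (b x e)).
Proof.
move=> Hj Ha Hb; have Hj2 : PF (fun x e => j x e %/ 2) by pfi.
have h0 := PF_top0 Hj2; have h1 := PF_top1 Hj2; have h2 := PF_top2 Hj2; have h3 := PF_top3 Hj2.
have h4 := PF_wid Hj2; have h5 := PB_flp Hj2.
rewrite /vote_rel; apply: PBif; first by pfi.
  exact: PB_gad.
by apply: PBleq; [apply: PFS|]; apply: PF_key.
Qed.

Lemma flatten_profile x : let m := ncand (NC x) (NV x) in
  flatten (map (@rel_bits m) (profile (NC x) (NV x) (sat x))) =
  mkseq (fun i => vote_rel (NC x) (NV x) (sat x) (i %/ (m * m)) (i %% (m * m) %/ m) (i %% (m * m) %% m))
        (ngad (NC x) (NV x) * 2 * (m * m)).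
Proof.
move=> m; rewrite -(flatten_mkseq (fun j i => vote_rel (NC x) (NV x) (sat x) j (i %/ m) (i %% m))).
rewrite /profile /mkseq -map_comp; congr flatten.
by apply: eq_map => j /=; rewrite rel_bits_mkseq.
Qed.

Lemma PFword_profile : PFword (fun x => enc_profile (profile (NC x) (NV x) (sat x))).
Proof.
have Hm := PF_m; have HG := PF_ngad.
apply: PFword_cat; first exact: PFword_unary.
apply: PFword_cat.
  apply: PFword_ext (PFword_unary (N := fun x => ngad (NC x) (NV x) * 2) _) _ => [|x]; first by pfi.
  by rewrite /profile size_mkseq.
apply: PFword_ext (PFword_mkseq _ _) (fun x => esym (flatten_profile x)) => [|a Ha]; first by pfi.
by apply: PB_vote_rel; pfi.
Qed.

Lemma PFword_true : PFword (fun x => perm_bits (true_vote (NC x) (NV x))).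
Proof.
have Hm := PF_m.
apply: PFword_ext (PFword_mkseq (N := fun x => ncand (NC x) (NV x) * ncand (NC x) (NV x))
  (p := fun x i => i %/ ncand (NC x) (NV x) == i %% ncand (NC x) (NV x)) _ _) _ => [|a Ha|x]; try by pfi.
by rewrite (@perm_bits_mkseq _ _ id) // => a; rewrite perm1.
Qed.

Lemma PFword_swap : PFword (fun x => perm_bits (swap_vote (NC x) (NV x))).
Proof.
have Hm := PF_m; have He := PF_e; have Hf := PF_f.
pose s x a := if a == cand_e (NC x) (NV x) then cand_f (NC x) (NV x)
              else if a == cand_f (NC x) (NV x) then cand_e (NC x) (NV x) else a.
apply: PFword_ext (PFword_mkseq (N := fun x => ncand (NC x) (NV x) * ncand (NC x) (NV x))
  (p := fun x i => s x (i %/ ncand (NC x) (NV x)) == i %% ncand (NC x) (NV x)) _ _) _ => [|a Ha|x].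
- by pfi.
- by rewrite /s; pfi.
rewrite (@perm_bits_mkseq _ _ (s x)) // => a; rewrite /s /swap_vote.
case: tpermP => [->|->|]; rewrite ?eE ?fE ?eqxx //.
  by rewrite /cand_f gtn_eqF.
move=> /eqP; rewrite -val_eqE /= eE => /negbTE -> /eqP; by rewrite -val_eqE /= fE => /negbTE ->.
Qed.

End Instance.

Theorem theorem4 :
  NP_hard DOMINATION_4 /\ NP_hard DOMINATING_MANIPULATION_4.
Proof.
split=> L /cook_levin [NC [NV [sat [HC HV Hsat HL]]]].
- exists (fun x => enc_domination (profile (NC x) (NV x) (sat x)) (true_vote _ _) (true_vote _ _) (swap_vote _ _)).
  split; last by move=> x; rewrite HL domination_enc ?swap_dominates //; exact: profile_admissible.
  apply: PFword_poly; apply: PFword_cat; first exact: PFword_profile.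
  apply: PFword_cat; first exact: PFword_true.
  by apply: PFword_cat; [exact: PFword_true|exact: PFword_swap].
- exists (fun x => enc_dom_manip (profile (NC x) (NV x) (sat x)) (true_vote _ _)).
  split; last first.
    by move=> x; rewrite HL dom_manip_enc ?swap_dominating_manipulation //; exact: profile_admissible.
  by apply: PFword_poly; apply: PFword_cat; [exact: PFword_profile|exact: PFword_true].
Qed.
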